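(* Let $D$ be a bounded minimally convex domain in $\mathbb{R}^n$, $n\ge 3$, with $\mathscr{C}^r$ boundary $bD$ for some real number $r>2$. (1) If $M$ is a connected open conformal surface and $f:M\to\mathbb{R}^n$ is a conformal harmonic map with $f(M)\subset\overline{D}$, then either $f(M)\subset D$ or $f(M)\subset bD$. (2) If $M$ is a connected open conformal surface and $K\subset M$ is a removable set for bounded harmonic functions, then every conformal harmonic map $M\setminus K\to D$ extends to a conformal harmonic map $M\to D$. (3) In particular, every conformal harmonic map $\mathbb{D}^*\to D$ extends to a conformal harmonic map $\mathbb{D}\to D$.
   Context: $\mathbb{D}=\{z\in\mathbb{C}:|z|<1\}$ and $\mathbb{D}^*=\mathbb{D}\setminus\{0\}$. For a real symmetric form, the trace on a $2$-plane $\Lambda\subset\mathbb{R}^n$ is that of its restriction to $\Lambda$. A $\mathscr{C}^2$ function $\rho$ on a domain in $\mathbb{R}^n$ is $2$-plurisubharmonic if $\mathrm{tr}_\Lambda\,\mathrm{Hess}_\rho(\mathbf{x})\ge 0$ for every point $\mathbf{x}$ and every $2$-dimensional linear subspace $\Lambda\subset\mathbb{R}^n$, and strongly $2$-plurisubharmonic if the inequality is always strict. A domain $D\subset\mathbb{R}^n$ is minimally convex (i.e. $2$-convex) if it admits a strongly $2$-plurisubharmonic exhaustion function $\rho:D\to\mathbb{R}$, meaning that $\{\mathbf{x}\in D:\rho(\mathbf{x})\le c\}$ is compact for every $c\in\mathbb{R}$. For bounded domains with smooth boundary the paper uses the known fact (Harvey–Lawson) that this is equivalent to $2$-convexity of the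 boundary: $\nu_1(\mathbf{x})+\nu_2(\mathbf{x})\ge 0$ for every $\mathbf{x}\in bD$, where $\nu_1(\mathbf{x})\le\cdots\le\nu_{n-1}(\mathbf{x})$ are the principal curvatures of $bD$ at $\mathbf{x}$ with respect to the inner unit normal (nonnegative when $D$ is convex). For noninteger $r=k+\alpha$ with $k$ an integer and $0<\alpha<1$, $\mathscr{C}^r$ means the Hölder class $\mathscr{C}^{k,\alpha}$. A set $K\subset M$ is removable for bounded harmonic functions if it is closed and every bounded harmonic function on $M\setminus K$ extends to a harmonic function on $M$. *)

(* Defs.v *)
From HB Require Import structures.
From mathcomp Require Import all_boot all_order all_algebra.
From mathcomp Require Import all_classical all_reals all_analysis.
Set Implicit Arguments.
Unset Strict Implicit.
Unset Printing Implicit Defensive.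
Import Order.TTheory GRing.Theory Num.Theory.
Import numFieldNormedType.Exports.
Local Open Scope classical_set_scope.
Local Open Scope ring_scope.

(* The norm of MathComp-Analysis on 'rV[R]_n is the sup norm; it induces the
   usual topology, but Euclidean lengths and angles are expressed by dot. *)
Definition dot (R : realType) (n : nat) (u v : 'rV[R]_n) : R :=
  \sum_(i < n) u 0 i * v 0 i.

Definition partial (R : realType) (m : nat) (V : normedModType R) (i : 'I_m)
  (f : 'rV[R]_m -> V) : 'rV[R]_m -> V :=
  fun x => 'D_(delta_mx 0 i) f x.

Definition iter_partial (R : realType) (m : nat) (V : normedModType R)
  (s : seq 'I_m) (f : 'rV[R]_m -> V) : 'rV[R]_m -> V :=
  foldr (fun i g => partial i g) f s.

(* 'D_v f x is total, so the existence of the partial derivatives is required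
   separately. *)
Definition class_Ck (R : realType) (m : nat) (V : normedModType R) (k : nat)
  (U : set 'rV[R]_m) (f : 'rV[R]_m -> V) : Prop :=
  forall (s : seq 'I_m) (x : 'rV[R]_m), U x ->
    ((size s <= k)%N -> {for x, continuous (iter_partial s f)}) /\
    ((size s < k)%N ->
      forall i : 'I_m, derivable (iter_partial s f) x (delta_mx 0 i)).

Definition locally_holder (R : realType) (m : nat) (V : normedModType R)
  (a : R) (U : set 'rV[R]_m) (g : 'rV[R]_m -> V) : Prop :=
  forall x, U x -> exists (C : R) (W : set 'rV[R]_m),
    nbhs x W /\ forall y z, W y -> W z -> `|g y - g z| <= C * `|y - z| `^ a.

(* For integer r this is C^r; for noninteger r = k + a it is C^{k,a}. *)
Definition class_Cr (R : realType) (m : nat) (V : normedModType R) (r : R)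
  (U : set 'rV[R]_m) (f : 'rV[R]_m -> V) : Prop :=
  let k := Num.truncn r in
  class_Ck k U f /\
  (k%:R < r -> forall s : seq 'I_m, size s = k ->
     locally_holder (r - k%:R) U (iter_partial s f)).

Definition domain (R : realType) (n : nat) (D : set 'rV[R]_n) : Prop :=
  [/\ open D, connected D & D !=set0].

Definition bd (T : topologicalType) (D : set T) : set T :=
  closure D `\` interior D.

(* Local defining functions with nonvanishing gradient. *)
Definition has_Cr_boundary (R : realType) (n : nat) (r : R)
  (D : set 'rV[R]_n) : Prop :=
  forall p, bd D p -> exists (U : set 'rV[R]_n) (g : 'rV[R]_n -> R),
    [/\ open U /\ U p,
        class_Cr r U g,
        forall x, U x -> exists i : 'I_n, partial i g x != 0,
        D `&` U = [set x | U x /\ g x < 0] &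
        bd D `&` U = [set x | U x /\ g x = 0]].

Definition hessian (R : realType) (n : nat) (rho : 'rV[R]_n -> R)
  (x : 'rV[R]_n) : 'M[R]_n :=
  \matrix_(i < n, j < n) partial i (partial j rho) x.

Definition orthonormal_basis (R : realType) (n k : nat)
  (L : {vspace 'rV[R]_n}) (e : k.-tuple 'rV[R]_n) : Prop :=
  basis_of L e /\
  forall i j : 'I_k, dot (tnth e i) (tnth e j) = (i == j)%:R.

(* The trace of the restriction of H to L is computed in an orthonormal basis;
   it does not depend on the basis, hence the quantification over all of them. *)
Definition strongly_2_plurisubharmonic (R : realType) (n : nat)
  (D : set 'rV[R]_n) (rho : 'rV[R]_n -> R) : Prop :=
  class_Ck 2 D rho /\
  forall x, D x -> forall L : {vspace 'rV[R]_n}, \dim L = 2%N ->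
  forall e : 2.-tuple 'rV[R]_n, orthonormal_basis L e ->
    0 < \sum_(i < 2) dot (tnth e i *m hessian rho x) (tnth e i).

Definition exhaustion (R : realType) (n : nat)
  (D : set 'rV[R]_n) (rho : 'rV[R]_n -> R) : Prop :=
  forall c : R, compact [set x | D x /\ rho x <= c].

Definition minimally_convex (R : realType) (n : nat) (D : set 'rV[R]_n)
  : Prop :=
  exists rho : 'rV[R]_n -> R,
    strongly_2_plurisubharmonic D rho /\ exhaustion D rho.

Notation plane R := 'rV[R]_2.

(* Conformality in the weak sense (the differential may vanish), as usual for
   conformal harmonic maps: branch points and constant maps are allowed. *)
Definition conformal_at (R : realType) (n : nat) (f : plane R -> 'rV[R]_n)
  (z : plane R) : Prop :=
  dot (partial 0 f z) (partial 0 f z) = dot (partial 1 f z) (partial 1 f z) /\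
  dot (partial 0 f z) (partial 1 f z) = 0.

Definition planar_harmonic (R : realType) (V : normedModType R)
  (U : set (plane R)) (h : plane R -> V) : Prop :=
  class_Ck 2 U h /\
  forall z, U z -> partial 0 (partial 0 h) z + partial 1 (partial 1 h) z = 0.

Definition planar_conformal_harmonic (R : realType) (n : nat)
  (U : set (plane R)) (f : plane R -> 'rV[R]_n) : Prop :=
  planar_harmonic U f /\ forall z, U z -> conformal_at f z.

(* On each connected component of the open set U such a map is holomorphic or
   antiholomorphic with nowhere vanishing derivative. *)
Definition planar_conformal_immersion (R : realType)
  (U : set (plane R)) (g : plane R -> plane R) : Prop :=
  class_Ck 1 U g /\
  forall z, U z -> conformal_at g z /\ partial 0 g z != 0.

(* chart_map and chart_inv are meaningful only on chart_dom and on its image. *)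
Record chart (R : realType) (T : topologicalType) := Chart {
  chart_dom : set T;
  chart_map : T -> plane R;
  chart_inv : plane R -> T }.

Definition is_chart (R : realType) (T : topologicalType) (c : chart R T)
  : Prop :=
  let img := chart_map c @` chart_dom c in
  [/\ open (chart_dom c), open img,
      forall x, chart_dom c x -> chart_inv c (chart_map c x) = x,
      forall x, chart_dom c x -> {for x, continuous (chart_map c)} &
      forall z, img z -> {for z, continuous (chart_inv c)}].

(* Conformal surfaces need not be orientable: transition maps may reverse the
   orientation. *)
Record conformal_surface (R : realType) := ConformalSurface {
  surface_space :> topologicalType;
  surface_hausdorff : hausdorff_space surface_space;
  surface_second_countable : @second_countable surface_space;
  atlas : set (chart R surface_space);
  atlas_chart : forall c, atlas c -> is_chart c;
  atlas_cover : forall x, exists2 c, atlas c & chart_dom c x;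
  atlas_conformal : forall c d, atlas c -> atlas d ->
    planar_conformal_immersion
      (chart_map c @` (chart_dom c `&` chart_dom d))
      (chart_map d \o chart_inv c) }.

Definition connected_open_surface (R : realType) (M : conformal_surface R)
  : Prop :=
  connected [set: M] /\ ~ compact [set: M].

(* Functions on an open subset U of M are total functions on M whose values
   outside U are irrelevant. *)
Definition harmonic_on (R : realType) (V : normedModType R)
  (M : conformal_surface R) (U : set M) (h : M -> V) : Prop :=
  forall c : chart R M, atlas c ->
    planar_harmonic (chart_map c @` (chart_dom c `&` U)) (h \o chart_inv c).

Definition conformal_harmonic_on (R : realType) (n : nat)
  (M : conformal_surface R) (U : set M) (f : M -> 'rV[R]_n) : Prop :=
  forall c : chart R M, atlas c ->
    planar_conformal_harmonic (chart_map c @` (chart_dom c `&` U))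
      (f \o chart_inv c).

Definition removable (R : realType) (M : conformal_surface R) (K : set M)
  : Prop :=
  closed K /\
  forall h : M -> R,
    harmonic_on (~` K) h ->
    (exists B : R, forall x, (~` K) x -> `|h x| <= B) ->
    exists H : M -> R,
      harmonic_on [set: M] H /\ forall x, (~` K) x -> H x = h x.

Definition disc (R : realType) : set (plane R) := [set z | dot z z < 1].

Definition punctured_disc (R : realType) : set (plane R) :=
  @disc R `\ (0 : plane R).

(* Main.v *)
(* If rho is strongly 2-plurisubharmonic and F is a conformal harmonic
   immersion, then rho o F is strictly subharmonic.  Suppose that the second
   fundamental form of bD has negative trace on a conformal tangent pair.  A
   small Enneper surface with suitable second-order contact at the point then
   lies in D except for the point itself; pushing it into D and applying the
   maximum principle to the exhaustion rho along the resulting family of discs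
   gives a contradiction.  Thus bD is 2-convex.  By 2-convexity and a Hopf
   barrier, pushing the map by a small multiple of a Gaussian barrier in a
   direction transverse to bD, the set where a conformal harmonic map into the
   closure of D meets bD is open; as it is also closed, this gives (1).

   For (2), the components of the map extend by removability.  The complement
   of K is dense: otherwise a disc inside K touches the closure of the
   complement at a point q, and Perron's method yields a bounded harmonic
   function off the disc behaving like |z - q|^(1/2) near q, which has no
   extension differentiable at q.  Hence the extension is conformal with values
   in the closure of D, and its contact set, being open, would meet the
   complement of K if it were nonempty.  The same argument gives (3), as
   isolated singularities of bounded harmonic functions are removable.

   Transition maps are only known to be conformal of class C^1; comparing their
   components, which have the mean value property, with Poisson integrals shows
   that they are harmonic. *)

Require Import Defs.
From HB Require Import structures.
From mathcomp Require Import all_boot all_order all_algebra.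
From mathcomp Require Import all_classical all_reals all_analysis.
From mathcomp Require Import ring lra.
Set Implicit Arguments.
Unset Strict Implicit.
Unset Printing Implicit Defensive.
Import Order.TTheory GRing.Theory Num.Theory.
Import Num.Def numFieldNormedType.Exports.
Local Open Scope classical_set_scope.
Local Open Scope ring_scope.

(** * Partial derivatives and the chain rule *)

Section Basics.
Variable R : realType.

(** The comparison functions of the proof are maxima, glued functions and Dirichlet solutions
    continued by the old values outside a disc. They are continuous but not C^2, so subharmonicity
    is tested with C^2 functions touching from above. This notion passes to maxima at once and is
    carried through conformal changes of coordinates by composing the test function.

    In the contact argument the pushed map f + w e is no longer conformal, so 2-convexity does not
    apply to its differential directly. At a contact point its partial derivatives are tangent to
    the level set of a C^2 defining function, and they fail to be conformal by at most a constant
    times the gradient of w. For w a small multiple of exp(-al |z|^2) - const the gradient carries a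
    factor al, and the Laplacian, on an annulus away from the centre, a factor al^2; a large al
    therefore absorbs the defect.

    In the density argument the exponent 1/2 is chosen because the harmonic barrier of a disc is of
    linear size at q and a function differentiable at q is Lipschitz there, while |z - q|^(1/2)
    exceeds every linear bound. *)

Lemma is_derive_line (V W : normedModType R) (f : V -> W) (y v : V) (t : R) d :
  is_derive (t *: v + y) v f d -> is_derive t 1 (fun s : R => f (s *: v + y)) d.
Proof.
rewrite /derive => -[h1 h2]; have E : (fun h : R => h^-1 *: (f (h *: v + (t *: v + y)) - f (t *: v + y))) =
  (fun h : R => h^-1 *: (f ((h *: (1:R) + t) *: v + y) - f (t *: v + y))).
  by apply/funext => h; rewrite scalerDl addrA [h *: (1:R)]mulr1.
split; first by move: h1; rewrite /derivable /= E.
by move: h2; rewrite /derive /= E.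
Qed.

Lemma line_mvt (V : normedModType R) (f : V -> R) (y v : V) (s : R) (g : R -> R) :
  (forall t : R, `|t| <= `|s| -> is_derive (t *: v + y) v f (g t)) ->
  exists2 t, `|t| <= `|s| & f (s *: v + y) - f y = s * g t.
Proof.
move=> H.
have Hd (t : R) : `|t| <= `|s| -> is_derive t 1 (fun s : R => f (s *: v + y)) (g t).
  by move=> /H /is_derive_line.
have Hc (a b : R) : (forall t, t \in `[a, b] -> `|t| <= `|s|) ->
    {within `[a, b], continuous (fun s : R => f (s *: v + y))}.
  move=> ab; apply: derivable_within_continuous => t /ab /Hd; case=> //.
have [s0|s0|<-] := ltgtP 0 s; last first.
- by exists 0; rewrite ?scale0r ?add0r ?subrr ?mul0r.
- have ab : forall t, t \in `[s, 0] -> `|t| <= `|s|.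
    move=> t; rewrite in_itv/= => /andP[h1 h2].
    by rewrite (ltr0_norm s0) ler0_norm// lerN2.
  have [t|t] := @MVT _ _ g _ _ s0 _ (Hc _ _ ab).
    by move=> /subset_itv_oo_cc/ab/Hd; apply.
  move=> /subset_itv_oo_cc/ab h; rewrite scale0r add0r sub0r => e; exists t => //.
  by rewrite -opprB e; ring.
- have ab : forall t, t \in `[0, s] -> `|t| <= `|s|.
    move=> t; rewrite in_itv/= => /andP[h1 h2].
    by rewrite (gtr0_norm s0) ger0_norm.
  have [t|t] := @MVT _ _ g _ _ s0 _ (Hc _ _ ab).
    by move=> /subset_itv_oo_cc/ab/Hd; apply.
  move=> /subset_itv_oo_cc/ab h; rewrite scale0r add0r => e; exists t => //.
  by rewrite e; ring.
Qed.

(** The derivatives [g] are an explicit argument, so that the rules of calculus produce them as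
    formulas. The condition holds on a neighbourhood of [x], hence it expresses C^1 regularity near
    [x] and spreads to nearby points. *)
Definition has_partials (m : nat) (f : 'rV[R]_m -> R) (x : 'rV[R]_m)
    (g : 'I_m -> 'rV[R]_m -> R) : Prop :=
  \forall y \near x, forall i,
    is_derive y (delta_mx 0 i) f (g i y) /\ {for y, continuous (g i)}.

Lemma mx_norm_le (m : nat) (v : 'rV[R]_m) i : `|v 0 i| <= `|v|.
Proof. by rewrite [leRHS]/Num.Def.normr/= mx_normrE; apply: (le_bigmax _ _ (0, i)). Qed.

Lemma mx_norm_leP (m : nat) (v : 'rV[R]_m) (e : R) : 0 <= e ->
  (forall i, `|v 0 i| <= e) -> `|v| <= e.
Proof.
move=> e0 H; rewrite [leLHS]/Num.Def.normr/= mx_normrE; apply: bigmax_le => // -[i j] _ /=.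
by rewrite ord1.
Qed.

(** Continuous partial derivatives give Frechet differentiability: the increment is split into steps
    along the coordinate axes, and the mean value theorem is applied to each step. *)
Lemma has_partials_taylor (m : nat) (f : 'rV[R]_m -> R) x g : has_partials f x g ->
  forall e, 0 < e -> \forall h \near (0 : 'rV[R]_m),
    `|f (h + x) - f x - \sum_i h 0 i * g i x| <= e * `|h|.
Proof.
move=> fg e e0; pose e1 := e / m.+1%:R.
have e10 : 0 < e1 by rewrite divr_gt0.
have : \forall y \near x, forall i, is_derive y (delta_mx 0 i) f (g i y) /\ `|g i y - g i x| <= e1.
  have H2 : \forall y \near x, forall i, `|g i y - g i x| <= e1.
    apply: (@filter_forall _ _ (fun i y => `|g i y - g i x| <= e1) (nbhs x)) => i; have [_] := nbhs_singleton fg i.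
    by move=> /cvgr_distC_le /(_ _ e10).
  by apply: filterS2 fg H2 => y A B i; have [] := A i.
move=> /nbhs_ballP[d /= d0 H].
apply/nbhs_ballP; exists d => //= h; rewrite -ball_normE /= sub0r normrN => hd.
(* [p k] keeps the first [k] coordinates of [h]. Each of the [m] steps costs at most [e1] times the
   norm of [h], and [e1] is [e] divided by m + 1 so that the costs add up to less than [e]. *)
pose p k := \row_i (if (i < k)%N then h 0 i else 0) : 'rV[R]_m.
have pk k : `|p k| <= `|h|.
  apply: mx_norm_leP => // i; rewrite mxE; case: ifP => _; first exact: mx_norm_le.
  by rewrite normr0.
have H' y : `|y| <= `|h| -> forall i, is_derive (y + x) (delta_mx 0 i) f (g i (y + x)) /\
    `|g i (y + x) - g i x| <= e1.
  move=> yh; apply: H; rewrite -ball_normE /ball_/= opprD addrCA subrr addr0 normrN.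
  exact: le_lt_trans yh hd.
have ind k : (k <= m)%N ->
    `|f (p k + x) - f x - \sum_(i < m | (i < k)%N) h 0 i * g i x| <= k%:R * (e1 * `|h|).
  elim: k => [_|k IH km].
    rewrite big_pred0 // subr0 (_ : p 0%N = 0); last by apply/rowP => i; rewrite !mxE.
    by rewrite add0r subrr normr0 mul0r.
  pose i0 := Ordinal km.
  have pS : p k.+1 = h 0 i0 *: delta_mx 0 i0 + p k.
    apply/rowP => i; rewrite !mxE eqxx /= ltnS leq_eqVlt.
    have [->|ni] := eqVneq i i0; first by rewrite eqxx /= ltnn mulr1 addr0.
    have -> : (i == k :> nat) = false by apply/negbTE; rewrite -(inj_eq val_inj) in ni.
    by rewrite mulr0 add0r.
  have np t : `|t| <= `|h 0 i0| -> `|t *: delta_mx 0 i0 + p k| <= `|h|.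
    move=> th; apply: mx_norm_leP => // i; rewrite !mxE eqxx /=.
    have [->|ni] := eqVneq i i0; first by rewrite ltnn mulr1 addr0 (le_trans th)// mx_norm_le.
    rewrite mulr0 add0r; case: ifP => _; last by rewrite normr0.
    exact: mx_norm_le.
  have [t th] := @line_mvt _ f (p k + x) (delta_mx 0 i0) (h 0 i0)
      (fun t => g i0 (t *: delta_mx 0 i0 + p k + x))
      (fun t th => ltac:(by rewrite addrA; have [] := H' _ (np _ th) i0)).
  rewrite addrA -pS => E.
  rewrite (bigD1 i0) //= (eq_bigl (fun i : 'I_m => (i < k)%N)); last first.
    move=> i; rewrite ltnS leq_eqVlt andb_orl.
    have [->|ni] := eqVneq i i0; first by rewrite ltnn eqxx.
    have -> : (i == k :> nat) = false by apply/negbTE; rewrite -(inj_eq val_inj) in ni.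
    by rewrite /= andbT.
  have -> : f (p k.+1 + x) - f x - (h 0 i0 * g i0 x + \sum_(i < m | (i < k)%N) h 0 i * g i x) =
     (f (p k + x) - f x - \sum_(i < m | (i < k)%N) h 0 i * g i x) +
     (h 0 i0 * (g i0 (t *: delta_mx 0 i0 + p k + x) - g i0 x)).
    by rewrite mulrBr -E; ring.
  apply: (le_trans (ler_normD _ _)).
  rewrite -natr1 mulrDl mul1r; apply: lerD; first exact: IH (ltnW km).
  rewrite normrM mulrC; apply: ler_pM => //; last exact: mx_norm_le.
  by have [] := H' _ (np _ th) i0.
have := ind m (leqnn m).
rewrite (_ : p m = h); last by apply/rowP => i; rewrite mxE ltn_ord.
have -> : \sum_(i < m | (i < m)%N) h 0 i * g i x = \sum_i h 0 i * g i x.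
  by apply: eq_bigl => i; rewrite ltn_ord.
move=> /le_trans; apply; rewrite mulrA ler_wpM2r// /e1 mulrCA.
rewrite ler_piMr ?(ltW e0)// ler_pdivrMr// mul1r ler_nat //.
Unshelve. all: by end_near. Qed.


Lemma cvg_fin_sum (T : Type) (F : set_system T) (FF : Filter F) (I : finType)
    (f : I -> T -> R) (l : I -> R) :
  (forall i, f i x @[x --> F] --> l i) -> \sum_i f i x @[x --> F] --> \sum_i l i.
Proof. by move=> H; apply: cvg_big => //; exact: add_continuous. Qed.

Lemma cvg_rowP (T : Type) (F : set_system T) (FF : Filter F) (n : nat)
    (f : T -> 'rV[R]_n) (l : 'rV[R]_n) :
  (forall i, f x 0 i @[x --> F] --> l 0 i) -> f x @[x --> F] --> l.
Proof.
move=> H; apply/cvgrPdist_le => e e0.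
have : \forall x \near F, forall i, `|l 0 i - f x 0 i| <= e.
  apply: (@filter_forall _ _ (fun i x => `|l 0 i - f x 0 i| <= e) F) => i.
  by move/cvgrPdist_le : (H i) => /(_ e e0).
apply: filterS => x h; apply: mx_norm_leP; first exact: ltW.
by move=> i; rewrite !mxE.
Qed.

Section GradientForm.
Variables (m : nat) (a : 'I_m -> R).

Definition grad_form (v : 'rV[R]_m) : R := \sum_i v 0 i * a i.

Lemma grad_form_linear : linear grad_form.
Proof.
move=> k u v; rewrite /grad_form scaler_sumr -big_split /=.
by apply: eq_bigr => i _; rewrite !mxE mulrDl -mulrA.
Qed.

HB.instance Definition _ :=
  GRing.isLinear.Build R 'rV[R]_m R *:%R grad_form grad_form_linear.

Lemma grad_form_continuous : continuous grad_form.
Proof.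
move=> v; apply: (@cvg_fin_sum _ (nbhs v)) => i; apply: cvgMr_tmp.
exact: (@coord_continuous _ _ _ 0 i).
Qed.

End GradientForm.

Lemma has_partials_diff (m : nat) (f : 'rV[R]_m -> R) x g : has_partials f x g ->
  differentiable f x /\ forall v, 'd f x v = \sum_i v 0 i * g i x.
Proof.
move=> fg; have D : 'd f x = grad_form (fun i => g i x) :> ('rV[R]_m -> R).
  apply: diff_unique; first exact: grad_form_continuous.
  apply/eqaddoP => e e0; apply: filterS (has_partials_taylor fg e0) => h /=.
  by rewrite opprD addrA.
split; last by move=> v; rewrite D.
apply/diff_locallyP; rewrite D; split; first exact: grad_form_continuous.
apply/eqaddoP => e e0; apply: filterS (has_partials_taylor fg e0) => h /=.
by rewrite opprD addrA.
Qed.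

Lemma has_partials_near (m : nat) (f : 'rV[R]_m -> R) x g :
  has_partials f x g -> \forall y \near x, has_partials f y g.
Proof. exact: near_join. Qed.

Lemma has_partials_continuous (m : nat) (f : 'rV[R]_m -> R) x g :
  has_partials f x g -> {for x, continuous f}.
Proof. by move=> /has_partials_diff[/differentiable_continuous]. Qed.

Lemma near_eq_for_continuous (T U : topologicalType) (f g : T -> U) x :
  {near x, f =1 g} -> {for x, continuous f} -> {for x, continuous g}.
Proof.
move=> E c; suff : g @ x --> g x by [].
by have <- := nbhs_singleton E; apply: cvg_trans c; exact: near_eq_cvg.
Qed.

Lemma has_partials_eq (m : nat) (f f' : 'rV[R]_m -> R) x g g' :
  {near x, f =1 f'} -> (forall i, {near x, g i =1 g' i}) ->
  has_partials f x g -> has_partials f' x g'.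
Proof.
move=> /near_join E1 E2.
have {}E2 : \forall y \near x, forall i, {near y, g i =1 g' i}.
  apply: (@filter_forall _ _ (fun i y => {near y, g i =1 g' i}) (nbhs x)) => i.
  exact: near_join (E2 i).
apply: filterS3 E1 E2 => y e1 e2 H i; have [d c] := H i.
split; last exact: near_eq_for_continuous c.
rewrite -(nbhs_singleton (e2 i)); exact: near_eq_is_derive d.
Qed.

Lemma has_partials_partial (m : nat) (f : 'rV[R]_m -> R) x g :
  has_partials f x g -> forall i, {near x, partial i f =1 g i}.
Proof. by move=> H i; apply: filterS H => y /(_ i)[[_ e] _]; exact: e. Qed.

Lemma has_partials_val (m : nat) (f : 'rV[R]_m -> R) x g :
  has_partials f x g -> forall i, partial i f x = g i x.
Proof. by move=> H i; exact: (nbhs_singleton (has_partials_partial H i)). Qed.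

Lemma has_partials_cst (m : nat) (c : R) (x : 'rV[R]_m) :
  has_partials (cst c) x (fun _ => cst 0).
Proof. by apply: (@filterE _ (nbhs x)) => y i; split; [exact: is_derive_cst|exact: cst_continuous]. Qed.

Lemma is_derive_coord (m : nat) (j : 'I_m) (y v : 'rV[R]_m) :
  is_derive y v (fun z : 'rV[R]_m => z 0 j) (v 0 j).
Proof.
have /derivable_mxP /(_ 0 j) H := @derivable_id R 'rV[R]_m y v.
split => //; have := @derive_id _ _ y v; rewrite derive_mx; last exact: derivable_id.
by move=> /rowP/(_ j); rewrite mxE.
Qed.

Lemma has_partials_coord (m : nat) (j : 'I_m) (x : 'rV[R]_m) :
  has_partials (fun z : 'rV[R]_m => z 0 j) x (fun i => cst (i == j)%:R).
Proof.
apply: (@filterE _ (nbhs x)) => y i; split; last exact: cst_continuous.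
have := is_derive_coord j y (delta_mx 0 i); by rewrite mxE eqxx /= eq_sym.
Qed.

Lemma has_partialsD (m : nat) (f g : 'rV[R]_m -> R) x df dg :
  has_partials f x df -> has_partials g x dg ->
  has_partials (fun y => f y + g y) x (fun i y => df i y + dg i y).
Proof.
apply: filterS2 => y F G i; have [a b] := F i; have [c d] := G i; split.
  exact: (is_deriveD a c).
exact: (cvgD b d).
Qed.

Lemma has_partialsN (m : nat) (f : 'rV[R]_m -> R) x df :
  has_partials f x df -> has_partials (fun y => - f y) x (fun i y => - df i y).
Proof.
apply: filterS => y F i; have [a b] := F i; split; first exact: (is_deriveN a).
exact: (cvgN b).
Qed.

Lemma has_partialsB (m : nat) (f g : 'rV[R]_m -> R) x df dg :
  has_partials f x df -> has_partials g x dg ->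
  has_partials (fun y => f y - g y) x (fun i y => df i y - dg i y).
Proof. by move=> F G; apply: has_partialsD => //; exact: has_partialsN. Qed.

Lemma has_partialsM (m : nat) (f g : 'rV[R]_m -> R) x df dg :
  has_partials f x df -> has_partials g x dg ->
  has_partials (fun y => f y * g y) x (fun i y => df i y * g y + f y * dg i y).
Proof.
move=> Hf Hg.
apply: filterS3 (Hg) (has_partials_near Hf) (has_partials_near Hg) => y G Hfy Hgy i.
have [a b] := nbhs_singleton Hfy i; have [c d] := G i; split.
  have := is_deriveM a c => /is_derive_eq; apply.
  by rewrite addrC; congr (_ + _); exact: mulrC.
have cf := has_partials_continuous Hfy; have cg := has_partials_continuous Hgy.
exact: (cvgD (cvgM b cg) (cvgM cf d)).
Qed.

Lemma has_partialsZ (m : nat) (c : R) (f : 'rV[R]_m -> R) x df :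
  has_partials f x df -> has_partials (fun y => c * f y) x (fun i y => c * df i y).
Proof.
apply: filterS => y F i; have [a b] := F i; split; first exact: (is_deriveZ c a).
exact: (cvgM (cvg_cst c) b).
Qed.

Lemma has_partials_sum (m n : nat) (f : 'I_n -> 'rV[R]_m -> R) x df :
  (forall k, has_partials (f k) x (df k)) ->
  has_partials (fun y => \sum_k f k y) x (fun i y => \sum_k df k i y).
Proof.
move=> H; have : \forall y \near x, forall k i, is_derive y (delta_mx 0 i) (f k) (df k i y) /\
    {for y, continuous (df k i)}.
  exact: (@filter_forall _ _ (fun k y => forall i, is_derive y (delta_mx 0 i) (f k) (df k i y) /\
    {for y, continuous (df k i)}) (nbhs x)).
apply: filterS => y {}H i; split; last by apply: (@cvg_fin_sum _ (nbhs y)) => k; have [] := H k i.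
have := @is_derive_sum _ _ _ n f y (delta_mx 0 i) (fun k => df k i y) (fun k => (H k i).1).
by rewrite (_ : \sum_(i0 < n) f i0 = fun y => \sum_k f k y)//; apply/funext => z; rewrite fct_sumE.
Qed.

(** Only one directional derivative of [f] is available. Restricting [f] to the line through [y] in
    direction [v] gives a curve, and for functions of one variable derivable means differentiable,
    so the usual chain rule applies. *)
Lemma is_derive_comp_diff (V W : normedModType R) (G : W -> R) (f : V -> W) y v :
  differentiable G (f y) -> derivable f y v ->
  is_derive y v (fun z => G (f z)) ('d G (f y) ('D_v f y)).
Proof.
move=> dG df; pose phi (t : R) := f (t *: v + y).
have phi0 : phi 0 = f y by rewrite /phi scale0r add0r.
have dphi : differentiable phi (0 : R).
  by apply/derivable1_diffP; exact: ((derivable1P _ _ _).1 df).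
have dG' : differentiable G (phi 0) by rewrite phi0.
have E : 'D_1 phi 0 = 'D_v f y.
  rewrite /derive; congr (lim (_ @ 0^')); apply/funext => h /=.
  by rewrite phi0 /phi addr0 [_%:A]mulr1.
have dc : differentiable (G \o phi) 0 by exact: differentiable_comp.
split; first by apply/derivable1P/derivable1_diffP.
rewrite -E (deriveE _ dphi) -phi0 -[RHS]/(('d G (phi 0) \o 'd phi 0) 1) -diff_comp//.
rewrite -deriveE // /derive; congr (lim (_ @ 0^')); apply/funext => h /=.
by rewrite phi0 /phi addr0 [_%:A]mulr1.
Qed.

Lemma has_partials_row_continuous (m n : nat) (f : 'rV[R]_m -> 'rV[R]_n) x df :
  (forall k, has_partials (fun z => f z 0 k) x (df k)) -> {for x, continuous f}.
Proof. by move=> H; apply: (@cvg_rowP _ (nbhs x)) => k; exact: has_partials_continuous (H k). Qed.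

Lemma has_partials_row_derive (m n : nat) (f : 'rV[R]_m -> 'rV[R]_n) x df :
  (forall k, has_partials (fun z => f z 0 k) x (df k)) ->
  forall i, is_derive x (delta_mx 0 i) f (\row_k df k i x).
Proof.
move=> H i; have dx : derivable f x (delta_mx 0 i).
  apply/derivable_mxP => j k; rewrite ord1.
  by have [[]] := nbhs_singleton (H k) i.
split => //; rewrite derive_mx//; apply/rowP => k; rewrite !mxE.
by have [[]] := nbhs_singleton (H k) i.
Qed.

Lemma has_partials_comp (m n : nat) (G : 'rV[R]_n -> R) (f : 'rV[R]_m -> 'rV[R]_n) x dG df :
  has_partials G (f x) dG -> (forall k, has_partials (fun z => f z 0 k) x (df k)) ->
  has_partials (fun z => G (f z)) x (fun i y => \sum_k df k i y * dG k (f y)).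
Proof.
move=> HG Hf.
have c : {for x, continuous f} := has_partials_row_continuous Hf.
have N1 : \forall y \near x, has_partials G (f y) dG by exact: c (has_partials_near HG).
have N2 : \forall y \near x, forall k, has_partials (fun z => f z 0 k) y (df k).
  apply: (@filter_forall _ _ (fun k y => has_partials (fun z => f z 0 k) y (df k)) (nbhs x)) => k.
  exact: has_partials_near.
apply: filterS2 N1 N2 => y {}HG {}Hf i; split.
  have [dGy E] := has_partials_diff HG.
  have [d1 d2] := has_partials_row_derive Hf i.
  apply: (is_derive_eq (is_derive_comp_diff dGy d1)).
  by rewrite E d2; apply: eq_bigr => k _; rewrite mxE.
apply: (@cvg_fin_sum _ (nbhs y)) => k; apply: cvgM.
  by have [_] := nbhs_singleton (Hf k) i.
apply: (@cvg_comp _ _ _ f (dG k) _ (nbhs (f y))).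
  exact: has_partials_row_continuous Hf.
by have [_] := nbhs_singleton HG k.
Qed.

Lemma has_partials_comp1 (m : nat) (h dh : R -> R) (f : 'rV[R]_m -> R) x df :
  (\forall s \near f x, is_derive (s : R) (1 : R) h (dh s) /\ {for s, continuous dh}) ->
  has_partials f x df ->
  has_partials (fun z => h (f z)) x (fun i y => df i y * dh (f y)).
Proof.
move=> Hh Hf.
have N1 : \forall y \near x, is_derive (f y) (1 : R) h (dh (f y)) /\ {for (f y), continuous dh}.
  exact: (has_partials_continuous Hf) Hh.
apply: filterS2 N1 (has_partials_near Hf) => y [d c] {}Hf i.
have [df1 df2] := nbhs_singleton Hf i; split.
  have dfy : differentiable h (f y) by apply/derivable1_diffP; case: d.
  apply: (is_derive_eq (is_derive_comp_diff dfy _)); first by case: df1.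
  case: df1 => _ ->; rewrite deriv1E; last by case: d.
  by rewrite derive1E; case: d => _ ->.
have cf := has_partials_continuous Hf.
have cd := continuous_comp cf c.
exact: (cvgM df2 cd).
Qed.

End Basics.

(** * Second partial derivatives and the passage to and from [class_Ck] *)

Section SecondOrder.
Variable R : realType.

Lemma near_eq_all (T : topologicalType) (U : Type) (f g : T -> U) (x : T) : f =1 g -> {near x, f =1 g}.
Proof. by move=> fg; apply: (@filterE _ (nbhs x)). Qed.

Lemma near_eq_refl (T : topologicalType) (U : Type) (f : T -> U) (x : T) : {near x, f =1 f}.
Proof. exact: near_eq_all. Qed.

(** [h i j] is the derivative in direction [j] of [g i]. The two mixed derivatives are kept apart,
    and second-order arguments involve their sum. *)
Definition has_partials2 (m : nat) (f : 'rV[R]_m -> R) (x : 'rV[R]_m)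
    (g : 'I_m -> 'rV[R]_m -> R) (h : 'I_m -> 'I_m -> 'rV[R]_m -> R) : Prop :=
  has_partials f x g /\ forall i, has_partials (g i) x (h i).

Definition twice_diff (m : nat) (f : 'rV[R]_m -> R) (x : 'rV[R]_m) : Prop :=
  exists g h, has_partials2 f x g h.

Section Coefficient.
Variables (m : nat) (V : normedModType R) (l : V -> R).
Hypothesis lc : continuous l.
Hypothesis ld : forall (f : 'rV[R]_m -> V) y v,
  derivable f y v -> is_derive y v (fun z => l (f z)) (l ('D_v f y)).

(** The functional [l] covers two cases at once: a coordinate of a row vector, and the identity on
    scalars. *)
Lemma class_C1_coef (U : set 'rV[R]_m) f x : open U -> class_Ck 1 U f -> U x ->
  has_partials (fun z => l (f z)) x (fun i z => l (partial i f z)).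
Proof.
move=> oU fU Ux; have : nbhs x U by exact: open_nbhs_nbhs.
apply: filterS => y Uy i; split.
  by apply: ld; have [_] := fU [::] y Uy; apply.
have [] := fU [:: i] y Uy => /(_ isT) c _.
by apply: (@continuous_comp _ _ _ (partial i f) l y); [exact: c|exact: lc].
Qed.

Lemma class_C2_C1 (U : set 'rV[R]_m) (f : 'rV[R]_m -> V) : class_Ck 2 U f ->
  class_Ck 1 U f /\ forall i, class_Ck 1 U (partial i f).
Proof.
move=> fU; split=> [s x Ux|i s x Ux].
  have [a b] := fU s x Ux; split=> sz; first by apply: a; apply: leq_trans sz _.
  by apply: b; apply: leq_trans sz _.
have [a b] := fU (rcons s i) x Ux.
have E : iter_partial (rcons s i) f = iter_partial s (partial i f).
  by rewrite /iter_partial foldr_rcons.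
rewrite size_rcons !E in a b; split=> sz; first by apply: a; rewrite ltnS.
by apply: b; rewrite ltnS.
Qed.

Lemma class_C2_coef (U : set 'rV[R]_m) f x : open U -> class_Ck 2 U f -> U x ->
  has_partials2 (fun z => l (f z)) x (fun i z => l (partial i f z))
    (fun i j z => l (partial j (partial i f) z)).
Proof.
move=> oU /class_C2_C1[f1 f2] Ux; split; first exact: class_C1_coef Ux.
by move=> i; exact: class_C1_coef (f2 i) Ux.
Qed.

End Coefficient.

Lemma coord_coef (m n : nat) (k : 'I_n) (f : 'rV[R]_m -> 'rV[R]_n) y v :
  derivable f y v -> is_derive y v (fun z => f z 0 k) ('D_v f y 0 k).
Proof.
move=> d; split; first by move/derivable_mxP : d; apply.
by rewrite derive_mx// mxE.
Qed.

Lemma class_C1_row (m n : nat) (U : set 'rV[R]_m) (f : 'rV[R]_m -> 'rV[R]_n) x k :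
  open U -> class_Ck 1 U f -> U x ->
  has_partials (fun z => f z 0 k) x (fun i z => partial i f z 0 k).
Proof.
apply: (@class_C1_coef m 'rV[R]_n (fun v => v 0 k)); first exact: (@coord_continuous _ _ _ 0 k).
exact: coord_coef.
Qed.

Lemma class_C2_row (m n : nat) (U : set 'rV[R]_m) (f : 'rV[R]_m -> 'rV[R]_n) x k :
  open U -> class_Ck 2 U f -> U x ->
  has_partials2 (fun z => f z 0 k) x (fun i z => partial i f z 0 k)
    (fun i j z => partial j (partial i f) z 0 k).
Proof.
apply: (@class_C2_coef m 'rV[R]_n (fun v => v 0 k)); first exact: (@coord_continuous _ _ _ 0 k).
exact: coord_coef.
Qed.

Lemma class_C2_partials (m : nat) (U : set 'rV[R]_m) (f : 'rV[R]_m -> R) x :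
  open U -> class_Ck 2 U f -> U x ->
  has_partials2 f x (fun i => partial i f) (fun i j => partial j (partial i f)).
Proof.
apply: (@class_C2_coef m R id); first by move=> y.
by move=> {}f y v d; exact: derivableP.
Qed.

Lemma has_partials2_near (m : nat) (f : 'rV[R]_m -> R) x g h :
  has_partials2 f x g h -> \forall y \near x, has_partials2 f y g h.
Proof.
move=> [H1 H2]; have H3 : \forall y \near x, forall i, has_partials (g i) y (h i).
  apply: (@filter_forall _ _ (fun i y => has_partials (g i) y (h i)) (nbhs x)) => i.
  exact: has_partials_near.
by apply: filterS2 (has_partials_near H1) H3 => y.
Qed.

Lemma has_partials_self (m : nat) (f : 'rV[R]_m -> R) x g :
  has_partials f x g -> has_partials f x (fun i => partial i f).
Proof.
move=> H; apply: (has_partials_eq _ _ H); first exact: near_eq_refl.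
by move=> i; apply: filterS (has_partials_partial H i) => y ->.
Qed.

Lemma has_partials2_self (m : nat) (f : 'rV[R]_m -> R) x g h :
  has_partials2 f x g h ->
  has_partials2 f x (fun i => partial i f) (fun i j => partial j (partial i f)).
Proof.
move=> [H1 H2]; split; first exact: has_partials_self H1.
move=> i; apply: (@has_partials_self _ _ _ (h i)).
apply: (has_partials_eq _ _ (H2 i)); last by move=> j; exact: near_eq_refl.
by apply: filterS (has_partials_partial H1 i) => y ->.
Qed.

Lemma has_partials2_val (m : nat) (f : 'rV[R]_m -> R) x g h :
  has_partials2 f x g h -> forall i j, partial j (partial i f) x = h i j x.
Proof.
move=> [H1 H2] i j; rewrite -(has_partials_val (H2 i) j).
by apply: near_eq_derive; exact: has_partials_partial.
Qed.

Lemma has_partials2_eq (m : nat) (f f' : 'rV[R]_m -> R) x g h :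
  {near x, f =1 f'} -> has_partials2 f x g h -> has_partials2 f' x g h.
Proof.
move=> E [H1 H2]; split => //; apply: has_partials_eq H1 => // i; exact: near_eq_refl.
Qed.

Lemma size_le2 (T : Type) (s : seq T) : (size s <= 2)%N ->
  [\/ s = [::], exists i, s = [:: i] | exists i j, s = [:: i; j]].
Proof.
case: s => [|i [|j [|k s]]] // _; [by constructor 1|by constructor 2; exists i|].
by constructor 3; exists i, j.
Qed.

(** Iterated partial derivatives of the vector-valued map are identified with rows of coordinate
    derivatives only near the point, so each order up to two is transported along an equality of
    germs. *)
Lemma class_C2_of_row (m n : nat) (U : set 'rV[R]_m) (f : 'rV[R]_m -> 'rV[R]_n) :
  (forall x k, U x -> twice_diff (fun z => f z 0 k) x) -> class_Ck 2 U f.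
Proof.
move=> H s x Ux.
pose g k i := partial i (fun z => f z 0 k); pose h k i j := partial j (g k i).
have Hk k : has_partials2 (fun z => f z 0 k) x (g k) (h k).
  by have [a [b]] := H x k Ux; exact: has_partials2_self.
have Hn : \forall y \near x, forall k, has_partials2 (fun z => f z 0 k) y (g k) (h k).
  apply: (@filter_forall _ _ (fun k y => has_partials2 (fun z => f z 0 k) y (g k) (h k)) (nbhs x)) => k.
  exact: has_partials2_near.
have P1 i : {near x, (fun y => \row_k g k i y) =1 partial i f}.
  apply: filterS Hn => y Hy.
  have := has_partials_row_derive (fun k => (Hy k).1) i; by case=> _ <-.
have D1 i : forall j, is_derive x (delta_mx 0 j) (fun y => \row_k g k i y) (\row_k h k i j x).
  move=> j; apply: (has_partials_row_derive (f := fun y => \row_k g k i y) (df := fun k => h k i)) => k.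
  apply: (has_partials_eq _ _ ((Hk k).2 i)); last by move=> l; exact: near_eq_refl.
  by apply: near_eq_all => y; rewrite mxE.
split=> sz.
  have [->|[i ->]|[j [i ->]]] := size_le2 sz => /=.
  - exact: has_partials_row_continuous (fun k => (Hk k).1).
  - apply: near_eq_for_continuous (P1 i) _.
    apply: (@has_partials_row_continuous _ _ _ _ _ (fun k => h k i)) => k.
    apply: (has_partials_eq _ _ ((Hk k).2 i)); last by move=> l; exact: near_eq_refl.
    by apply: near_eq_all => y; rewrite mxE.
  - apply: (@near_eq_for_continuous _ _ (fun y => \row_k h k i j y)).
      have P1' := near_join (P1 i).
      apply: filterS2 P1' Hn => y e Hy.
      have := has_partials_row_derive (f := fun y => \row_k g k i y) (df := fun k => h k i) (x := y).
      move=> /(_ _ j)[|_ <-].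
        move=> k; apply: (has_partials_eq _ _ ((Hy k).2 i)); last by move=> l; exact: near_eq_refl.
        by apply: near_eq_all => z; rewrite mxE.
      exact: near_eq_derive.
    apply: (@cvg_rowP _ _ (nbhs x) _ _ (fun y => \row_k h k i j y) (\row_k h k i j x)) => k.
    rewrite [X in _ --> X]mxE (_ : (fun y => _) = h k i j); last by apply/funext => y; rewrite mxE.
    by have [_] := nbhs_singleton ((Hk k).2 i) j.
move=> j; have [e|[i ->]|[a [b e]]] := size_le2 (ltnW sz).
- by rewrite e /=; have [] := has_partials_row_derive (fun k => (Hk k).1) j.
- by apply: near_eq_derivable (P1 i) _; have [] := D1 i j.
- by rewrite e in sz.
Qed.

Lemma class_C2_of_partials (m : nat) (U : set 'rV[R]_m) (f : 'rV[R]_m -> R) :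
  (forall x, U x -> twice_diff f x) -> class_Ck 2 U f.
Proof.
move=> H s x Ux.
have [H1 H2] : has_partials2 f x (fun i => partial i f) (fun i j => partial j (partial i f)).
  by have [a [b]] := H x Ux; exact: has_partials2_self.
split=> sz.
  have [->|[i ->]|[j [i ->]]] := size_le2 sz => /=.
  - exact: has_partials_continuous H1.
  - exact: has_partials_continuous (H2 i).
  - by have [_] := nbhs_singleton (H2 i) j.
move=> j; have [->|[i ->]|[a [b e]]] := size_le2 (ltnW sz).
- by have [[]] := nbhs_singleton H1 j.
- by have [[]] := nbhs_singleton (H2 i) j.
- by rewrite e in sz.
Qed.

End SecondOrder.

(** * Viscosity subharmonic functions and the maximum principle *)

Section Closure.
Variable R : realType.
Implicit Types m n : nat.

Lemma has_partials2_cst m (c : R) (x : 'rV[R]_m) :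
  has_partials2 (cst c) x (fun _ => cst 0) (fun _ _ => cst 0).
Proof. by split=> [|i]; exact: has_partials_cst. Qed.

Lemma has_partials2_coord m (j : 'I_m) (x : 'rV[R]_m) :
  has_partials2 (fun z : 'rV[R]_m => z 0 j) x (fun i => cst (i == j)%:R)
    (fun _ _ => cst 0).
Proof. by split=> [|i]; [exact: has_partials_coord|exact: has_partials_cst]. Qed.

Lemma has_partials2D m (f g : 'rV[R]_m -> R) x df dg ddf ddg :
  has_partials2 f x df ddf -> has_partials2 g x dg ddg ->
  has_partials2 (fun y => f y + g y) x (fun i y => df i y + dg i y)
    (fun i j y => ddf i j y + ddg i j y).
Proof. by move=> [a b] [c d]; split=> [|i]; exact: has_partialsD. Qed.

Lemma has_partials2B m (f g : 'rV[R]_m -> R) x df dg ddf ddg :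
  has_partials2 f x df ddf -> has_partials2 g x dg ddg ->
  has_partials2 (fun y => f y - g y) x (fun i y => df i y - dg i y)
    (fun i j y => ddf i j y - ddg i j y).
Proof. by move=> [a b] [c d]; split=> [|i]; exact: has_partialsB. Qed.

Lemma has_partials2Z m (c : R) (f : 'rV[R]_m -> R) x df ddf :
  has_partials2 f x df ddf ->
  has_partials2 (fun y => c * f y) x (fun i y => c * df i y) (fun i j y => c * ddf i j y).
Proof. by move=> [a b]; split=> [|i]; exact: has_partialsZ. Qed.

Lemma has_partials2M m (f g : 'rV[R]_m -> R) x df dg ddf ddg :
  has_partials2 f x df ddf -> has_partials2 g x dg ddg ->
  has_partials2 (fun y => f y * g y) x (fun i y => df i y * g y + f y * dg i y)
    (fun i j y => (ddf i j y * g y + df i y * dg j y) +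
                  (df j y * dg i y + f y * ddg i j y)).
Proof.
move=> [a b] [c d]; split=> [|i]; first exact: has_partialsM.
by apply: has_partialsD; apply: has_partialsM.
Qed.

Lemma has_partials2_comp m n (G : 'rV[R]_n -> R) (f : 'rV[R]_m -> 'rV[R]_n) x
    dG ddG df ddf :
  has_partials2 G (f x) dG ddG ->
  (forall k, has_partials2 (fun z => f z 0 k) x (df k) (ddf k)) ->
  has_partials2 (fun z => G (f z)) x (fun i y => \sum_k df k i y * dG k (f y))
   (fun i j y => \sum_k (ddf k i j y * dG k (f y) +
      df k i y * \sum_l df l j y * ddG k l (f y))).
Proof.
move=> [G1 G2] H; split; first by apply: has_partials_comp => // k; case: (H k).
move=> i; apply: has_partials_sum => k; apply: has_partialsM; first by case: (H k).
by apply: has_partials_comp => // l; case: (H l).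
Qed.

Lemma has_partials2_comp1 m (h dh ddh : R -> R) (f : 'rV[R]_m -> R) x df ddf :
  (\forall s \near f x, is_derive (s : R) (1 : R) h (dh s) /\
     is_derive (s : R) (1 : R) dh (ddh s) /\ {for s, continuous ddh}) ->
  has_partials2 f x df ddf ->
  has_partials2 (fun z => h (f z)) x (fun i y => df i y * dh (f y))
    (fun i j y => ddf i j y * dh (f y) + df i y * (df j y * ddh (f y))).
Proof.
move=> H [f1 f2]; split.
  apply: has_partials_comp1 f1; apply: filterS H => s [a [b c]]; split => //.
  by apply: differentiable_continuous; apply/derivable1_diffP; case: b.
move=> i; apply: has_partialsM => //; apply: has_partials_comp1 => //.
by apply: filterS H => s [_].
Qed.

Lemma has_partials2_ext m (f f' : 'rV[R]_m -> R) x df df' ddf ddf' :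
  f =1 f' -> (forall i, df i =1 df' i) -> (forall i j, ddf i j =1 ddf' i j) ->
  has_partials2 f x df ddf -> has_partials2 f' x df' ddf'.
Proof.
move=> /funext <- h1 h2; rewrite (_ : df' = df); last first.
  by apply/funext => i; apply/esym/funext/h1.
rewrite (_ : ddf' = ddf) //.
by apply/funext => i; apply/funext => j; apply/esym/funext/h2.
Qed.

Lemma has_partials_derive m (f : 'rV[R]_m -> R) x g v :
  has_partials f x g -> is_derive x v f (\sum_i v 0 i * g i x).
Proof.
move=> /has_partials_diff[d e]; split; first exact: diff_derivable.
by rewrite deriveE.
Qed.

Lemma ray_mvt (V : normedModType R) (f : V -> R) (y v : V) (s : R) (g : R -> R) : 0 < s ->
  (forall t : R, 0 <= t <= s -> is_derive (t *: v + y) v f (g t)) ->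
  exists2 t, 0 < t < s & f (s *: v + y) - f y = s * g t.
Proof.
move=> s0 H.
have Hd (t : R) : 0 <= t <= s -> is_derive t 1 (fun s : R => f (s *: v + y)) (g t).
  by move=> /H /is_derive_line.
have [t|t|t] := @MVT _ (fun s : R => f (s *: v + y)) g _ _ s0.
- by rewrite in_itv/= => /andP[a b]; apply: Hd; rewrite !ltW.
- by apply: derivable_within_continuous => u; rewrite in_itv/= => /Hd; case.
- by rewrite in_itv/= => a; rewrite scale0r add0r subr0 mulrC => e; exists t.
Qed.

(** The mean value theorem is applied to [f] and then to its directional derivative. The factor [t]
    stands where the usual remainder has 1/2; only its sign matters for the second-order test. *)
Lemma ray_taylor2 m (f : 'rV[R]_m -> R) x v df ddf :
  (forall t : R, 0 <= t <= 1 -> has_partials2 f (t *: v + x) df ddf) ->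
  exists t s, [/\ 0 < t < 1, 0 < s < 1 &
    f (v + x) - f x - \sum_i v 0 i * df i x =
    t * \sum_i v 0 i * \sum_j v 0 j * ddf i j (s *: v + x)].
Proof.
move=> H.
have [t /andP[t0 t1] Et] := @ray_mvt _ f x v 1 (fun t => \sum_i v 0 i * df i (t *: v + x)) ltr01
  (fun t ht => has_partials_derive v (H t ht).1).
have [s /andP[s0 s1] Es] := @ray_mvt _ (fun y => \sum_i v 0 i * df i y) x v t
   (fun t => \sum_i v 0 i * \sum_j v 0 j * ddf i j (t *: v + x)) t0
   (fun s hs => ltac:(
     apply: (is_derive_eq (has_partials_derive (g := fun j y => \sum_i v 0 i * ddf i j y) v _));
     [apply: has_partials_sum => i; apply: has_partialsZ; apply: (H s _).2;
      by move/andP: hs => [-> hs]; rewrite (le_trans hs)// ltW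
     |under eq_bigr do rewrite mulr_sumr; rewrite exchange_big /=;
      apply: eq_bigr => i _; rewrite mulr_sumr; apply: eq_bigr => j _; rewrite mulrCA //])).
exists t, s; split; [by rewrite t0|by rewrite s0 (lt_trans s1)|].
by rewrite -Es -[v in f (v + x)]scale1r Et mul1r.
Qed.

Lemma near0_norm (V : normedModType R) (P : set V) (x : V) : (\forall y \near x, P y) ->
  exists2 d : R, 0 < d & forall v, `|v| < d -> P (v + x).
Proof.
move=> /nbhs_ballP[d /= d0 H]; exists d => // v vd; apply: H.
by rewrite -ball_normE /ball_ /= opprD addrCA subrr addr0 normrN.
Qed.

Lemma delta_norm m (i : 'I_m) : `|delta_mx 0 i : 'rV[R]_m| <= 1.
Proof. by apply: mx_norm_leP => // j; rewrite mxE normr_nat; case: (_ && _). Qed.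

(** If [ddf i i x] were positive it would be positive nearby; two applications of the mean value
    theorem along the axis [i], starting from the vanishing first derivative, would then give a
    larger value of [f]. *)
Lemma local_max_partials m (f : 'rV[R]_m -> R) x df ddf :
  has_partials2 f x df ddf -> (\forall y \near x, f y <= f x) ->
  forall i, df i x = 0 /\ ddf i i x <= 0.
Proof.
move=> H M i.
have [d d0 Hd] := near0_norm (filterI (has_partials2_near H) M).
have sm (t : R) : `|t| < d -> `|t *: delta_mx 0 i : 'rV[R]_m| < d.
  by move=> td; rewrite normrZ (le_lt_trans _ td)// ler_piMr// delta_norm.
have cf : df i x = 0.
  have D (t : R) : `|t| < d ->
     is_derive t 1 (fun t : R => f (t *: delta_mx 0 i + x)) (df i (t *: delta_mx 0 i + x)).
    move=> td; apply: is_derive_line.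
    by have [[]] := nbhs_singleton (Hd _ (sm _ td)).1.1 i.
  have := @derive1_at_max _ (fun t : R => f (t *: delta_mx 0 i + x)) (- d) d 0.
  case/(_ _ _ _ _).
  - by rewrite ge0_cp// ltW.
  - by move=> t; rewrite in_itv/= -ltr_norml => /D[].
  - by rewrite in_itv/= oppr_lt0 d0.
  - move=> t; rewrite in_itv/= -ltr_norml scale0r add0r => td.
    exact: (Hd _ (sm _ td)).2.
  - move=> _ e; have := D 0; rewrite normr0 => /(_ d0)[_ e'].
    by rewrite -[RHS]e e' scale0r add0r.
split => //; rewrite leNgt; apply/negP => pos.
have N : \forall y \near x, 0 < ddf i i y.
  have [_] := nbhs_singleton (H.2 i) i.
  by move=> /cvgr_gt; apply.
have [e e0 He] := near0_norm N.
pose s := minr d e / 2.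
have s0 : 0 < s by rewrite divr_gt0// lt_min d0.
have hs : s < minr d e by rewrite ltr_pdivrMr// ltr_pMr ?ltr1n// lt_min d0.
have [sd se] : s < d /\ s < e by move: hs; rewrite lt_min => /andP.
have ns (t : R) c : 0 <= t <= s -> s < c -> `|t *: delta_mx 0 i : 'rV[R]_m| < c.
  move=> /andP[t0 ts] sc; rewrite normrZ ger0_norm//.
  by rewrite (le_lt_trans _ (le_lt_trans ts sc))// ler_piMr// delta_norm.
have [t /andP[t0 ts] Et] := @ray_mvt _ f x (delta_mx 0 i) s (fun t => df i (t *: delta_mx 0 i + x)) s0
  (fun t ht => ltac:(by have [] := nbhs_singleton (Hd _ (ns t d ht sd)).1.1 i)).
have L (u : R) : 0 <= u <= t -> is_derive (u *: delta_mx 0 i + x) (delta_mx 0 i)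
    (df i) (ddf i i (u *: delta_mx 0 i + x)).
  move=> /andP[u0 ut]; have hu : 0 <= u <= s by rewrite u0 (le_trans ut)// ltW.
  by have [] := nbhs_singleton ((Hd _ (ns u d hu sd)).1.2 i) i.
have [u /andP[u0 ut] Eu] := ray_mvt t0 L.
have us : 0 <= u <= s by rewrite (ltW u0) ltW// (lt_trans ut).
have h1 := He _ (ns u e us se).
have ss : 0 <= s <= s by rewrite lexx ltW.
have := (Hd _ (ns s d ss sd)).2; rewrite -subr_le0 Et.
rewrite cf subr0 in Eu; rewrite Eu leNgt => /negP; apply.
by apply: mulr_gt0 => //; apply: mulr_gt0.
Qed.

End Closure.

Section Subharmonic.
Variable R : realType.
Local Notation plane := 'rV[R]_2.

(* Subharmonicity in the viscosity sense. *)
Definition vsub (u : plane -> R) (z : plane) : Prop :=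
  forall phi g h, has_partials2 phi z g h ->
    (\forall y \near z, u y - phi y <= u z - phi z) -> 0 <= h 0 0 z + h 1 1 z.

Lemma vsub_C2 (u : plane -> R) z g h : has_partials2 u z g h ->
  0 <= h 0 0 z + h 1 1 z -> vsub u z.
Proof.
move=> Hu L phi g' h' Hp M; have := local_max_partials (has_partials2B Hu Hp) M.
move=> H; have [_ a] := H 0; have [_ b] := H 1.
by lra.
Qed.

(** A test function touching [u] from above at [z] also touches the smaller [v] there. This is how
    maxima and Poisson modifications stay subharmonic at the points where pieces meet. *)
Lemma vsub_touch (u v : plane -> R) z : (\forall y \near z, v y <= u y) -> v z = u z ->
  vsub v z -> vsub u z.
Proof.
move=> vu e Hv phi g h Hp M; apply: Hv Hp _.
by apply: filterS2 vu M => y a; rewrite e; apply: le_trans; rewrite lerD2r.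
Qed.

Lemma vsub_eq (u v : plane -> R) z : {near z, v =1 u} -> vsub v z -> vsub u z.
Proof.
move=> E; apply: vsub_touch; last exact: nbhs_singleton E.
by apply: filterS E => y ->.
Qed.

Lemma vsubD (u w : plane -> R) z g h : has_partials2 w z g h ->
  0 <= h 0 0 z + h 1 1 z -> vsub u z -> vsub (fun y => u y + w y) z.
Proof.
move=> Hw L Hu phi g' h' Hp M.
have := Hu _ _ _ (has_partials2B Hp Hw).
suff N : \forall y \near z, u y - (phi y - w y) <= u z - (phi z - w z).
  by move=> /(_ N); lra.
by apply: filterS M => y; lra.
Qed.

Lemma vsub_max (u v : plane -> R) z : vsub u z -> vsub v z -> vsub (fun y => maxr (u y) (v y)) z.
Proof.
move=> Hu Hv; have [uv|vu] := leP (u z) (v z).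
  apply: vsub_touch Hv; last by rewrite (max_idPr _).
  by apply: (@filterE _ (nbhs z)) => y; rewrite le_max lexx orbT.
apply: vsub_touch Hu; last by rewrite (max_idPl _)// ltW.
by apply: (@filterE _ (nbhs z)) => y; rewrite le_max lexx.
Qed.

Lemma I2P (i : 'I_2) : i = 0 \/ i = 1.
Proof.
case: i => -[|[|//]] h; [left|right]; exact: val_inj.
Qed.

Lemma dot2E (u v : plane) : dot u v = u 0 0 * v 0 0 + u 0 1 * v 0 1.
Proof.
rewrite /dot big_ord_recl big_ord1; congr (_ * _ + _ * _); congr (_ _ _); exact: val_inj.
Qed.

Lemma has_partials2_sq m (a : 'rV[R]_m) (j : 'I_m) (x : 'rV[R]_m) :
  has_partials2 (fun z : 'rV[R]_m => (z 0 j - a 0 j) ^+ 2) x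
    (fun i z => 2 * (z 0 j - a 0 j) * (i == j)%:R)
    (fun i k z => 2 * (k == j)%:R * (i == j)%:R).
Proof.
have H := has_partials2B (has_partials2_coord j x) (has_partials2_cst (a 0 j) x).
apply: has_partials2_ext (has_partials2M H H) => [y|i y|i k y] /=; first by rewrite expr2.
  by ring.
by ring.
Qed.

Lemma has_partials2_dist (a x : plane) :
  has_partials2 (fun z : plane => dot (z - a) (z - a)) x (fun i z => 2 * (z 0 i - a 0 i))
    (fun i k _ => 2 * (k == i)%:R).
Proof.
apply: has_partials2_ext (has_partials2D (has_partials2_sq a 0 x) (has_partials2_sq a 1 x)).
- by move=> y; rewrite dot2E !mxE !expr2.
- by move=> i y /=; have [->|->] := I2P i; rewrite /=; ring.
- by move=> i k y /=; have [->|->] := I2P i; have [->|->] := I2P k; rewrite /=; ring.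
Qed.

End Subharmonic.

Section MaximumPrinciple.
Variable R : realType.
Local Notation plane := 'rV[R]_2.

Lemma sqr_normr (x : R) : `|x| ^+ 2 = x ^+ 2.
Proof. by rewrite real_normK// num_real. Qed.

(** Euclidean distances are kept squared: they are then polynomial, with explicit derivatives, and
    the discs below are round, whereas balls of the ambient norm are squares. *)
Definition sqdist (a z : plane) : R := dot (z - a) (z - a).

Definition odisc (a : plane) (r : R) : set plane := [set z | sqdist a z < r ^+ 2].

Definition cdisc (a : plane) (r : R) : set plane := [set z | sqdist a z <= r ^+ 2].

Lemma sqdistE (a z : plane) : sqdist a z = (z 0 0 - a 0 0) ^+ 2 + (z 0 1 - a 0 1) ^+ 2.
Proof. by rewrite /sqdist dot2E !mxE !expr2. Qed.

Lemma sqdist_ge0 (a z : plane) : 0 <= sqdist a z.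
Proof. by rewrite sqdistE addr_ge0 ?sqr_ge0. Qed.

Lemma sqdistC (a z : plane) : sqdist a z = sqdist z a.
Proof. by rewrite !sqdistE; ring. Qed.

Lemma sqdistxx (a : plane) : sqdist a a = 0.
Proof. by rewrite sqdistE !subrr; ring. Qed.

Lemma sqdist_eq0 (a z : plane) : sqdist a z = 0 -> z = a.
Proof.
move=> /eqP; rewrite sqdistE paddr_eq0 ?sqr_ge0// !sqrf_eq0 !subr_eq0 => /andP[/eqP h0 /eqP h1].
by apply/rowP => i; have [->|->] := I2P i.
Qed.

Lemma sqdist_gt0 (a z : plane) : z != a -> 0 < sqdist a z.
Proof.
by move=> za; rewrite lt_neqAle sqdist_ge0 andbT eq_sym; apply/eqP => /sqdist_eq0/eqP; exact/negP.
Qed.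

Lemma sqdist_triangle (a b c : plane) : sqdist a c <= 2 * sqdist a b + 2 * sqdist b c.
Proof.
rewrite !sqdistE; set x := c 0 0; set y := c 0 1.
have h1 := sqr_ge0 ((x - b 0 0) - (b 0 0 - a 0 0)); have h2 := sqr_ge0 ((y - b 0 1) - (b 0 1 - a 0 1)).
by lra.
Qed.

Lemma has_partials2_sqdist (a x : plane) :
  has_partials2 (sqdist a) x (fun i z => 2 * (z 0 i - a 0 i))
    (fun i k _ => 2 * (k == i)%:R).
Proof. exact: has_partials2_dist. Qed.

Lemma sqdist_continuous (a : plane) : continuous (sqdist a).
Proof. by move=> x; exact: has_partials_continuous (has_partials2_sqdist a x).1. Qed.

Lemma norm_sqdist (a z : plane) : `|z - a| ^+ 2 <= sqdist a z.
Proof.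
have h i : (z 0 i - a 0 i) ^+ 2 <= sqdist a z.
  rewrite sqdistE; have := sqr_ge0 (z 0 0 - a 0 0); have := sqr_ge0 (z 0 1 - a 0 1).
  by have [->|->] := I2P i; lra.
rewrite -[leRHS]sqr_sqrtr ?sqdist_ge0// ler_pXn2r ?nnegrE ?sqrtr_ge0//.
apply: mx_norm_leP => [|i]; first exact: sqrtr_ge0.
rewrite !mxE -sqrtr_sqr ler_sqrt ?sqdist_ge0//.
Qed.

Lemma odisc_open (a : plane) r : open (odisc a r).
Proof.
have := @open_comp _ _ (sqdist a) [set t | t < r ^+ 2]; apply => //.
by move=> x _; exact: sqdist_continuous.
Qed.

Lemma odisc_nbhs (a z : plane) r : odisc a r z -> nbhs z (odisc a r).
Proof. by move=> h; apply: open_nbhs_nbhs; split => //; exact: odisc_open. Qed.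

Lemma odisc_cdisc (a : plane) r : odisc a r `<=` cdisc a r.
Proof. by move=> z /ltW. Qed.

Lemma cdisc_closed (a : plane) r : closed (cdisc a r).
Proof.
apply: (@closed_comp _ _ (sqdist a) [set t | t <= r ^+ 2]) => //.
by move=> x _; exact: sqdist_continuous.
Qed.

Lemma cdisc_bounded (a : plane) r : bounded_set (cdisc a r).
Proof.
exists (`|a| + `|r|); split; first exact: num_real.
move=> M hM z; rewrite /cdisc /= => h.
apply: le_trans (ltW hM); rewrite -[z](subrK a) (le_trans (ler_normD _ _))// addrC lerD2l.
by rewrite -ler_sqr ?nnegrE// sqr_normr (le_trans (norm_sqdist _ _)).
Qed.

Lemma cdisc_compact (a : plane) r : compact (cdisc a r).
Proof. by apply: bounded_closed_compact; [exact: cdisc_bounded|exact: cdisc_closed]. Qed.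

Lemma nbhs_odisc (a : plane) (P : set plane) : nbhs a P ->
  exists2 r, 0 < r & cdisc a r `<=` P.
Proof.
move=> /near0_norm[d d0 H]; exists (d / 2); first by rewrite divr_gt0.
move=> z h; rewrite -[z](subrK a); apply: H.
rewrite -(ltr_pXn2r (n := 2)) ?nnegrE// ?(ltW d0)//.
apply: (le_lt_trans (norm_sqdist _ _)); apply: (le_lt_trans h).
by rewrite ltr_pXn2r ?nnegrE ?divr_ge0 ?ltW// gtr_pMr// invf_lt1// ltr1n.
Qed.

(** Adding a small multiple of |z|^2 to [u] forces the maximum to an interior point where [u] is
    positive. There -e |z|^2 touches [u] from above up to a constant, and its Laplacian -4e is
    negative. *)
Lemma max_principle (A : set plane) (u : plane -> R) : compact A ->
  {within A, continuous u} ->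
  (forall z, A z -> u z <= 0 \/ (nbhs z A /\ vsub u z)) ->
  forall z, A z -> u z <= 0.
Proof.
move=> cA cu H z1 Az1; rewrite leNgt; apply/negP => u1.
have A0 : A !=set0 by exists z1.
have cs : {within A, continuous (sqdist 0)}.
  exact: continuous_subspaceT (@sqdist_continuous 0).
have [zM _ HM] := compact_EVT_max A0 cA cs.
(* [M] exceeds |z|^2 on [A], so with e = u z1 / M the added term stays below [u z1] and cannot make
   up for a nonpositive value of [u] at the new maximum. *)
pose M := sqdist 0 zM + 1.
have M0 : 0 < M by rewrite ltr_wpDl// sqdist_ge0.
pose e := u z1 / M.
have e0 : 0 < e by rewrite divr_gt0.
have cw : {within A, continuous (fun z => u z + e * sqdist 0 z)}.
  by move=> z; apply: cvgD; [exact: cu|apply: cvgMl_tmp; exact: cs].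
have [z2] := compact_EVT_max A0 cA cw; rewrite inE => Az2 Hz2.
have := Hz2 z1; rewrite inE => /(_ Az1) h1.
have h2 : e * sqdist 0 z2 < u z1.
  have -> : u z1 = e * M by rewrite /e divfK// gt_eqF.
  rewrite ltr_pM2l// /M; have := HM z2; rewrite inE => /(_ Az2); lra.
have h3 : 0 <= e * sqdist 0 z1 by rewrite mulr_ge0 ?sqdist_ge0// ltW.
have [u2|[nA sub]] := H z2 Az2; first by lra.
have N : \forall y \near z2, u y - (- e * sqdist 0 y) <= u z2 - (- e * sqdist 0 z2).
  apply: filterS nA => y Ay.
  have := Hz2 y; rewrite inE => /(_ Ay); lra.
have := sub _ _ _ (has_partials2Z (- e) (has_partials2_sqdist 0 z2)) N.
by rewrite /= => ?; lra.
Qed.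

End MaximumPrinciple.

(** * Averages over a period, and their differentiation in a parameter *)

Section CircleAverage.
Variable R : realType.

Definition cavg (g : R -> R) : R :=
  (\int[@lebesgue_measure R]_(t in `[0%R, (pi *+ 2)%R]) g t) / (pi *+ 2).

Lemma pi2_gt0 : 0 < pi *+ 2 :> R.
Proof. by rewrite pmulrn_lgt0// pi_gt0. Qed.

Lemma cint_integrable (g : R -> R) : continuous g ->
  (@lebesgue_measure R).-integrable `[0%R, (pi *+ 2)%R] (EFin \o g).
Proof.
move=> cg; apply: continuous_compact_integrable; first exact: segment_compact.
exact: continuous_subspaceT.
Qed.

Lemma cavg_cst (c : R) : cavg (fun _ => c) = c.
Proof.
have e : @lebesgue_measure R `[0%R, (pi *+ 2)%R]%classic = (pi *+ 2)%:E.
  by rewrite lebesgue_measure_itv/= lte_fin pi2_gt0 oppr0 adde0.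
rewrite /cavg Rintegral_cst//; transitivity (c * fine (pi *+ 2 : R)%:E / (pi *+ 2)).
  by congr (_ * fine _ / _); exact: e.
by rewrite /= mulfK// gt_eqF// pi2_gt0.
Qed.

Lemma eq_cavg (f g : R -> R) : f =1 g -> cavg f = cavg g.
Proof. by move=> /funext ->. Qed.

Lemma cavgD (f g : R -> R) : continuous f -> continuous g ->
  cavg (fun t => f t + g t) = cavg f + cavg g.
Proof. by move=> cf cg; rewrite /cavg RintegralD ?mulrDl//; exact: cint_integrable. Qed.

Lemma cavgB (f g : R -> R) : continuous f -> continuous g ->
  cavg (fun t => f t - g t) = cavg f - cavg g.
Proof. by move=> cf cg; rewrite /cavg RintegralB ?mulrBl//; exact: cint_integrable. Qed.

Lemma cavgZ (c : R) (f : R -> R) : continuous f -> cavg (fun t => c * f t) = c * cavg f.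
Proof. by move=> cf; rewrite /cavg RintegralZl ?mulrA//; exact: cint_integrable. Qed.

Lemma cavg_le (f g : R -> R) : continuous f -> continuous g -> (forall t, f t <= g t) ->
  cavg f <= cavg g.
Proof.
move=> cf cg fg; rewrite /cavg ler_pM2r ?invr_gt0 ?pi2_gt0//.
by apply: le_Rintegral => //; exact: cint_integrable.
Qed.

Lemma cavg_norm (f : R -> R) M : continuous f -> (forall t, `|f t| <= M) -> `|cavg f| <= M.
Proof.
move=> cf fM; have cM c : continuous (fun _ : R => c : R) by move=> ?; exact: cvg_cst.
have h1 : cavg (fun _ => - M) <= cavg f.
  by apply: cavg_le => // t; have := fM t; rewrite ler_norml => /andP[].
have h2 : cavg f <= cavg (fun _ => M).
  by apply: cavg_le => // t; have := fM t; rewrite ler_norml => /andP[].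
by rewrite ler_norml; rewrite !cavg_cst in h1 h2; rewrite h1.
Qed.

Lemma cavg_derive (G g : R -> R) : continuous g -> (forall t : R, is_derive t (1 : R) G (g t)) ->
  G (pi *+ 2) = G 0 -> cavg g = 0.
Proof.
move=> cg dG per; have cG : continuous G.
  by move=> t; apply: differentiable_continuous; apply/derivable1_diffP; case: (dG t).
rewrite /cavg /Rintegral (@continuous_FTC2 _ g G)//= ?per ?subrr ?mul0r//.
- exact: pi2_gt0.
- exact: continuous_subspaceT.
- split=> [t _||]; first by case: (dG t).
    by apply: cvg_at_right_filter; exact: cG.
  by apply: cvg_at_left_filter; exact: cG.
- by move=> t _; rewrite derive1E; case: (dG t).
Qed.

Lemma cavg_diff (k k' : R -> R -> R) (a u v C : R) : u < a < v ->
  (forall s, u < s < v -> continuous (k s)) ->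
  (forall s t, u < s < v -> is_derive (s : R) (1 : R) (k ^~ t) (k' s t) /\ `|k' s t| <= C) ->
  is_derive a (1 : R) (fun s => cavg (k s)) (cavg (k' a)).
Proof.
move=> auv ck dk.
have Ia : `]u, v[%classic a by rewrite /= in_itv.
have E s t : u < s < v -> partial1of2 k s t = k' s t.
  by move=> /dk-/(_ t)[[_ e] _]; rewrite partial1of2E.
have C0 : 0 <= C by have [_] := dk a 0 auv; apply: le_trans.
have G1 x : `]u, v[%classic x -> (@lebesgue_measure R).-integrable `[0%R, (pi *+ 2)%R] (EFin \o k x).
  by rewrite /= in_itv/= => /ck; exact: cint_integrable.
have G2 (x y : R) : `]u, v[%classic x -> `[0%R, (pi *+ 2)%R]%classic y -> derivable (k ^~ y) x 1.
  by rewrite /= in_itv/= => /dk-/(_ y)[[]].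
have G3 : (@lebesgue_measure R).-integrable `[0%R, (pi *+ 2)%R] (EFin \o (fun _ : R => C)).
  by apply: cint_integrable => ?; exact: cvg_cst.
have G4 (x y : R) : `]u, v[%classic x -> `[0%R, (pi *+ 2)%R]%classic y -> `|partial1of2 k x y| <= C.
  by rewrite /= in_itv/= => h _; rewrite E//; have [] := dk x y h.
have mB : measurable (`[0%R, (pi *+ 2)%R]%classic : set (measurableTypeR R)).
  exact: measurable_itv.
have D := derivable_under_integral mB Ia G1 G2 (fun _ => C0) G3 G4.
have V := differentiation_under_integral mB Ia G1 G2 (fun _ => C0) G3 G4.
have dF : is_derive a (1 : R) (fun s => \int[@lebesgue_measure R]_(t in `[0%R, (pi *+ 2)%R]) k s t)
  (\int[@lebesgue_measure R]_(t in `[0%R, (pi *+ 2)%R]) k' a t).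
  split => //; rewrite -derive1E V; apply: eq_Rintegral => t _; exact: E.
have := is_deriveZ (pi *+ 2)^-1 dF.
rewrite (_ : _ \*: _ = fun s => cavg (k s)); last by apply/funext => s; rewrite /cavg /= [RHS]mulrC.
by rewrite /cavg [X in _ -> is_derive _ _ _ X]mulrC.
Qed.

End CircleAverage.

(** * The Poisson integral *)

Section PoissonKernel.
Variable R : realType.
Local Notation plane := 'rV[R]_2.

Lemma is_derive_of_line (V W : normedModType R) (f : V -> W) (y v : V) d :
  is_derive (0 : R) (1 : R) (fun s : R => f (s *: v + y)) d -> is_derive y v f d.
Proof.
rewrite /derive => -[h1 h2].
have E : (fun h : R => h^-1 *: (f ((h *: (1:R) + 0) *: v + y) - f ((0 : R) *: v + y))) =
  (fun h : R => h^-1 *: (f (h *: v + y) - f y)).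
  by apply/funext => h; rewrite addr0 [h *: (1:R)]mulr1 scale0r add0r.
split; first by move: h1; rewrite /derivable /= E.
by move: h2; rewrite /derive /= E.
Qed.

(** Bounded partial derivatives make [f] Lipschitz near [z], by one mean value step in each
    coordinate. Continuity of a circle integral depending on [z] will follow from a bound on its
    derivatives. *)
Lemma bounded_partials_continuous (f : plane -> R) z (d : 'I_2 -> plane -> R) (C : R) :
  (\forall y \near z, forall i, is_derive y (delta_mx 0 i) f (d i y) /\ `|d i y| <= C) ->
  {for z, continuous f}.
Proof.
move=> /near0_norm[e e0 H]; apply/(@cvgrPdist_le _ _ _ (nbhs z)) => eps eps0.
have C0 : 0 <= C.
  by have [_] := H 0 (ltac:(by rewrite normr0)) 0; apply: le_trans.
pose e1 := minr (e / 2) (eps / (2 * (C + 1))).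
have C1 : 0 < 2 * (C + 1) by rewrite mulr_gt0// ltr_wpDl.
have e10 : 0 < e1 by rewrite lt_min !divr_gt0.
apply/nbhs_ballP; exists e1 => // y; rewrite -ball_normE /ball_ /= -normrN opprB => hy.
pose v := y - z.
have yE : y = v 0 1 *: delta_mx 0 1 + (v 0 0 *: delta_mx 0 0 + z).
  by apply/rowP => i; rewrite !mxE; have [->|->] := I2P i; rewrite /=; ring.
have [v2 veps] : `|v| < e / 2 /\ `|v| < eps / (2 * (C + 1)).
  by apply/andP; move: hy; rewrite lt_min.
have nd (t : R) i : `|t| <= `|v| -> `|t *: delta_mx 0 i : plane| <= `|v|.
  by move=> tv; rewrite normrZ (le_trans _ tv)// ler_piMr// delta_norm.
have hv w : `|w| < e -> forall i, is_derive (w + z) (delta_mx 0 i) f (d i (w + z)) /\ `|d i (w + z)| <= C.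
  by move=> we; exact: H.
have v00 := mx_norm_le v 0; have v01 := mx_norm_le v 1.
have L1 (t : R) : `|t| <= `|v 0 0| -> `|t *: delta_mx 0 0 : plane| < e.
  by move=> tv; have := nd t 0 (le_trans tv v00); lra.
have L2 (t : R) : `|t| <= `|v 0 1| -> `|t *: delta_mx 0 1 + v 0 0 *: delta_mx 0 0 : plane| < e.
  move=> tv; apply: (le_lt_trans (ler_normD _ _)).
  have := nd t 1 (le_trans tv v01); have := nd _ 0 v00; lra.
have [t1 h1 E1] := line_mvt (fun t ht => (hv _ (L1 t ht) 0).1).
have L3 (t : R) : `|t| <= `|v 0 1| -> is_derive (t *: delta_mx 0 1 + (v 0 0 *: delta_mx 0 0 + z)) (delta_mx 0 1)
    f (d 1 (t *: delta_mx 0 1 + v 0 0 *: delta_mx 0 0 + z)).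
  by move=> ht; rewrite addrA; exact: (hv _ (L2 t ht) 1).1.
have [t2 h2 E2] := line_mvt L3.
have -> : f z - f y = - (v 0 0 * d 0 (t1 *: delta_mx 0 0 + z) +
   v 0 1 * d 1 (t2 *: delta_mx 0 1 + v 0 0 *: delta_mx 0 0 + z)).
  by rewrite -E1 -E2 -yE; ring.
rewrite normrN; apply: (le_trans (ler_normD _ _)); rewrite !normrM.
have k1 : `|v 0 0| * `|d 0 (t1 *: delta_mx 0 0 + z)| <= `|v| * C.
  by apply: ler_pM => //; exact: (hv _ (L1 t1 h1) 0).2.
have k2 : `|v 0 1| * `|d 1 (t2 *: delta_mx 0 1 + v 0 0 *: delta_mx 0 0 + z)| <= `|v| * C.
  by apply: ler_pM => //; exact: (hv _ (L2 t2 h2) 1).2.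
rewrite ltr_pdivlMr// in veps.
have := normr_ge0 v; nra.
Qed.

Lemma has_partialsV m (f : 'rV[R]_m -> R) x df : f x != 0 -> has_partials f x df ->
  has_partials (fun z => (f z)^-1) x (fun i z => df i z * - ((f z)^-1 * (f z)^-1)).
Proof.
move=> fx H; apply: (has_partials_comp1 (h := fun s => s^-1) (dh := fun s => - (s^-1 * s^-1))) H.
have N : \forall s \near f x, s != 0 :> R.
  by apply: open_nbhs_nbhs; split => //; exact: open_neq.
apply: filterS N => s s0; split.
  have h := is_deriveV (f := id) s0 (is_derive_id s (1 : R)).
  by apply: is_derive_eq h _; rewrite /= [LHS]mulr1 expr2 invfM.
by apply: cvgN; apply: cvgM; apply: cvgV.
Qed.

Section Kernel.
Variables (a : plane) (r : R).

Definition cpt (t : R) : plane :=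
  \row_(i < 2) (a 0 i + r * (if i == 0 then cos t else sin t)).

Lemma cpt0 t : cpt t 0 0 = a 0 0 + r * cos t. Proof. by rewrite mxE. Qed.

Lemma cpt1 t : cpt t 0 1 = a 0 1 + r * sin t. Proof. by rewrite mxE. Qed.

Lemma sqdist_cpt t : sqdist a (cpt t) = r ^+ 2.
Proof.
rewrite sqdistE cpt0 cpt1 -[RHS]mulr1 -(cos2Dsin2 t); ring.
Qed.

Lemma cpt_continuous : continuous cpt.
Proof.
move=> t; apply: (@cvg_rowP _ _ (nbhs t)) => i; rewrite mxE.
rewrite (_ : (fun x => cpt x 0 i) = fun t => a 0 i + r * (if i == 0 then cos t else sin t)).
  apply: cvgD; first exact: cvg_cst.
  apply: cvgMl_tmp; case: ifP => _; [exact: continuous_cos|exact: continuous_sin].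
by apply/funext => s; rewrite mxE.
Qed.

Definition cden (z : plane) (t : R) := sqdist z (cpt t).

(* The powers of 1 / (zeta - z), for zeta on the circle, times zeta - a;
   a complex number is represented by its real and imaginary parts. *)
Definition cinv1 (z : plane) (t : R) : R := (cpt t 0 0 - z 0 0) / cden z t.
Definition cinv2 (z : plane) (t : R) : R := - ((cpt t 0 1 - z 0 1) / cden z t).

Fixpoint ckernel (k : nat) (z : plane) (t : R) : R * R :=
  if k is k'.+1 then
    let p := ckernel k' z t in
    (p.1 * cinv1 z t - p.2 * cinv2 z t, p.1 * cinv2 z t + p.2 * cinv1 z t)
  else (r * cos t, r * sin t).

Lemma cdenE z t : cden z t = (cpt t 0 0 - z 0 0) ^+ 2 + (cpt t 0 1 - z 0 1) ^+ 2.
Proof. by rewrite /cden sqdistE. Qed.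

Lemma has_partials_den t z : has_partials (cden^~ t) z (fun i z => 2 * (z 0 i - cpt t 0 i)).
Proof.
apply: has_partials_eq (has_partials2_sqdist (cpt t) z).1 => [|i].
  by apply: near_eq_all => y; rewrite /cden sqdistC.
exact: near_eq_refl.
Qed.

(** Real form of the rule that 1 / (zeta - z) has complex derivative 1 / (zeta - z)^2 in z;
    differentiation in the second coordinate multiplies this by i. *)
Lemma has_partials_cinv z t : cden z t != 0 ->
  has_partials (cinv1^~ t) z (fun i z => if i == 0 then cinv1 z t ^+ 2 - cinv2 z t ^+ 2
    else - (2 * cinv1 z t * cinv2 z t)) /\
  has_partials (cinv2^~ t) z (fun i z => if i == 0 then 2 * cinv1 z t * cinv2 z t
    else cinv1 z t ^+ 2 - cinv2 z t ^+ 2).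
Proof.
move=> d0; have V := has_partialsV (f := cden^~ t) d0 (has_partials_den t z).
have X i := has_partialsB (has_partials_cst (cpt t 0 i) z) (has_partials_coord i z).
split.
  apply: has_partials_eq (has_partialsM (X 0) V) => [|i]; apply: near_eq_all => y //.
  rewrite /cinv1 /cinv2 /=; have E := cdenE y t.
  (* The formulas are compared at every [y]; where the denominator vanishes, its inverse is 0 by
     convention and both sides are 0. *)
  have [e|e] := eqVneq (cden y t) 0.
    by rewrite e invr0; have [->|->] := I2P i => /=; ring.
  by rewrite E in e *; have [->|->] := I2P i => /=; field.
have := has_partialsN (has_partialsM (X 1) V).
apply: has_partials_eq => [|i]; apply: near_eq_all => y //.
rewrite /cinv1 /cinv2 /=; have E := cdenE y t.
have [e|e] := eqVneq (cden y t) 0.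
  by rewrite e invr0; have [->|->] := I2P i => /=; ring.
by rewrite E in e *; have [->|->] := I2P i => /=; field.
Qed.

(** The complex derivative of (zeta - a) / (zeta - z)^k is k (zeta - a) / (zeta - z)^(k+1), so
    differentiation stays inside the family of kernels. *)
Lemma has_partials_ckernel k z t : cden z t != 0 ->
  has_partials (fun z => (ckernel k z t).1) z (fun i z => k%:R *
    if i == 0 then (ckernel k.+1 z t).1 else - (ckernel k.+1 z t).2) /\
  has_partials (fun z => (ckernel k z t).2) z (fun i z => k%:R *
    if i == 0 then (ckernel k.+1 z t).2 else (ckernel k.+1 z t).1).
Proof.
move=> d0; have [W1 W2] := has_partials_cinv d0.
elim: k => [|k [IH1 IH2]].
  by split; (apply: has_partials_eq (has_partials_cst _ z) => [|i]; apply: near_eq_all => y);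
    rewrite /= ?mul0r.
split.
  apply: has_partials_eq (has_partialsB (has_partialsM IH1 W1) (has_partialsM IH2 W2)) => [|i];
    apply: near_eq_all => y //=.
  by rewrite -natr1; case: ifP => _; ring.
apply: has_partials_eq (has_partialsD (has_partialsM IH1 W2) (has_partialsM IH2 W1)) => [|i];
  apply: near_eq_all => y //=.
by rewrite -natr1; case: ifP => _; ring.
Qed.

Lemma ckernel_bound k (d : R) : 0 < d -> exists M, forall z t, d <= cden z t ->
  `|(ckernel k z t).1| <= M /\ `|(ckernel k z t).2| <= M.
Proof.
(* The quotients are bounded by the square root of 1 / d, and [W] bounds that root without
   extracting it. *)
move=> d0; pose W := 1 + d^-1.
have hW (x e : R) : d <= e -> x ^+ 2 <= e -> `|x / e| <= W.
  move=> de xe; have e0 : 0 < e := lt_le_trans d0 de.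
  have h : (x / e) ^+ 2 <= d^-1.
    rewrite (_ : (x / e) ^+ 2 = (x ^+ 2 / e) * e^-1); last by field; rewrite gt_eqF.
    rewrite -[leRHS]mul1r; apply: ler_pM; rewrite ?divr_ge0 ?invr_ge0 ?sqr_ge0 ?(ltW e0)//.
      by rewrite ler_pdivrMr// mul1r.
    by rewrite lef_pV2 ?posrE.
  have := sqr_ge0 (`|x / e| - 1 / 2); rewrite -sqr_normr in h.
  have := normr_ge0 (x / e); rewrite /W; have : 0 < d^-1 by rewrite invr_gt0.
  nra.
have W0 : 0 <= W by rewrite /W addr_ge0// invr_ge0 ltW.
elim: k => [|k [M IH]].
  exists `|r| => z t _ /=; rewrite !normrM.
  split; apply: ler_piMr => //; rewrite ler_norml; first by rewrite cos_geN1 cos_le1.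
  by rewrite sin_geN1 sin_le1.
exists (M * W + M * W) => z t dz.
have [h1 h2] := IH z t dz.
have w1 : `|cinv1 z t| <= W.
  by apply: hW => //; rewrite cdenE; have := sqr_ge0 (cpt t 0 1 - z 0 1); lra.
have w2 : `|cinv2 z t| <= W.
  by rewrite normrN; apply: hW => //; rewrite cdenE; have := sqr_ge0 (cpt t 0 0 - z 0 0); lra.
by split => /=; [apply: (le_trans (ler_normB _ _))|apply: (le_trans (ler_normD _ _))];
  apply: lerD; rewrite normrM; apply: ler_pM.
Qed.

Lemma ckernel_continuous k z : (forall t, cden z t != 0) ->
  continuous (fun t => (ckernel k z t).1) /\ continuous (fun t => (ckernel k z t).2).
Proof.
move=> d0.
have cp i : continuous (fun t => cpt t 0 i - z 0 i).
  move=> t; apply: cvgB; last exact: cvg_cst.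
  apply: (@cvg_comp _ _ _ cpt (fun v : plane => v 0 i) _ (nbhs (cpt t))); first exact: cpt_continuous.
  exact: (@coord_continuous _ _ _ 0 i).
have cd : continuous (cden z).
  move=> t; apply: (@cvg_comp _ _ _ cpt (sqdist z) _ (nbhs (cpt t))); first exact: cpt_continuous.
  exact: sqdist_continuous.
have cdV : continuous (fun t => (cden z t)^-1) by move=> t; apply: cvgV => //; exact: cd.
have c1 : continuous (cinv1 z) by move=> t; apply: cvgM; [exact: cp|exact: cdV].
have c2 : continuous (cinv2 z) by move=> t; apply: cvgN; apply: cvgM; [exact: cp|exact: cdV].
elim: k => [|k [IH1 IH2]].
  split=> t /=; apply: cvgMl_tmp; [exact: continuous_cos|exact: continuous_sin].
split=> t /=.
  by apply: cvgB; apply: cvgM; [exact: IH1|exact: c1|exact: IH2|exact: c2].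
by apply: cvgD; apply: cvgM; [exact: IH1|exact: c2|exact: IH2|exact: c1].
Qed.

Hypothesis r0 : 0 < r.

Lemma cauchy_schwarz2 (u v : plane) : dot u v ^+ 2 <= dot u u * dot v v.
Proof.
rewrite !dot2E; have := sqr_ge0 (u 0 0 * v 0 1 - u 0 1 * v 0 0).
by rewrite -subr_ge0 => h; rewrite -subr_ge0 (le_trans h)// le_eqVlt; apply/orP; left; apply/eqP; ring.
Qed.

(** The reverse triangle inequality for squared distances, from Cauchy-Schwarz applied to the
    vectors from the centre to the two points. *)
Lemma cden_lower (s : R) z t : 0 <= s <= r -> sqdist a z <= s ^+ 2 -> (r - s) ^+ 2 <= cden z t.
Proof.
move=> /andP[s0 sr] az; pose p := cpt t - a; pose q := z - a.
have pp : dot p p = r ^+ 2 := sqdist_cpt t.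
have qq : dot q q <= s ^+ 2 := az.
have q0 : 0 <= dot q q := sqdist_ge0 a z.
have pq : dot p q <= r * Num.sqrt (dot q q).
  have [n|n] := leP 0 (dot p q); last by rewrite (le_trans (ltW n))// mulr_ge0 ?sqrtr_ge0// ltW.
  rewrite -(ler_pXn2r (n := 2)) ?nnegrE// ?mulr_ge0 ?sqrtr_ge0 ?(ltW r0)//.
  by rewrite exprMn sqr_sqrtr// -pp cauchy_schwarz2.
have E : cden z t = r ^+ 2 - 2 * dot p q + dot q q.
  by rewrite -pp /p /q !dot2E cdenE !mxE; ring.
pose y := Num.sqrt (dot q q); have y0 : 0 <= y := sqrtr_ge0 _.
have yy : dot q q = y ^+ 2 by rewrite /y sqr_sqrtr.
have ys : y <= s by rewrite -(ler_pXn2r (n := 2)) ?nnegrE// -yy.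
apply: (@le_trans _ _ ((r - y) ^+ 2)).
  by rewrite ler_pXn2r ?nnegrE ?subr_ge0// ?(le_trans ys)// lerB.
rewrite E yy; rewrite -/y in pq; rewrite -subr_ge0.
rewrite (_ : _ - _ = 2 * (r * y - dot p q)); last by ring.
by rewrite mulr_ge0// subr_ge0.
Qed.

Lemma odisc_shrink z : odisc a r z ->
  exists s, [/\ 0 < s, s < r & odisc a s z].
Proof.
move=> az; pose y := Num.sqrt (sqdist a z); have y0 : 0 <= y := sqrtr_ge0 _.
have yy : sqdist a z = y ^+ 2 by rewrite /y sqr_sqrtr// sqdist_ge0.
have yr : y < r by rewrite -(ltr_pXn2r (n := 2)) ?nnegrE ?(ltW r0)// -yy.
exists ((y + r) / 2); split; [lra|lra|].
rewrite /odisc /= yy ltr_pXn2r ?nnegrE//; lra.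
Qed.

Lemma cden_gt0 z t : odisc a r z -> cden z t != 0.
Proof.
move=> /odisc_shrink[s [s0 sr zs]].
have h : 0 <= s <= r by rewrite !ltW.
rewrite gt_eqF// (lt_le_trans _ (cden_lower t h (ltW zs)))// exprn_gt0// subr_gt0//.
Qed.

Section Coefficients.
Variables (g : R -> R) (G : R).
Hypotheses (gc : continuous g) (gG : forall t, `|g t| <= G).

(** Since d zeta = i (zeta - a) dt, the two moments of order k are the real and imaginary parts of
    the Cauchy integral of g d zeta / (zeta - z)^k over the circle, divided by 2 pi i. *)
Definition cmoment1 k z := cavg (fun t => g t * (ckernel k z t).1).
Definition cmoment2 k z := cavg (fun t => g t * (ckernel k z t).2).

Lemma cmoment_continuous k z : odisc a r z ->
  continuous (fun t => g t * (ckernel k z t).1) /\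
  continuous (fun t => g t * (ckernel k z t).2).
Proof.
move=> az; have [c1 c2] := ckernel_continuous k (fun t => cden_gt0 t az).
by split=> t; apply: cvgM; [exact: gc|exact: c1|exact: gc|exact: c2].
Qed.

Lemma cmoment_bound k z : odisc a r z -> exists C, \forall y \near z,
  `|cmoment1 k y| <= C /\ `|cmoment2 k y| <= C.
Proof.
move=> /odisc_shrink[s [s0 sr zs]].
have h : 0 <= s <= r by rewrite !ltW.
have d0 : 0 < (r - s) ^+ 2 by rewrite exprn_gt0// subr_gt0.
have [M HM] := ckernel_bound k d0; exists (G * M).
apply: filterS (odisc_nbhs zs) => y ys.
have yr : odisc a r y.
  by apply: lt_trans ys _; rewrite ltr_pXn2r ?nnegrE// ltW.
have [c1 c2] := cmoment_continuous k yr.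
by split; apply: cavg_norm => // t; rewrite normrM; apply: ler_pM => //;
  have [] := HM y t (cden_lower t h (ltW ys)).
Qed.

Lemma cmoment_derive k z i : odisc a r z ->
  is_derive z (delta_mx 0 i) (cmoment1 k)
    (k%:R * if i == 0 then cmoment1 k.+1 z else - cmoment2 k.+1 z) /\
  is_derive z (delta_mx 0 i) (cmoment2 k)
    (k%:R * if i == 0 then cmoment2 k.+1 z else cmoment1 k.+1 z).
Proof.
move=> az; have [s [s0 sr zs]] := odisc_shrink az.
have h : 0 <= s <= r by rewrite !ltW.
have d0 : 0 < (r - s) ^+ 2 by rewrite exprn_gt0// subr_gt0.
have [M HM] := ckernel_bound k.+1 d0.
have [e e0 He] := near0_norm (odisc_nbhs zs).
have H u : - e < u < e -> odisc a s (u *: delta_mx 0 i + z).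
  rewrite -ltr_norml => ue; apply: He; rewrite normrZ (le_lt_trans _ ue)//.
  by rewrite ler_piMr// delta_norm.
have H' u : - e < u < e -> odisc a r (u *: delta_mx 0 i + z).
  by move=> /H ys; apply: lt_trans ys _; rewrite ltr_pXn2r ?nnegrE// ltW.
have He0 : - e < 0 < e by rewrite oppr_lt0 e0.
have [c1 c2] := cmoment_continuous k.+1 az.
have Hk u t : - e < u < e -> `|k%:R * (ckernel k.+1 (u *: delta_mx 0 i + z) t).1| <= k%:R * M /\
   `|k%:R * (ckernel k.+1 (u *: delta_mx 0 i + z) t).2| <= k%:R * M.
  move=> ue; rewrite !normrM normr_nat.
  have [] := HM _ t (cden_lower t h (ltW (H u ue))).
  by move=> *; split; apply: ler_wpM2l.
have D u t : - e < u < e -> has_partials (fun z => (ckernel k z t).1) (u *: delta_mx 0 i + z)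
   (fun i z => k%:R * if i == 0 then (ckernel k.+1 z t).1 else - (ckernel k.+1 z t).2) /\
  has_partials (fun z => (ckernel k z t).2) (u *: delta_mx 0 i + z) (fun i z => k%:R *
    if i == 0 then (ckernel k.+1 z t).2 else (ckernel k.+1 z t).1).
  by move=> ue; apply: has_partials_ckernel; apply: cden_gt0; exact: H'.
split; apply: is_derive_of_line.
- have E : k%:R * (if i == 0 then cmoment1 k.+1 z else - cmoment2 k.+1 z) =
      cavg (fun t => g t * (k%:R * if i == 0 then (ckernel k.+1 ((0 : R) *: delta_mx 0 i + z) t).1
        else - (ckernel k.+1 ((0 : R) *: delta_mx 0 i + z) t).2)).
    rewrite scale0r add0r; case: ifP => _.
      by rewrite -cavgZ//; apply: eq_cavg => t; ring.
    by rewrite -mulN1r mulrA -cavgZ//; apply: eq_cavg => t; ring.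
  rewrite E; apply: (@cavg_diff _ (fun u t => g t * (ckernel k (u *: delta_mx 0 i + z) t).1)
   (fun u t => g t * (k%:R * if i == 0 then (ckernel k.+1 (u *: delta_mx 0 i + z) t).1
        else - (ckernel k.+1 (u *: delta_mx 0 i + z) t).2)) 0 (- e) e (G * (k%:R * M)) He0).
    by move=> u ue; have [] := cmoment_continuous k (H' u ue).
  move=> u t ue; have [D1 _] := D u t ue; split.
    have := is_deriveZ (g t) (is_derive_line (nbhs_singleton D1 i).1); apply.
  have [k1 k2] := Hk u t ue; rewrite normrM; apply: ler_pM => //.
  by case: ifP => _ //; rewrite mulrN normrN.
- have E : k%:R * (if i == 0 then cmoment2 k.+1 z else cmoment1 k.+1 z) =
      cavg (fun t => g t * (k%:R * if i == 0 then (ckernel k.+1 ((0 : R) *: delta_mx 0 i + z) t).2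
        else (ckernel k.+1 ((0 : R) *: delta_mx 0 i + z) t).1)).
    by rewrite scale0r add0r; case: ifP => _;
      rewrite -cavgZ//; apply: eq_cavg => t; ring.
  rewrite E; apply: (@cavg_diff _ (fun u t => g t * (ckernel k (u *: delta_mx 0 i + z) t).2)
   (fun u t => g t * (k%:R * if i == 0 then (ckernel k.+1 (u *: delta_mx 0 i + z) t).2
        else (ckernel k.+1 (u *: delta_mx 0 i + z) t).1)) 0 (- e) e (G * (k%:R * M)) He0).
    by move=> u ue; have [] := cmoment_continuous k (H' u ue).
  move=> u t ue; have [_ D1] := D u t ue; split.
    have := is_deriveZ (g t) (is_derive_line (nbhs_singleton D1 i).1); apply.
  have [k1 k2] := Hk u t ue; rewrite normrM; apply: ler_pM => //.
  by case: ifP => _.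
Qed.

Lemma cmoment_continuous_at k z : odisc a r z ->
  {for z, continuous (cmoment1 k)} /\ {for z, continuous (cmoment2 k)}.
Proof.
move=> az; have [C HC] := cmoment_bound k.+1 az.
have b y i : `|cmoment1 k.+1 y| <= C -> `|cmoment2 k.+1 y| <= C ->
   `|k%:R * if i == 0 :> 'I_2 then cmoment1 k.+1 y else - cmoment2 k.+1 y| <= k%:R * C /\
   `|k%:R * if i == 0 :> 'I_2 then cmoment2 k.+1 y else cmoment1 k.+1 y| <= k%:R * C.
  have kC x : `|x| <= C -> `|k%:R * x| <= k%:R * C by move=> h; rewrite normrM normr_nat ler_wpM2l.
  by move=> h1 h2; case: ifP => _; split; apply: kC => //; rewrite [leLHS]normrN.
split.
  apply: (@bounded_partials_continuous _ _ (fun i y => k%:R *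
     if i == 0 :> 'I_2 then cmoment1 k.+1 y else - cmoment2 k.+1 y) (k%:R * C)).
  apply: filterS2 HC (odisc_nbhs az) => y [h1 h2] ay i; split; first exact: (cmoment_derive k i ay).1.
  exact: (b y i h1 h2).1.
apply: (@bounded_partials_continuous _ _ (fun i y => k%:R *
   if i == 0 :> 'I_2 then cmoment2 k.+1 y else cmoment1 k.+1 y) (k%:R * C)).
apply: filterS2 HC (odisc_nbhs az) => y [h1 h2] ay i; split; first exact: (cmoment_derive k i ay).2.
exact: (b y i h1 h2).2.
Qed.

Lemma has_partials_cmoment k z : odisc a r z ->
  has_partials (cmoment1 k) z
    (fun i z => k%:R * if i == 0 then cmoment1 k.+1 z else - cmoment2 k.+1 z) /\ has_partials (cmoment2 k) z
    (fun i z => k%:R * if i == 0 then cmoment2 k.+1 z else cmoment1 k.+1 z).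
Proof.
have K (f : plane -> R) y : {for y, continuous f} -> {for y, continuous (fun z => k%:R * f z)}.
  by move=> c; exact: (cvgM (cvg_cst _) c).
move=> az; split; apply: filterS (odisc_nbhs az) => y ay i.
  have [D _] := cmoment_derive k i ay; split; first exact: D.
  have [c1 c2] := cmoment_continuous_at k.+1 ay; apply: K.
  by have [->|->] := I2P i => //=; exact: (cvgN c2).
have [_ D] := cmoment_derive k i ay; split; first exact: D.
have [c1 c2] := cmoment_continuous_at k.+1 ay; apply: K.
by have [->|->] := I2P i.
Qed.

(** The Poisson kernel is the real part of 2 (zeta - a) / (zeta - z) - 1. In this form all
    derivatives of the integral are moments, and harmonicity is read off the third moments. *)
Definition poisson_int (z : plane) : R := 2 * cmoment1 1 z - cavg g.

Lemma has_partials2_poisson z : odisc a r z ->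
  has_partials2 poisson_int z
    (fun i z => 2 * if i == 0 then cmoment1 2 z else - cmoment2 2 z)
    (fun i j z => 4 * if i == 0 then (if j == 0 then cmoment1 3 z else - cmoment2 3 z)
       else - (if j == 0 then cmoment2 3 z else cmoment1 3 z)).
Proof.
move=> az; have [M1 M2] := has_partials_cmoment 1 az.
have [N1 N2] := has_partials_cmoment 2 az.
split.
  apply: has_partials_eq (has_partialsB (has_partialsZ 2 M1) (has_partials_cst (cavg g) z)) => [|i];
    apply: near_eq_all => y //=.
  by rewrite subr0 mul1r.
move=> i; have [->|->] := I2P i.
  by apply: has_partials_eq (has_partialsZ 2 N1) => [|j]; apply: near_eq_all => y //=; ring.
apply: has_partials_eq (has_partialsZ 2 (has_partialsN N2)) => [|j]; apply: near_eq_all => y //=.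
by ring.
Qed.

Definition pkernel z t : R := 2 * (ckernel 1 z t).1 - 1.

Lemma pkernel_continuous z : odisc a r z -> continuous (pkernel z).
Proof.
move=> az t; apply: cvgB; last exact: cvg_cst.
by apply: cvgMl_tmp; exact: (ckernel_continuous 1 (fun t => cden_gt0 t az)).1.
Qed.

Lemma poisson_intE z : odisc a r z -> poisson_int z = cavg (fun t => g t * pkernel z t).
Proof.
move=> az; have [c1 _] := cmoment_continuous 1 az.
rewrite /poisson_int /cmoment1 -cavgZ// -cavgB//; last by move=> t; apply: cvgMl_tmp; exact: c1.
by apply: eq_cavg => t; rewrite /pkernel; ring.
Qed.

Lemma pkernelE z t : odisc a r z -> pkernel z t = (r ^+ 2 - sqdist a z) / cden z t.
Proof.
move=> az; have d0 := cden_gt0 t az.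
apply: (mulIf d0); rewrite divfK// /pkernel /= /cinv1 /cinv2.
rewrite (_ : _ * cden z t = 2 * (r * cos t * (cpt t 0 0 - z 0 0) + r * sin t * (cpt t 0 1 - z 0 1)) - cden z t).
  have -> : r ^+ 2 = r ^+ 2 * (cos t ^+ 2 + sin t ^+ 2) by rewrite cos2Dsin2 mulr1.
  by rewrite cdenE sqdistE cpt0 cpt1; ring.
by field.
Qed.

End Coefficients.
End Kernel.
End PoissonKernel.

Section PoissonFormula.
Variable R : realType.
Local Notation plane := 'rV[R]_2.
Variables (a : plane) (r : R).
Hypothesis r0 : 0 < r.

Lemma is_derive_cpt t : is_derive (t : R) (1 : R) (fun t => cpt a r t 0 0) (- (r * sin t)) /\
  is_derive (t : R) (1 : R) (fun t => cpt a r t 0 1) (r * cos t).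
Proof.
split.
  rewrite (_ : (fun t => _) = (cst (a 0 0) + r \*: cos)); last by apply/funext => s; rewrite cpt0.
  by apply: is_derive_eq (is_deriveD (is_derive_cst _ _ _) (is_deriveZ r (is_derive_cos t))) _;
    rewrite add0r; exact: mulrN.
rewrite (_ : (fun t => _) = (cst (a 0 1) + r \*: sin)); last by apply/funext => s; rewrite cpt1.
by apply: is_derive_eq (is_deriveD (is_derive_cst _ _ _) (is_deriveZ r (is_derive_sin t))) _;
  rewrite add0r.
Qed.

(* The second power of the Cauchy kernel is a derivative along the circle. *)
Lemma is_derive_cinv z t : odisc a r z ->
  is_derive (t : R) (1 : R) (cinv1 a r z) (ckernel a r 2 z t).2 /\
  is_derive (t : R) (1 : R) (cinv2 a r z) (- (ckernel a r 2 z t).1).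
Proof.
move=> az; have d0 := cden_gt0 r0 t az.
have [C0 C1] := is_derive_cpt t.
have X : is_derive t (1 : R) (fun t => cpt a r t 0 0 - z 0 0) (- (r * sin t)).
  by apply: is_derive_eq (is_deriveB C0 (is_derive_cst (z 0 0) _ _)) _; rewrite subr0.
have Y : is_derive t (1 : R) (fun t => cpt a r t 0 1 - z 0 1) (r * cos t).
  by apply: is_derive_eq (is_deriveB C1 (is_derive_cst (z 0 1) _ _)) _; rewrite subr0.
have D : is_derive t (1 : R) (cden a r z) (2 * (- (r * sin t) * (cpt a r t 0 0 - z 0 0) + (r * cos t) * (cpt a r t 0 1 - z 0 1))).
  rewrite (_ : cden a r z = (fun t => cpt a r t 0 0 - z 0 0) * (fun t => cpt a r t 0 0 - z 0 0) +
     (fun t => cpt a r t 0 1 - z 0 1) * (fun t => cpt a r t 0 1 - z 0 1)); last first.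
    by apply/funext => s; rewrite cdenE !expr2.
  apply: is_derive_eq (is_deriveD (is_deriveM X X) (is_deriveM Y Y)) _.
  by rewrite /GRing.scale /=; ring.
have V := is_deriveV d0 D.
have E := cdenE a r z t.
split.
  apply: is_derive_eq (is_deriveM X V) _.
  rewrite /= /cinv1 /cinv2 /GRing.scale /= E in d0 *.
  by field.
rewrite (_ : cinv2 a r z = - ((fun t => cpt a r t 0 1 - z 0 1) * (fun t => (cden a r z t)^-1)))//.
apply: is_derive_eq (is_deriveN (is_deriveM Y V)) _.
rewrite /= /cinv1 /cinv2 /GRing.scale /= E in d0 *.
by field.
Qed.

Lemma cpt_2pi : cpt a r (pi *+ 2) = cpt a r 0.
Proof. by apply/rowP => i; rewrite !mxE cos2pi sin2pi cos0 sin0. Qed.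

Let one_cont : continuous (fun _ : R => 1 : R).
Proof. by move=> t; exact: cvg_cst. Qed.

Let one_bound : forall t : R, `|1 : R| <= 1.
Proof. by move=> _; rewrite normr1. Qed.

Lemma cmoment_2_one z : odisc a r z ->
  cmoment1 a r (fun _ => 1) 2 z = 0 /\ cmoment2 a r (fun _ => 1) 2 z = 0.
Proof.
move=> az; have [c1 c2] := ckernel_continuous 2 (fun t => cden_gt0 r0 t az).
split.
  rewrite /cmoment1; transitivity (cavg (fun t => -1 * - (ckernel a r 2 z t).1)).
    by apply: eq_cavg => t; ring.
  rewrite cavgZ; last by move=> t; apply: cvgN; exact: c1.
  suff -> : cavg (fun t => - (ckernel a r 2 z t).1) = 0 by rewrite mulr0.
  apply: (@cavg_derive _ (cinv2 a r z)).
  - by move=> t; apply: cvgN; exact: c1.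
  - by move=> t; exact: (is_derive_cinv t az).2.
  - by rewrite /cinv2 /cden cpt_2pi.
rewrite /cmoment2; transitivity (cavg (fun t => (ckernel a r 2 z t).2)).
  by apply: eq_cavg => t; rewrite mul1r.
apply: (@cavg_derive _ (cinv1 a r z)) => //.
- by move=> t; exact: (is_derive_cinv t az).1.
- by rewrite /cinv1 /cden cpt_2pi.
Qed.

Lemma odisc_center : odisc a r a.
Proof. by rewrite /odisc /= sqdistxx exprn_gt0. Qed.

Lemma sqdist_ray (v : plane) (t : R) : sqdist a (t *: v + a) = t ^+ 2 * sqdist a (v + a).
Proof. by rewrite !sqdistE !mxE; ring. Qed.

Lemma odisc_ray (v : plane) (t : R) : odisc a r (v + a) -> 0 <= t <= 1 -> odisc a r (t *: v + a).
Proof.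
move=> av /andP[t0 t1]; rewrite /odisc /= sqdist_ray.
apply: le_lt_trans av; rewrite ler_piMl ?sqdist_ge0//.
by rewrite exprn_ile1.
Qed.

Lemma pkernel_center t : pkernel a r a t = 1.
Proof.
rewrite pkernelE//; last exact: odisc_center.
by rewrite sqdistxx subr0 /cden sqdist_cpt divff// gt_eqF// exprn_gt0.
Qed.

(** The derivatives of the first moment of the constant 1 are second moments, which vanish. The
    average is thus constant along rays from the centre, where the kernel is identically 1. *)
Lemma cavg_pkernel z : odisc a r z -> cavg (pkernel a r z) = 1.
Proof.
move=> az.
have E y : odisc a r y -> cavg (pkernel a r y) = poisson_int a r (fun _ => 1) y.
  move=> ay; rewrite (poisson_intE r0 one_cont)//.
  by apply: eq_cavg => t; rewrite mul1r.
have C : cavg (pkernel a r a) = 1.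
  by rewrite -[RHS]cavg_cst; apply: eq_cavg => t; exact: pkernel_center.
suff S : cmoment1 a r (fun _ => 1) 1 z = cmoment1 a r (fun _ => 1) 1 a.
  apply: etrans C; apply: etrans (E z az) _; apply: etrans _ (esym (E a odisc_center)).
  by rewrite /poisson_int S.
have azv : odisc a r ((z - a) + a) by rewrite subrK.
have D (t : R) : 0 <= t <= 1 -> is_derive (t *: (z - a) + a) (z - a) (cmoment1 a r (fun _ => 1) 1) 0.
  move=> ht; have ay := odisc_ray azv ht.
  have [H _] := has_partials_cmoment r0 one_cont one_bound 1 ay.
  apply: is_derive_eq (has_partials_derive (z - a) H) _.
  have [e1 e2] := cmoment_2_one ay.
  by apply: big1 => i _; rewrite e1 e2 oppr0 if_same !mulr0.
have [t _] := ray_mvt (g := fun _ => 0) ltr01 D.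
by rewrite scale1r subrK mulr0 => /eqP; rewrite subr_eq0 => /eqP.
Qed.

Lemma pkernel_ge0 z t : odisc a r z -> 0 <= pkernel a r z t.
Proof.
move=> az; rewrite pkernelE// divr_ge0//; first by rewrite subr_ge0 ltW.
exact: sqdist_ge0.
Qed.

Lemma pkernel_le4 z t : odisc a (r / 2) z -> pkernel a r z t <= 4.
Proof.
move=> az; have az' : odisc a r z.
  apply: lt_trans az _; rewrite ltr_pXn2r ?nnegrE ?divr_ge0 ?(ltW r0)//.
  by rewrite gtr_pMr// invf_lt1// ltr1n.
rewrite pkernelE// ler_pdivrMr; last by rewrite lt_neqAle eq_sym cden_gt0// sqdist_ge0.
have h : 0 <= r / 2 <= r by have := r0; move=> ?; apply/andP; split; lra.
have := cden_lower r0 t h (ltW az); have := sqdist_ge0 a z.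
rewrite (_ : (r - r / 2) ^+ 2 = r ^+ 2 / 4); last by field.
lra.
Qed.

(** The function is C^2 near [z], but the Laplace equation is imposed at [z] alone; harmonicity on a
    set is obtained by quantifying over its points. *)
Definition harmonic_at (h : plane -> R) (z : plane) : Prop :=
  exists g k, has_partials2 h z g k /\ k 0 0 z + k 1 1 z = 0.

Section Dirichlet.
Variable u : plane -> R.
Hypothesis uc : forall z, sqdist a z = r ^+ 2 -> {for z, continuous u}.

Lemma circle_data : continuous (fun t => u (cpt a r t)) /\ exists G, forall t, `|u (cpt a r t)| <= G.
Proof.
split.
  move=> t; apply: (@cvg_comp _ _ _ (cpt a r) u _ (nbhs (cpt a r t))); first exact: cpt_continuous.
  exact: uc (sqdist_cpt a r t).
pose S := [set z | sqdist a z = r ^+ 2].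
have cS : compact S.
  apply: (subclosed_compact _ (@cdisc_compact _ a r)); last first.
    by move=> z h; rewrite /cdisc /= h.
  apply: (@closed_comp _ _ (sqdist a) [set t | t = r ^+ 2]); last exact: closed_eq.
  by move=> x _; exact: sqdist_continuous.
have cu : {within S, continuous (fun z => `|u z|)}.
  apply: continuous_in_subspaceT => z; rewrite inE => /uc c.
  exact: (@continuous_comp _ _ _ u normr z c (@norm_continuous _ _ _)).
have [|c _ H] := compact_EVT_max _ cS cu.
  by exists (cpt a r 0); exact: sqdist_cpt.
by exists `|u c| => t; apply: H; rewrite inE; exact: sqdist_cpt.
Qed.

Definition poisson (z : plane) : R := poisson_int a r (fun t => u (cpt a r t)) z.

Lemma poissonE z : odisc a r z -> poisson z = cavg (fun t => u (cpt a r t) * pkernel a r z t).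
Proof. by move=> az; have [c [G HG]] := circle_data; rewrite /poisson (poisson_intE r0 c). Qed.

Lemma poisson_harmonic z : odisc a r z -> harmonic_at poisson z.
Proof.
move=> az; have [c [G HG]] := circle_data.
have H := has_partials2_poisson r0 c HG az.
eexists; eexists; split; first exact: H.
by rewrite /=; ring.
Qed.

Lemma weighted_continuous z : odisc a r z -> continuous (fun t => u (cpt a r t) * pkernel a r z t).
Proof.
move=> az t; apply: cvgM; first by have [c _] := circle_data; exact: c.
exact: (pkernel_continuous r0 az).
Qed.

Lemma poisson_center : poisson a = cavg (fun t => u (cpt a r t)).
Proof.
rewrite poissonE; last exact: odisc_center.
by apply: eq_cavg => t; rewrite pkernel_center mulr1.
Qed.

(** Keeping [u] off the open disc makes this both the solution of the Dirichlet problem and the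
    Poisson modification of Perron's method. *)
Definition dirichlet (z : plane) : R := if sqdist a z < r ^+ 2 then poisson z else u z.

(* Since |zeta - b|^2 <= 2 |zeta - z|^2 + 2 |z - b|^2 and the kernel times
   |zeta - z|^2 is the constant r^2 - |z - a|^2, the average of |zeta - b|^2
   tends to zero as z tends to b. *)
Lemma poisson_boundary (b : plane) (e : R) : sqdist a b = r ^+ 2 -> 0 < e ->
  \forall z \near b, odisc a r z -> `|poisson z - u b| <= e.
Proof.
move=> ab e0.
have [cg [G HG]] := circle_data.
have Nb : \forall z \near b, `|u z - u b| <= e / 2.
  by move: (uc ab) => /cvgr_distC_le; apply; rewrite divr_gt0.
have [d d0 Hd] := nbhs_odisc Nb.
(* [M] bounds the oscillation of the data. Where |zeta - b| exceeds [d] it is at most C |zeta -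
   b|^2, and where it does not the oscillation is at most e / 2; hence one bound valid on the whole
   circle. *)
pose M := G + `|u b|; pose C := M / d ^+ 2.
have d20 : 0 < d ^+ 2 by rewrite exprn_gt0.
have G0 : 0 <= G by apply: le_trans (HG 0); exact: normr_ge0.
have M0 : 0 <= M by rewrite addr_ge0.
have C0 : 0 <= C by rewrite divr_ge0// ltW.
have Hu t : `|u (cpt a r t) - u b| <= e / 2 + C * sqdist b (cpt a r t).
  have [h|h] := leP (sqdist b (cpt a r t)) (d ^+ 2).
    apply: (le_trans (Hd _ h)); rewrite lerDl mulr_ge0// sqdist_ge0//.
  apply: (le_trans (ler_normB _ _)); apply: (@le_trans _ _ M); first by rewrite lerD2r.
  have : M <= C * sqdist b (cpt a r t).
    by rewrite /C mulrAC -mulrA ler_peMr// ler_pdivlMr// mul1r ltW.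
  by move=> /le_trans; apply; rewrite lerDr divr_ge0// ltW.
pose F z := 2 * C * (r ^+ 2 - sqdist a z + sqdist b z).
have Fc : F z @[z --> b] --> F b.
  exact: (cvgM (cvg_cst (2 * C)) (cvgD (cvgB (cvg_cst (r ^+ 2))
    (@sqdist_continuous _ a b)) (@sqdist_continuous _ b b))).
have Fb : F b = 0 by rewrite /F ab sqdistxx; ring.
have NF : \forall z \near b, F z <= e / 2.
  by move: Fc; rewrite Fb => /cvgr_le; apply; rewrite divr_gt0.
apply: filterS NF => z Fz az.
have pc := pkernel_continuous r0 az.
have sc : continuous (fun t => sqdist b (cpt a r t)).
  move=> t; apply: (@cvg_comp _ _ _ (cpt a r) (sqdist b) _ (nbhs (cpt a r t))).
    exact: cpt_continuous.
  exact: sqdist_continuous.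
have E : poisson z - u b = cavg (fun t => (u (cpt a r t) - u b) * pkernel a r z t).
  transitivity (cavg (fun t => u (cpt a r t) * pkernel a r z t) - cavg (fun t => u b * pkernel a r z t)).
    by rewrite poissonE// cavgZ// cavg_pkernel// mulr1.
  rewrite -cavgB//; first by apply: eq_cavg => t; ring.
    exact: weighted_continuous.
  by move=> t; apply: cvgMl_tmp; exact: pc.
pose W t := (e / 2 + 2 * C * sqdist b z) * pkernel a r z t + 2 * C * (r ^+ 2 - sqdist a z).
have HW t : `|(u (cpt a r t) - u b) * pkernel a r z t| <= W t.
  rewrite normrM (ger0_norm (pkernel_ge0 t az)).
  apply: (@le_trans _ _ ((e / 2 + C * sqdist b (cpt a r t)) * pkernel a r z t)).
    by apply: ler_wpM2r => //; exact: pkernel_ge0.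
  apply: (@le_trans _ _ ((e / 2 + C * (2 * sqdist b z + 2 * sqdist z (cpt a r t))) * pkernel a r z t)).
    apply: ler_wpM2r; first exact: pkernel_ge0.
    by rewrite lerD2l; apply: ler_wpM2l => //; exact: sqdist_triangle.
  rewrite le_eqVlt; apply/orP; left; apply/eqP; rewrite /W pkernelE// -/(cden a r z t).
  by field; exact: cden_gt0.
have cW : continuous W.
  by move=> t; apply: cvgD; [apply: cvgMl_tmp; exact: pc|exact: cvg_cst].
have cD : continuous (fun t => (u (cpt a r t) - u b) * pkernel a r z t).
  by move=> t; apply: cvgM; [apply: cvgB; [exact: cg|exact: cvg_cst]|exact: pc].
have EW : cavg W = e / 2 + F z.
  rewrite /W cavgD; first 1 last.
  - by move=> t; apply: cvgMl_tmp; exact: pc.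
  - by move=> t; exact: cvg_cst.
  by rewrite cavgZ// cavg_pkernel// cavg_cst /F; ring.
have h1 : cavg (fun t => (u (cpt a r t) - u b) * pkernel a r z t) <= cavg W.
  by apply: cavg_le => // t; apply: le_trans (HW t); exact: ler_norm.
have h2 : - cavg W <= cavg (fun t => (u (cpt a r t) - u b) * pkernel a r z t).
  rewrite -mulN1r -cavgZ//; apply: cavg_le => //.
    by move=> t; apply: cvgMl_tmp; exact: cW.
  by move=> t; rewrite mulN1r lerNl; apply: le_trans (HW t); rewrite -normrN; exact: ler_norm.
by rewrite E ler_norml; apply/andP; split; lra.
Qed.

Lemma dirichlet_in z : odisc a r z -> dirichlet z = poisson z.
Proof. by rewrite /dirichlet /odisc /= => ->. Qed.

Lemma dirichlet_near z : odisc a r z -> {near z, poisson =1 dirichlet}.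
Proof. by move=> /odisc_nbhs; apply: filterS => y /dirichlet_in ->. Qed.

Lemma dirichlet_out z : r ^+ 2 <= sqdist a z -> dirichlet z = u z.
Proof. by rewrite /dirichlet leNgt => /negbTE ->. Qed.

Lemma harmonic_at_eq (f h : plane -> R) z : {near z, f =1 h} -> harmonic_at f z -> harmonic_at h z.
Proof. by move=> E [g [k [H L]]]; exists g, k; split => //; exact: has_partials2_eq H. Qed.

Lemma dirichlet_harmonic z : odisc a r z -> harmonic_at dirichlet z.
Proof. by move=> az; apply: harmonic_at_eq (dirichlet_near az) _; exact: poisson_harmonic. Qed.

Lemma harmonic_at_continuous (h : plane -> R) z : harmonic_at h z -> {for z, continuous h}.
Proof. by move=> [g [k [[H _] _]]]; exact: has_partials_continuous H. Qed.

Lemma dirichlet_continuous z : cdisc a r z -> {for z, continuous dirichlet}.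
Proof.
rewrite /cdisc /= le_eqVlt => /orP[/eqP az|az]; last first.
  exact/harmonic_at_continuous/dirichlet_harmonic.
apply/(@cvgrPdist_le _ _ _ (nbhs z)) => e e0.
have Nu : \forall y \near z, `|u y - u z| <= e.
  by move: (uc az) => /cvgr_distC_le; apply.
apply: filterS2 Nu (poisson_boundary az e0) => y h1 h2.
rewrite distrC (dirichlet_out (z := z)) ?az// /dirichlet.
by case: ifP => [/h2|_].
Qed.

End Dirichlet.
End PoissonFormula.

(** * Harmonic functions on discs *)

Section HarmonicFunctions.
Variable R : realType.
Local Notation plane := 'rV[R]_2.

Lemma harmonic_at_cst (c : R) (z : plane) : harmonic_at (fun _ => c) z.
Proof. by eexists; eexists; split; [exact: has_partials2_cst|rewrite /= addr0]. Qed.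

Lemma harmonic_atD (f h : plane -> R) z : harmonic_at f z -> harmonic_at h z ->
  harmonic_at (fun y => f y + h y) z.
Proof.
move=> [g [k [H L]]] [g' [k' [H' L']]].
by eexists; eexists; split; [exact: has_partials2D H H'|rewrite /=; lra].
Qed.

Lemma harmonic_atZ (c : R) (h : plane -> R) z : harmonic_at h z -> harmonic_at (fun y => c * h y) z.
Proof.
move=> [g [k [H L]]]; eexists; eexists; split; first exact: has_partials2Z H.
by rewrite /= -mulrDr L mulr0.
Qed.

Lemma harmonic_atN (h : plane -> R) z : harmonic_at h z -> harmonic_at (fun y => - h y) z.
Proof.
move=> /(harmonic_atZ (-1)); apply: harmonic_at_eq; apply: near_eq_all => y.
by rewrite mulN1r.
Qed.

Lemma harmonic_atB (f h : plane -> R) z : harmonic_at f z -> harmonic_at h z ->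
  harmonic_at (fun y => f y - h y) z.
Proof. by move=> H H'; apply: harmonic_atD => //; exact: harmonic_atN. Qed.

Lemma harmonic_vsub (h : plane -> R) z : harmonic_at h z -> vsub h z.
Proof. by move=> [g [k [H L]]]; apply: vsub_C2 H _; rewrite L. Qed.

Lemma vsub_subr (u h : plane -> R) z : vsub u z -> harmonic_at h z -> vsub (fun y => u y - h y) z.
Proof. by move=> Hu /harmonic_atN[g [k [H L]]]; apply: vsubD H _ Hu; rewrite L. Qed.

Lemma harmonic_compare (a : plane) r (u h : plane -> R) :
  (forall z, cdisc a r z -> {for z, continuous u} /\ {for z, continuous h}) ->
  (forall z, odisc a r z -> vsub u z /\ harmonic_at h z) ->
  (forall z, sqdist a z = r ^+ 2 -> u z <= h z) ->
  forall z, cdisc a r z -> u z <= h z.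
Proof.
move=> C H B z az; rewrite -subr_le0.
apply: (@max_principle _ (cdisc a r) (fun z => u z - h z)) => //.
- exact: cdisc_compact.
- apply: continuous_in_subspaceT => y; rewrite inE => /C[c1 c2].
  exact: (cvgB c1 c2).
- move=> y; rewrite {1}/cdisc /= le_eqVlt => /orP[/eqP /B h1|h1].
    by left; rewrite subr_le0.
  right; split; first by apply: filterS (odisc_nbhs h1) => ?; exact: odisc_cdisc.
  by have [h2 h3] := H _ h1; exact: vsub_subr.
Qed.

Lemma circle_cdisc (a : plane) r z : sqdist a z = r ^+ 2 -> cdisc a r z.
Proof. by rewrite /cdisc /= => ->. Qed.

Lemma harmonic_dirichlet (a : plane) r (h : plane -> R) : 0 < r ->
  (forall z, cdisc a r z -> {for z, continuous h}) ->
  (forall z, odisc a r z -> harmonic_at h z) ->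
  forall z, cdisc a r z -> h z = dirichlet a r h z.
Proof.
move=> r0 C H z az; have C' y := C y \o @circle_cdisc a r y.
apply/eqP; rewrite eq_le; apply/andP; split.
  apply: (@harmonic_compare a r) => // y ay.
  - by split; [exact: C|exact: dirichlet_continuous].
  - by split; [exact/harmonic_vsub/H|exact: dirichlet_harmonic].
  - by rewrite dirichlet_out// ay.
apply: (@harmonic_compare a r) => // y ay.
- by split; [exact: dirichlet_continuous|exact: C].
- by split; [exact/harmonic_vsub/dirichlet_harmonic|exact: H].
- by rewrite dirichlet_out// ay.
Qed.

Lemma harmonic_mean (a : plane) r (h : plane -> R) : 0 < r ->
  (forall z, cdisc a r z -> {for z, continuous h}) ->
  (forall z, odisc a r z -> harmonic_at h z) ->
  h a = cavg (fun t => h (cpt a r t)).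
Proof.
move=> r0 C H; have C' y := C y \o @circle_cdisc a r y; have c := odisc_center a r0.
by rewrite (harmonic_dirichlet r0 C H (odisc_cdisc c)) dirichlet_in// poisson_center.
Qed.

(** On the concentric disc of half the radius the Poisson kernel is at most 4, and the average of
    the boundary values is [h a]. *)
Lemma harnack (a : plane) r (h : plane -> R) : 0 < r ->
  (forall z, cdisc a r z -> {for z, continuous h}) ->
  (forall z, odisc a r z -> harmonic_at h z) ->
  (forall z, sqdist a z = r ^+ 2 -> 0 <= h z) ->
  forall z, odisc a (r / 2) z -> h z <= 4 * h a.
Proof.
move=> r0 C H P z az; have az' : odisc a r z.
  apply: lt_trans az _; rewrite ltr_pXn2r ?nnegrE ?divr_ge0 ?(ltW r0)//.
  by rewrite gtr_pMr// invf_lt1// ltr1n.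
have C' y := C y \o @circle_cdisc a r y; have [cg _] := circle_data C'.
rewrite (harmonic_dirichlet r0 C H (odisc_cdisc az')) dirichlet_in// poissonE//.
rewrite (harmonic_mean r0 C H) -cavgZ//.
apply: cavg_le => [||t].
- exact: weighted_continuous.
- by move=> t; apply: cvgMl_tmp; exact: cg.
- rewrite mulrC; apply: ler_wpM2r; first by apply: P; rewrite sqdist_cpt.
  exact: pkernel_le4.
Qed.

Lemma odisc_le (a z : plane) (r s : R) : 0 <= r -> r <= s -> odisc a r z -> odisc a s z.
Proof.
move=> r0 rs az; apply: lt_le_trans az _.
by rewrite ler_pXn2r ?nnegrE// (le_trans r0).
Qed.

Lemma cdisc_odisc (a z : plane) (r s : R) : 0 <= r -> r < s -> cdisc a r z -> odisc a s z.
Proof.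
move=> r0 rs az; apply: le_lt_trans az _.
by rewrite ltr_pXn2r ?nnegrE// ltW// (le_lt_trans r0).
Qed.

(** On a smaller disc [u] is squeezed onto its own Dirichlet solution: an approximant within [e] of
    [u] is, by comparison on the circle, within [e] of that solution as well. *)
Lemma harmonic_uniform_limit (a : plane) r (u : plane -> R) : 0 < r ->
  (forall e, 0 < e -> exists h : plane -> R, forall z, odisc a r z ->
     harmonic_at h z /\ `|u z - h z| <= e) ->
  forall z, odisc a r z -> harmonic_at u z.
Proof.
move=> r0 H z /(odisc_shrink r0)[s [s0 sr az]].
have uc y : odisc a r y -> {for y, continuous u}.
  move=> ay; apply/(@cvgrPdist_le _ _ _ (nbhs y)) => e e0.
  have e3 : 0 < e / 3 by rewrite divr_gt0.
  have [h Hh] := H _ e3; have [hy hy'] := Hh y ay.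
  have := harmonic_at_continuous hy => /cvgr_distC_le /(_ _ e3) Nh.
  apply: filterS2 Nh (odisc_nbhs ay) => x h1 /Hh[_ h2].
  rewrite (_ : u y - u x = (u y - h y) - (h x - h y) - (u x - h x)); last by ring.
  apply: (le_trans (ler_normB _ _)); have := ler_normB (u y - h y) (h x - h y); lra.
have sC y : cdisc a s y -> odisc a r y by apply: cdisc_odisc => //; exact: ltW.
have uC y : cdisc a s y -> {for y, continuous u} by move=> /sC/uc.
have uC' y : sqdist a y = s ^+ 2 -> {for y, continuous u} by move=> /circle_cdisc/uC.
pose v := dirichlet a s u.
have E y : odisc a s y -> u y = v y.
  move=> ay; apply/eqP; rewrite -subr_eq0 -normr_le0; apply/ler_addgt0Pr => e e0.
  have e2 : 0 < e / 2 by rewrite divr_gt0.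
  have [h Hh] := H _ e2; rewrite add0r.
  have h1 : h y - v y <= e / 2.
    rewrite lerBlDl; apply: (@harmonic_compare a s h (fun x => v x + e / 2)) => [x ax|x ax|x ax|].
    - split; first by have [/harmonic_at_continuous] := Hh x (sC x ax).
      exact: (cvgD (dirichlet_continuous s0 uC' ax) (cvg_cst _)).
    - have [hx _] := Hh x (sC x (odisc_cdisc ax)); split; first exact: harmonic_vsub.
      by apply: harmonic_atD; [exact: dirichlet_harmonic|exact: harmonic_at_cst].
    - rewrite /v dirichlet_out ?ax//; have [|_] := Hh x (sC x _); first by rewrite /cdisc /= ax.
      by rewrite ler_norml => /andP[]; lra.
    - exact: odisc_cdisc.
  have h2 : v y - h y <= e / 2.
    rewrite lerBlDl; apply: (@harmonic_compare a s v (fun x => h x + e / 2)) => [x ax|x ax|x ax|].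
    - split; first exact: (dirichlet_continuous s0 uC' ax).
      have [/harmonic_at_continuous c _] := Hh x (sC x ax).
      exact: (cvgD c (cvg_cst _)).
    - have [hx _] := Hh x (sC x (odisc_cdisc ax)).
      split; first by apply: harmonic_vsub; exact: dirichlet_harmonic.
      by apply: harmonic_atD => //; exact: harmonic_at_cst.
    - rewrite /v dirichlet_out ?ax//; have [|_] := Hh x (sC x _); first by rewrite /cdisc /= ax.
      by rewrite ler_norml => /andP[]; lra.
    - exact: odisc_cdisc.
  have [_] := Hh y (sC y (odisc_cdisc ay)); rewrite !ler_norml => /andP[k1 k2].
  by apply/andP; split; lra.
apply: (@harmonic_at_eq _ v); last exact: dirichlet_harmonic.
by apply: filterS (odisc_nbhs az) => y /E ->.
Qed.

Lemma harmonic_ln (a z : plane) : z != a -> harmonic_at (fun y => ln (sqdist a y)) z.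
Proof.
move=> za; have d0 := sqdist_gt0 za.
have N : \forall s \near sqdist a z, is_derive (s : R) (1 : R) (@ln R) s^-1 /\
    is_derive (s : R) (1 : R) (fun s => s^-1) (- (s^-1 * s^-1)) /\
    {for s, continuous (fun s : R => - (s^-1 * s^-1))}.
  have : \forall s \near sqdist a z, 0 < s.
    by apply: open_nbhs_nbhs; split => //; exact: open_gt.
  apply: filterS => s s0; have sn0 : s != 0 by rewrite gt_eqF.
  split; first exact: is_derive1_ln.
  split; last by apply: cvgN; apply: cvgM; apply: cvgV.
  apply: is_derive_eq (is_deriveV (f := id) sn0 (is_derive_id s (1 : R))) _.
  by rewrite /= [LHS]mulr1 expr2 invfM.
have H := has_partials2_comp1 N (has_partials2_sqdist a z).
eexists; eexists; split; first exact: H.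
by rewrite /= sqdistE in d0 *; field; rewrite gt_eqF.
Qed.

(* Comparison with small multiples of the logarithm. *)
Lemma removable_bound (u : plane -> R) (s G : R) : 0 < s ->
  (forall z, cdisc 0 s z -> z != 0 ->
     [/\ {for z, continuous u}, u z <= G & sqdist 0 z = s ^+ 2 -> u z <= 0]) ->
  (forall z, odisc 0 s z -> z != 0 -> vsub u z) ->
  forall z, odisc 0 s z -> z != 0 -> u z <= 0.
Proof.
move=> s0 C H z1 az1 z10; apply/ler_addgt0Pr => e e0; rewrite add0r.
have s20 : 0 < s ^+ 2 by rewrite exprn_gt0.
have d1 := sqdist_gt0 z10.
(* With k = e / L the logarithmic term equals -e at [z1]. Where |z|^2 is at most [q], that term is
   at most -G and outweighs the upper bound on [u], so the maximum principle needs no information at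
   the puncture. *)
pose L := ln (s ^+ 2) - ln (sqdist 0 z1).
have L0 : 0 < L by rewrite subr_gt0 ltr_ln ?posrE.
pose k := e / L; have k0 : 0 < k by rewrite divr_gt0.
pose q := minr (sqdist 0 z1) (expR (ln (s ^+ 2) - G / k)).
have q0 : 0 < q by rewrite lt_min d1 expR_gt0.
pose w z := u z + k * (ln (sqdist 0 z) - ln (s ^+ 2)).
pose A := [set z | q <= sqdist 0 z] `&` cdisc 0 s.
have An0 z : A z -> z != 0.
  by move=> [h _]; apply/eqP => e1; move: h; rewrite e1 /= sqdistxx leNgt q0.
have Hl z : z != 0 -> harmonic_at (fun z => k * (ln (sqdist 0 z) - ln (s ^+ 2))) z.
  by move=> zn; apply: harmonic_atZ; apply: harmonic_atB; [exact: harmonic_ln|exact: harmonic_at_cst].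
have cA : compact A.
  rewrite /A setIC; apply: compact_closedI; first exact: cdisc_compact.
  apply: (@closed_comp _ _ (sqdist 0) [set t | q <= t]); last exact: closed_ge.
  by move=> x _; exact: sqdist_continuous.
have Az1 : A z1 by split; [rewrite /= ge_min lexx|exact: odisc_cdisc].
have : w z1 <= 0.
  apply: (max_principle cA _ _ Az1).
    apply: continuous_in_subspaceT => z; rewrite inE => Az; have zn := An0 z Az.
    have [c _ _] := C z Az.2 zn.
    exact: (cvgD c (harmonic_at_continuous (Hl z zn))).
  move=> z Az; have zn := An0 z Az; have [c uG uB] := C z Az.2 zn; have dz := sqdist_gt0 zn.
  have lnz : ln (sqdist 0 z) <= ln (s ^+ 2) by rewrite ler_ln ?posrE//; exact: Az.2.
  have [e1|n1] := eqVneq (sqdist 0 z) (s ^+ 2).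
    by left; rewrite /w e1 subrr mulr0 addr0; exact: uB.
  have zo : odisc 0 s z by rewrite /odisc /= lt_neqAle n1; exact: Az.2.
  have [h|h] := leP (sqdist 0 z) q.
    left; have : ln (sqdist 0 z) <= ln (s ^+ 2) - G / k.
      by rewrite -[leRHS]expRK ler_ln ?posrE ?expR_gt0// (le_trans h)// ge_min lexx orbT.
    move=> h1; have h2 : k * (ln (sqdist 0 z) - ln (s ^+ 2)) <= k * (- (G / k)).
      by rewrite ler_pM2l//; lra.
    have h3 : k * - (G / k) = - G by field; rewrite gt_eqF.
    by rewrite /w; lra.
  right; split; last first.
    have := vsub_subr (H z zo zn) (harmonic_atN (Hl z zn)).
    by apply: vsub_eq; apply: near_eq_all => y; rewrite opprK.
  have N : \forall y \near z, q < sqdist 0 y.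
    by have := @sqdist_continuous _ 0 z; move=> /cvgr_gt; apply.
  apply: filterS2 N (odisc_nbhs zo) => y qy yo; split; first exact: ltW.
  exact: odisc_cdisc.
rewrite /w (_ : k * _ = - e); first by lra.
by rewrite -opprB -/L mulrN /k divfK// gt_eqF.
Qed.

(** The extension is the Dirichlet solution on the disc of radius 1/2. Its differences with [u], of
    either sign, are bounded near the puncture and vanish on the circle. *)
Lemma removable_point (u : plane -> R) (B : R) :
  (forall z, odisc 0 1 z -> z != 0 -> harmonic_at u z /\ `|u z| <= B) ->
  exists v, (forall z, odisc 0 1 z -> harmonic_at v z) /\
    (forall z, odisc 0 1 z -> z != 0 -> v z = u z).
Proof.
move=> H; pose s : R := 1 / 2; have s0 : 0 < s by rewrite divr_gt0.
have s1 : s < 1 by rewrite /s; lra.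
have sub z : cdisc 0 s z -> odisc 0 1 z by apply: cdisc_odisc => //; exact: ltW.
have cn0 z : sqdist 0 z = s ^+ 2 -> z != 0.
  by move=> h; apply/eqP => e; move: h; rewrite e sqdistxx; apply/eqP; rewrite eq_sym gt_eqF// exprn_gt0.
have uc z : sqdist 0 z = s ^+ 2 -> {for z, continuous u}.
  move=> h; have [hz _] := H z (sub z (circle_cdisc h)) (cn0 z h).
  exact: harmonic_at_continuous hz.
pose v := dirichlet 0 s u.
have vc z : cdisc 0 s z -> {for z, continuous v} by exact: dirichlet_continuous.
have cv : {within cdisc 0 s, continuous (fun z => `|v z|)}.
  apply: continuous_in_subspaceT => z; rewrite inE => /vc c.
  exact: (@continuous_comp _ _ _ v normr z c (@norm_continuous _ _ _)).
have [|c _ Hc] := compact_EVT_max _ (@cdisc_compact _ 0 s) cv.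
  by exists 0; apply: odisc_cdisc; exact: odisc_center.
have vG z : cdisc 0 s z -> `|v z| <= `|v c| by move=> h; apply: Hc; rewrite inE.
have E z : odisc 0 s z -> z != 0 -> v z = u z.
  move=> az zn; apply/eqP; rewrite eq_le; apply/andP; split; rewrite -subr_le0.
    apply: (@removable_bound (fun z => v z - u z) s (`|v c| + B)) az zn => // y ay yn.
      have [hy uB] := H y (sub y ay) yn; split.
      - exact: (cvgB (vc y ay) (harmonic_at_continuous hy)).
      - move: uB (vG y ay); rewrite !ler_norml => /andP[h1 h2] /andP[h3 h4]; lra.
      - by move=> h; rewrite /v dirichlet_out ?h// subrr.
    have [hy _] := H y (sub y (odisc_cdisc ay)) yn.
    by apply: vsub_subr => //; apply: harmonic_vsub; exact: dirichlet_harmonic.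
  apply: (@removable_bound (fun z => u z - v z) s (`|v c| + B)) az zn => // y ay yn.
    have [hy uB] := H y (sub y ay) yn; split.
    - exact: (cvgB (harmonic_at_continuous hy) (vc y ay)).
    - move: uB (vG y ay); rewrite !ler_norml => /andP[h1 h2] /andP[h3 h4]; lra.
    - by move=> h; rewrite /v dirichlet_out ?h// subrr.
  have [hy _] := H y (sub y (odisc_cdisc ay)) yn.
  by apply: vsub_subr; [exact: harmonic_vsub|exact: dirichlet_harmonic].
have E' z : z != 0 -> v z = u z.
  have [az|az] := ltP (sqdist 0 z) (s ^+ 2); first exact: E.
  by move=> _; rewrite /v dirichlet_out.
exists v; split => [z az|z _]; last exact: E'.
have [hz|hz] := ltP (sqdist 0 z) (s ^+ 2); first exact: dirichlet_harmonic.
have zn : z != 0.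
  by apply/eqP => e; move: hz; rewrite e sqdistxx leNgt exprn_gt0.
apply: (@harmonic_at_eq _ u); last by have [] := H z az zn.
have : \forall y \near z, 0 < sqdist 0 y.
  by have := @sqdist_continuous _ 0 z; move=> /cvgr_gt; apply; exact: sqdist_gt0.
apply: filterS => y y0; rewrite E'//; apply/eqP => e; move: y0.
by rewrite e sqdistxx ltxx.
Qed.

End HarmonicFunctions.

(** * Conformal changes of coordinates *)

Section ConformalRegularity.
Variable R : realType.
Local Notation plane := 'rV[R]_2.

Lemma is_derive_row (n : nat) (f : R -> 'rV[R]_n) (t : R) (d : 'rV[R]_n) :
  (forall k, is_derive t (1 : R) (fun s => f s 0 k) (d 0 k)) -> is_derive t (1 : R) f d.
Proof.
move=> H; have df : derivable f t 1 by apply/derivable_mxP => i k; rewrite ord1; case: (H k).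
split => //; rewrite derive_mx//; apply/rowP => k; rewrite !mxE.
by case: (H k).
Qed.

Lemma is_derive_curve m (f : 'rV[R]_m -> R) (c : R -> 'rV[R]_m) (t : R) (d : 'rV[R]_m) g :
  is_derive t (1 : R) c d -> has_partials f (c t) g ->
  is_derive t (1 : R) (fun s => f (c s)) (\sum_i d 0 i * g i (c t)).
Proof.
move=> [dc ec] /has_partials_diff[df ef].
by apply: is_derive_eq (is_derive_comp_diff df dc) _; rewrite ec ef.
Qed.

Lemma sum2 (F : 'I_2 -> R) : \sum_i F i = F 0 + F 1.
Proof. by rewrite big_ord_recl big_ord1; congr (_ + F _); exact: val_inj. Qed.

Lemma cavg_cos_sin : cavg (@cos R) = 0 /\ cavg (@sin R) = 0.
Proof.
split.
  apply: (@cavg_derive _ sin); first exact: continuous_cos.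
  by rewrite [LHS]sin2pi [RHS]sin0.
apply: (@cavg_derive _ (- cos)); first exact: continuous_sin.
  by move=> t; apply: is_derive_eq (is_deriveN (is_derive_cos t)) _; rewrite opprK.
by rewrite !fctE /= cos2pi cos0.
Qed.

Section CauchyRiemann.
Variables (U : set plane) (a b : plane -> R) (da db : 'I_2 -> plane -> R).
Hypothesis oU : open U.
Hypothesis Ha : forall z, U z -> has_partials a z da.
Hypothesis Hb : forall z, U z -> has_partials b z db.
Hypothesis CR : forall z, U z -> da 0 z = db 1 z /\ da 1 z = - db 0 z.

Lemma cpt_line (p : plane) (s t : R) : cpt p s t = s *: cpt 0 1 t + p.
Proof. by apply/rowP => i; rewrite !mxE add0r mul1r addrC. Qed.

(** The radial derivative of the average of [a] over a circle is the average of its normal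
    derivative; by the Cauchy-Riemann equations this is a tangential derivative of [b] divided by
    the radius, with zero average. Only first derivatives enter, as required for maps of class
    C^1. *)
Lemma CR_mean_value (p : plane) (r : R) : 0 < r -> cdisc p r `<=` U ->
  a p = cavg (fun t => a (cpt p r t)).
Proof.
move=> r0 sU.
(* A slightly larger disc is needed because the average is differentiated in the radius up to and
   including [r]. It comes from the point of the complement of [U] nearest to [p]. *)
have oK : exists2 e, r < e & cdisc p e `<=` U.
  have [F|F] := pselect (~` U !=set0); last first.
    exists (r + 1); first by rewrite ltrDl.
    by move=> z _; apply: contrapT => nz; apply: F; exists z.
  have [[e re H]|N] := pselect (exists2 e, r < e & cdisc p e `<=` U); first by exists e.
  exfalso.
  pose A := cdisc p (r + 1) `&` ~` U.
  have cA : compact A.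
    by apply: compact_closedI; [exact: cdisc_compact|apply: open_closedC].
  have An : A !=set0.
    apply: contrapT => nA; apply: N; exists (r + 1); first by rewrite ltrDl.
    by move=> z hz; apply: contrapT => nz; apply: nA; exists z.
  have cs : {within A, continuous (sqdist p)}.
    exact: continuous_subspaceT (@sqdist_continuous _ p).
  have [c] := compact_EVT_min An cA cs; rewrite inE => -[c1 c2] Hc.
  have rc : r < Num.sqrt (sqdist p c).
    rewrite -(ltr_pXn2r (n := 2)) ?nnegrE ?sqrtr_ge0 ?(ltW r0)// sqr_sqrtr ?sqdist_ge0//.
    by rewrite ltNge; apply/negP => /sU.
  apply: N; exists (minr (r + 1) ((r + Num.sqrt (sqdist p c)) / 2)).
    by rewrite lt_min ltrDl ltr01 /=; lra.
  set e := minr _ _; have e0 : 0 <= e by rewrite le_min !divr_ge0 ?addr_ge0 ?sqrtr_ge0 ?(ltW r0).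
  move=> z ze; apply: contrapT => nz.
  have zA : A z.
    split => //; apply: le_trans ze _; rewrite ler_pXn2r ?nnegrE ?ge_min ?lexx ?addr_ge0 ?(ltW r0)//.
  have := Hc z; rewrite inE => /(_ zA) h1.
  have : sqdist p z < sqdist p c.
    apply: le_lt_trans ze _; rewrite -[ltRHS]sqr_sqrtr ?sqdist_ge0//.
    rewrite ltr_pXn2r ?nnegrE ?sqrtr_ge0//.
    apply: (@le_lt_trans _ _ ((r + Num.sqrt (sqdist p c)) / 2)); last by lra.
    by rewrite /e ge_min lexx orbT.
  by rewrite ltNge h1.
have [e re eU] := oK; have e0 : 0 < e := lt_trans r0 re.
have Us (s t : R) : - e < s < e -> U (cpt p s t).
  move=> se; apply: eU; rewrite /cdisc /= sqdist_cpt -sqr_normr ler_pXn2r ?nnegrE ?(ltW e0)//.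
  by rewrite ltW// ltr_norml.
have cda i z : U z -> {for z, continuous (da i)}.
  by move=> /Ha/nbhs_singleton/(_ i)[].
have ca z : U z -> {for z, continuous a} by move=> /Ha; exact: has_partials_continuous.
have [C HC] : exists C, forall z, cdisc p e z -> `|da 0 z| <= C /\ `|da 1 z| <= C.
  have bd i : exists C, forall z, cdisc p e z -> `|da i z| <= C.
    have c : {within cdisc p e, continuous (fun z => `|da i z|)}.
      apply: continuous_in_subspaceT => z; rewrite inE => /eU/(cda i) c.
      exact: (@continuous_comp _ _ _ (da i) normr z c (@norm_continuous _ _ _)).
    have [|m _ Hm] := compact_EVT_max _ (@cdisc_compact _ p e) c.
      by exists p; apply: odisc_cdisc; exact: odisc_center.
    by exists `|da i m| => z hz; apply: Hm; rewrite inE.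
  have [C0 H0] := bd 0; have [C1 H1] := bd 1; exists (maxr C0 C1) => z hz.
  by rewrite !le_max H0 ?H1 ?orbT.
pose k s t := a (cpt p s t).
pose k' s t := cos t * da 0 (cpt p s t) + sin t * da 1 (cpt p s t).
have curve_cont (f : plane -> R) s : - e < s < e -> (forall z, U z -> {for z, continuous f}) ->
    continuous (fun t => f (cpt p s t)).
  move=> se fc t; apply: (@cvg_comp _ _ _ (cpt p s) f _ (nbhs (cpt p s t))).
    exact: cpt_continuous.
  exact: fc (Us s t se).
have Dk s : - e < s < e -> is_derive s (1 : R) (fun s => cavg (k s)) (cavg (k' s)).
  move=> se; apply: (@cavg_diff _ k k' s (- e) e (C + C) se).
    by move=> u ue; exact: curve_cont.
  move=> u t ue; split.
    have H := has_partials_derive (cpt 0 1 t) (Ha (Us u t ue)).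
    rewrite cpt_line in H.
    have -> : k^~ t = (fun s => a (s *: cpt 0 1 t + p)) by apply/funext => s1; rewrite /k cpt_line.
    apply: is_derive_eq (is_derive_line H) _.
    by rewrite sum2 cpt0 cpt1 /k' -cpt_line !mxE; ring.
  have uc : cdisc p e (cpt p u t).
    rewrite /cdisc /= sqdist_cpt -sqr_normr ler_pXn2r ?nnegrE ?(ltW e0)//.
    by rewrite ltW// ltr_norml.
  have [h1 h2] := HC _ uc.
  apply: (le_trans (ler_normD _ _)); apply: lerD; rewrite normrM -[leRHS]mul1r; apply: ler_pM => //.
    by rewrite ler_norml cos_geN1 cos_le1.
  by rewrite ler_norml sin_geN1 sin_le1.
have Z s : - e < s < e -> cavg (k' s) = 0.
  (* At radius 0 the division by the radius fails, but the integrand is a combination of cosine and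
     sine with constant coefficients. *)
  move=> se; have [s0|sn] := eqVneq s 0.
    have cp t : cpt p s t = p by rewrite cpt_line s0 scale0r add0r.
    rewrite /k'; transitivity (cavg (fun t => da 0 p * cos t + da 1 p * sin t)).
      by apply: eq_cavg => t; rewrite cp; ring.
    have [c1 c2] := cavg_cos_sin.
    rewrite cavgD; first last.
    - by move=> t; apply: cvgMl_tmp; exact: continuous_sin.
    - by move=> t; apply: cvgMl_tmp; exact: continuous_cos.
    rewrite cavgZ; last exact: continuous_cos.
    rewrite cavgZ; last exact: continuous_sin.
    by rewrite c1 c2 !mulr0 addr0.
  have k'c : continuous (k' s).
    move=> t; apply: cvgD; apply: cvgM; [exact: continuous_cos| |exact: continuous_sin|].
      by apply: curve_cont => // z; exact: cda.
    by apply: curve_cont => // z; exact: cda.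
  apply: (mulfI sn); rewrite mulr0 -cavgZ//.
  apply: (@cavg_derive _ (fun t => b (cpt p s t))).
  - by move=> t; apply: cvgMl_tmp; exact: k'c.
  - move=> t; have [D0 D1] := is_derive_cpt p s t.
    have D : is_derive t (1 : R) (cpt p s) (\row_i if i == 0 then - (s * sin t) else s * cos t).
      by apply: is_derive_row => i; rewrite mxE; have [->|->] := I2P i.
    apply: is_derive_eq (is_derive_curve D (Hb (Us s t se))) _.
    have [e1 e2] := CR (Us s t se).
    by rewrite sum2 !mxE /= /k' e1 e2; ring.
  - by rewrite cpt_2pi.
have re' : 0 <= r <= r by rewrite lexx ltW.
have L (t : R) : 0 <= t <= r -> is_derive (t *: (1 : R) + 0) (1 : R) (fun s => cavg (k s)) 0.
  move=> /andP[t0 tr]; rewrite addr0 [t *: (1 : R)]mulr1.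
  have te : - e < t < e by rewrite (le_lt_trans tr re) (lt_le_trans _ t0)// oppr_lt0.
  by rewrite -(Z t te); exact: Dk.
have [t _] := ray_mvt (g := fun _ => 0) r0 L.
rewrite addr0 [r *: (1 : R)]mulr1 mulr0 => /eqP; rewrite subr_eq0 => /eqP E.
transitivity (cavg (k 0)); last by rewrite -E.
rewrite -[LHS]cavg_cst; apply: eq_cavg => t'.
by rewrite /k cpt_line scale0r add0r.
Qed.

End CauchyRiemann.

Lemma mean_value_max (p : plane) (r : R) (w : plane -> R) : 0 < r ->
  (forall z, cdisc p r z -> {for z, continuous w}) ->
  (forall z, sqdist p z = r ^+ 2 -> w z <= 0) ->
  (forall z, odisc p r z -> exists s, [/\ 0 < s, cdisc z s `<=` odisc p r &
     w z = cavg (fun t => w (cpt z s t))]) ->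
  forall z, cdisc p r z -> w z <= 0.
Proof.
move=> r0 C B MV z1 az1; rewrite leNgt; apply/negP => w1.
have r20 : 0 < r ^+ 2 by rewrite exprn_gt0.
pose e := w z1 / (2 * r ^+ 2); have e0 : 0 < e by rewrite divr_gt0// mulr_gt0.
have cw : {within cdisc p r, continuous (fun z => w z + e * sqdist p z)}.
  apply: continuous_in_subspaceT => z; rewrite inE => /C c.
  exact: (cvgD c (cvgM (cvg_cst e) (@sqdist_continuous _ p z))).
have [|z2] := compact_EVT_max _ (@cdisc_compact _ p r) cw; first by exists z1.
rewrite inE => az2 H.
have h1 : w z1 + e * sqdist p z1 <= w z2 + e * sqdist p z2 by apply: H; rewrite inE.
have h2 : e * r ^+ 2 < w z1.
  rewrite /e (_ : _ * _ = w z1 / 2); last by field; rewrite gt_eqF.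
  lra.
have h3 : 0 <= e * sqdist p z1 by rewrite mulr_ge0 ?sqdist_ge0// ltW.
have oz2 : odisc p r z2.
  rewrite /odisc /= lt_neqAle; apply/andP; split; last exact: az2.
  by apply/eqP => e2; move: (B z2 e2); rewrite e2 in h1; lra.
have [s [s0 sub E]] := MV z2 oz2.
have cc : continuous (fun t => w (cpt z2 s t)).
  move=> t; apply: (@cvg_comp _ _ _ (cpt z2 s) w _ (nbhs (cpt z2 s t))); first exact: cpt_continuous.
  by apply: C; apply/odisc_cdisc/sub; rewrite /cdisc /= sqdist_cpt.
have [c1 c2] := cavg_cos_sin.
pose q t := sqdist p z2 + s ^+ 2 + 2 * s * ((z2 0 0 - p 0 0) * cos t + (z2 0 1 - p 0 1) * sin t).
have qE t : sqdist p (cpt z2 s t) = q t.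
  have h : s ^+ 2 = s ^+ 2 * (cos t ^+ 2 + sin t ^+ 2) by rewrite cos2Dsin2 mulr1.
  by rewrite /q h !sqdistE cpt0 cpt1; ring.
have cq1 : continuous (fun t => (z2 0 0 - p 0 0) * cos t).
  by move=> t; apply: cvgMl_tmp; exact: continuous_cos.
have cq2 : continuous (fun t => (z2 0 1 - p 0 1) * sin t).
  by move=> t; apply: cvgMl_tmp; exact: continuous_sin.
have cq3 : continuous (fun t => (z2 0 0 - p 0 0) * cos t + (z2 0 1 - p 0 1) * sin t).
  by move=> t; apply: cvgD; [exact: cq1|exact: cq2].
have cq : continuous q.
  by move=> t; apply: cvgD; [exact: cvg_cst|apply: cvgMl_tmp; exact: cq3].
have Aq : cavg q = sqdist p z2 + s ^+ 2.
  rewrite /q cavgD; first last.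
  - by move=> t; apply: cvgMl_tmp; exact: cq3.
  - by move=> t; exact: cvg_cst.
  rewrite cavg_cst cavgZ// cavgD// cavgZ; last exact: continuous_cos.
  by rewrite cavgZ; [rewrite c1 c2; ring|exact: continuous_sin].
have : cavg (fun t => w (cpt z2 s t) + e * q t) <= cavg (fun _ => w z2 + e * sqdist p z2).
  apply: cavg_le => [t|t|t].
  - by apply: cvgD; [exact: cc|apply: cvgMl_tmp; exact: cq].
  - exact: cvg_cst.
  - rewrite -qE; apply: H; rewrite inE; apply/odisc_cdisc/sub.
    by rewrite /cdisc /= sqdist_cpt.
rewrite cavg_cst cavgD//; last by move=> t; apply: cvgMl_tmp; exact: cq.
rewrite cavgZ// Aq -E.
have : 0 < e * s ^+ 2 by rewrite mulr_gt0// exprn_gt0.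
lra.
Qed.

Lemma CR_harmonic (U : set plane) (a b : plane -> R) (da db : 'I_2 -> plane -> R) :
  open U ->
  (forall z, U z -> has_partials a z da) -> (forall z, U z -> has_partials b z db) ->
  (forall z, U z -> da 0 z = db 1 z /\ da 1 z = - db 0 z) ->
  forall z, U z -> harmonic_at a z.
Proof.
move=> oU Ha Hb CR p Up.
have [r r0 sU] : exists2 r, 0 < r & cdisc p r `<=` U.
  by apply: nbhs_odisc; exact: open_nbhs_nbhs.
have ac z : cdisc p r z -> {for z, continuous a} by move=> /sU/Ha; exact: has_partials_continuous.
have ac' z : sqdist p z = r ^+ 2 -> {for z, continuous a} by move=> /circle_cdisc/ac.
pose v := dirichlet p r a.
have vc z : cdisc p r z -> {for z, continuous v} by exact: dirichlet_continuous.
have vh z : odisc p r z -> harmonic_at v z by exact: dirichlet_harmonic.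
have MV z : odisc p r z -> exists s, [/\ 0 < s, cdisc z s `<=` odisc p r,
     a z = cavg (fun t => a (cpt z s t)), v z = cavg (fun t => v (cpt z s t)) &
     continuous (fun t => a (cpt z s t)) /\ continuous (fun t => v (cpt z s t))].
  move=> az; have [s s0 sub] := nbhs_odisc (odisc_nbhs az); exists s.
  have sub' : cdisc z s `<=` cdisc p r by move=> y /sub /odisc_cdisc.
  split => //.
  - by apply: (CR_mean_value oU Ha Hb CR s0) => y /sub' /sU.
  - apply: harmonic_mean => // y hy; first exact/vc/sub'.
    by apply/vh/sub/odisc_cdisc.
  - split=> t.
      apply: (@cvg_comp _ _ _ (cpt z s) a _ (nbhs (cpt z s t))); first exact: cpt_continuous.
      by apply/ac/sub'; rewrite /cdisc /= sqdist_cpt.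
    apply: (@cvg_comp _ _ _ (cpt z s) v _ (nbhs (cpt z s t))); first exact: cpt_continuous.
    by apply/vc/sub'; rewrite /cdisc /= sqdist_cpt.
have E z : cdisc p r z -> a z = v z.
  move=> az; apply/eqP; rewrite eq_le -subr_le0 -[X in _ && X]subr_le0; apply/andP; split.
    apply: (@mean_value_max p r (fun z => a z - v z) r0) => // y hy.
    - exact: (cvgB (ac y hy) (vc y hy)).
    - by rewrite /v dirichlet_out ?hy// subrr.
    - have [s [s0 sub e1 e2 [k1 k2]]] := MV y hy; exists s; split => //.
      by rewrite cavgB// -e1 -e2.
  apply: (@mean_value_max p r (fun z => v z - a z) r0) => // y hy.
  - exact: (cvgB (vc y hy) (ac y hy)).
  - by rewrite /v dirichlet_out ?hy// subrr.
  - have [s [s0 sub e1 e2 [k1 k2]]] := MV y hy; exists s; split => //.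
    by rewrite cavgB// -e1 -e2.
have op := odisc_center p r0.
apply: (@harmonic_at_eq _ v); last exact: vh.
by apply: filterS (odisc_nbhs op) => y /odisc_cdisc/E ->.
Qed.

(** Lagrange's identity gives J^2 = l^2 for the determinant J and the common squared row length l.
    According to the sign of J, J = l or -J = l, which turns a sum of two squares into 0. *)
Lemma conformal_matrix (a b c d : R) : a * a + b * b = c * c + d * d -> a * c + b * d = 0 ->
  (0 <= a * d - b * c -> c = - b /\ d = a) /\ (a * d - b * c <= 0 -> c = b /\ d = - a).
Proof.
move=> h1 h2; pose l := a * a + b * b; pose J := a * d - b * c.
have l0 : 0 <= l by rewrite addr_ge0// -expr2 sqr_ge0.
have JJ : J ^+ 2 = l ^+ 2.
  have -> : J ^+ 2 = l * (c * c + d * d) - (a * c + b * d) ^+ 2 by rewrite /J /l; ring.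
  by rewrite h2 -h1 expr0n subr0 -expr2.
have sq0 (x y : R) : x ^+ 2 + y ^+ 2 = 0 -> x = 0 /\ y = 0.
  by move=> /eqP; rewrite paddr_eq0 ?sqr_ge0// !sqrf_eq0 => /andP[/eqP -> /eqP ->].
split=> J0.
  have JE : J = l by apply/eqP; rewrite -(eqrXn2 (n := 2)) ?JJ.
  have [] := sq0 (c + b) (d - a).
    by rewrite (_ : _ + _ = c * c + d * d + l - 2 * J); [rewrite JE -h1 -/l; ring|rewrite /l /J; ring].
  by move=> /eqP; rewrite addr_eq0 => /eqP ? /eqP; rewrite subr_eq0 => /eqP.
have JE : - J = l by apply/eqP; rewrite -(eqrXn2 (n := 2)) ?sqrrN ?JJ// oppr_ge0.
have [] := sq0 (c - b) (d + a).
  by rewrite (_ : _ + _ = c * c + d * d + l - 2 * - J); [rewrite JE -h1 -/l; ring|rewrite /l /J; ring].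
by move=> /eqP; rewrite subr_eq0 => /eqP ? /eqP; rewrite addr_eq0 => /eqP.
Qed.

Lemma eq_opp0 (x : R) : x = - x -> x = 0.
Proof. by move=> h; lra. Qed.

Lemma CR_signs (s x1 x2 y1 y2 : R) : s * s = 1 -> y1 = - s * x2 -> y2 = s * x1 ->
  (x1 = s * y2 /\ y1 = - (s * x2)) /\ (x2 = - s * y1 /\ y2 = - (- s * x1)).
Proof.
by move=> ss -> ->; rewrite !mulrA mulrNN ss !mul1r !mulNr opprK.
Qed.

Section Immersion.
Variables (U : set plane) (g : plane -> plane).
Hypothesis oU : open U.
Hypothesis gU : planar_conformal_immersion U g.

Let jac z := partial 0 g z 0 0 * partial 1 g z 0 1 - partial 0 g z 0 1 * partial 1 g z 0 0.

(** The Jacobian is continuous and nonzero, since at a zero both sign alternatives would hold and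
    force the differential to vanish. Its sign is thus constant near [z], and the map is holomorphic
    or antiholomorphic there. *)
Lemma immersion_harmonic z k : U z -> harmonic_at (fun y => g y 0 k) z.
Proof.
move=> Uz; have [g1 g2] := gU.
have Hg l y (Uy : U y) := class_C1_row l oU g1 Uy.
have pc i l y : U y -> {for y, continuous (fun z => partial i g z 0 l)}.
  by move=> /(Hg l)/nbhs_singleton/(_ i)[].
have jc : {for z, continuous jac}.
  exact: (cvgB (cvgM (pc 0 0 z Uz) (pc 1 1 z Uz)) (cvgM (pc 0 1 z Uz) (pc 1 0 z Uz))).
have cm y (Uy : U y) := conformal_matrix
  (etrans (esym (dot2E _ _)) (etrans (g2 y Uy).1.1 (dot2E _ _)))
  (etrans (esym (dot2E _ _)) (g2 y Uy).1.2).
have NU : nbhs z U by exact: open_nbhs_nbhs.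
(* The number s = 1 or -1 records the orientation, so that one pair of Cauchy-Riemann equations,
   with conjugate function multiplied by s or -s, serves both cases. *)
have [s [s2 N]] : exists s : R, s * s = 1 /\ \forall y \near z, U y /\
   (partial 1 g y 0 0 = - s * partial 0 g y 0 1 /\ partial 1 g y 0 1 = s * partial 0 g y 0 0).
  have [j0|j0] := ltP 0 (jac z).
    exists 1; split; first by rewrite mulr1.
    have Nj : \forall y \near z, 0 < jac y by move: jc => /cvgr_gt; apply.
    apply: filterS2 NU Nj => y Uy /ltW jy; split => //.
    have [/(_ jy)[e1 e2] _] := cm y Uy.
    by split; [exact: etrans e1 (esym (mulN1r _))|exact: etrans e2 (esym (mul1r _))].
  have j1 : jac z < 0.
    rewrite lt_neqAle j0 andbT; apply/eqP => e.
    have [c1 c2] := cm z Uz; have e' : 0 <= jac z by rewrite e.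
    have [h1 h2] := c1 e'; have [h3 h4] := c2 j0.
    have [_ /eqP] := g2 z Uz; apply; apply/rowP => i; rewrite mxE.
    have [->|->] := I2P i; apply: eq_opp0; first exact: etrans (esym h2) h4.
    exact: etrans (esym h3) h1.
  exists (-1); split; first by rewrite mulN1r opprK.
  have Nj : \forall y \near z, jac y < 0 by move: jc => /cvgr_lt; apply.
  apply: filterS2 NU Nj => y Uy /ltW jy; split => //.
  have [_ /(_ jy)[e1 e2]] := cm y Uy; split; last exact: etrans e2 (esym (mulN1r _)).
  by apply: (etrans e1); rewrite opprK; exact: esym (mul1r _).
have [r r0 sN] := nbhs_odisc N.
have rz := odisc_center z r0.
have sO y : odisc z r y -> U y /\
   (partial 1 g y 0 0 = - s * partial 0 g y 0 1 /\ partial 1 g y 0 1 = s * partial 0 g y 0 0).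
  by move=> /odisc_cdisc/sN.
have [->|->] := I2P k.
  apply: (@CR_harmonic (odisc z r) _ (fun y => s * g y 0 1) (fun i y => partial i g y 0 0)
    (fun i y => s * partial i g y 0 1)) rz; first exact: odisc_open.
  - by move=> y /sO[/(Hg 0)].
  - by move=> y /sO[/(Hg 1) H _]; exact: has_partialsZ.
  - by move=> y /sO[_ [e1 e2]]; exact: (CR_signs s2 e1 e2).1.
apply: (@CR_harmonic (odisc z r) _ (fun y => - s * g y 0 0) (fun i y => partial i g y 0 1)
    (fun i y => - s * partial i g y 0 0)) rz; first exact: odisc_open.
- by move=> y /sO[/(Hg 1)].
- by move=> y /sO[/(Hg 0) H _]; exact: has_partialsZ.
- by move=> y /sO[_ [e1 e2]]; exact: (CR_signs s2 e1 e2).2.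
Qed.

(** [l] is the conformal factor. The terms in the first derivatives of [phi] cancel because the
    components of [g] are harmonic, and the mixed second derivatives cancel by conformality. *)
Lemma immersion_comp (phi : plane -> R) z dp ddp : U z -> has_partials2 phi (g z) dp ddp ->
  exists l G H, [/\ 0 < l, has_partials2 (fun y => phi (g y)) z G H &
    H 0 0 z + H 1 1 z = l * (ddp 0 0 (g z) + ddp 1 1 (g z))].
Proof.
move=> Uz Hp; have [g1 g2] := gU; have [[k1 k2] k3] := g2 z Uz.
have [da [dda [Ha La]]] := immersion_harmonic 0 Uz.
have [db [ddb [Hb Lb]]] := immersion_harmonic 1 Uz.
pose df (k : 'I_2) := if k == 0 then da else db.
pose ddf (k : 'I_2) := if k == 0 then dda else ddb.
have Hg k : has_partials2 (fun y => g y 0 k) z (df k) (ddf k) by have [->|->] := I2P k.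
have e i : partial i g z 0 0 = da i z /\ partial i g z 0 1 = db i z.
  split.
    by rewrite -(has_partials_val Ha.1) (has_partials_val (class_C1_row 0 oU g1 Uz)).
  by rewrite -(has_partials_val Hb.1) (has_partials_val (class_C1_row 1 oU g1 Uz)).
move: (e 0) (e 1) k1 k2 k3 => {e}.
move: (partial 0 g z) (partial 1 g z) => p0 p1 [p00 p01] [p10 p11].
rewrite !dot2E p00 p01 p10 p11 => k1 k2 k3.
pose l := da 0 z * da 0 z + db 0 z * db 0 z.
have HC := has_partials2_comp Hp Hg.
exists l; eexists; eexists; split; [|exact: HC|].
  rewrite lt_neqAle addr_ge0 -?expr2 ?sqr_ge0// andbT eq_sym paddr_eq0 -?expr2 ?sqr_ge0//.
  rewrite !sqrf_eq0; apply/andP => -[/eqP h1 /eqP h2]; move/eqP: k3; apply.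
  by apply/rowP => i; rewrite mxE; have [->|->] := I2P i; rewrite ?p00 ?p01.
rewrite /= !sum2 /df /ddf /=.
have [c1 c2] := conformal_matrix k1 k2.
have {}La : dda 1 1 z = - dda 0 0 z by lra.
have {}Lb : ddb 1 1 z = - ddb 0 0 z by lra.
rewrite /l La Lb.
by have [/c1[-> ->]|/ltW/c2[-> ->]] := leP 0 (da 0 z * db 1 z - db 0 z * da 1 z); ring.
Qed.

Lemma immersion_continuous z : U z -> {for z, continuous g}.
Proof. by move=> Uz; have [g1 _] := gU; have [] := g1 [::] z Uz => /(_ isT). Qed.

(** A test function at [g z] is pulled back by [g] to one at [z]; its Laplacian is multiplied by a
    positive factor, which leaves the sign condition unchanged. *)
Lemma vsub_immersion (u : plane -> R) (h : plane -> plane) z : U z ->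
  {near z, cancel g h} -> vsub u (h (g (z))) ->
  vsub (fun y => u (h y)) (g z).
Proof.
move=> Uz gK uz phi dp ddp Hp M.
have [l [G [H [l0 h1 h2]]]] := immersion_comp Uz Hp.
have e := nbhs_singleton gK.
rewrite /= in e; rewrite e in uz M.
have : 0 <= l * (ddp 0 0 (g z) + ddp 1 1 (g z)).
  rewrite -h2; apply: uz h1 _.
  have M' : \forall y \near z, u (h (g y)) - phi (g y) <= u z - phi (g z).
    exact: immersion_continuous Uz _ M.
  by apply: filterS2 gK M' => y ->.
by rewrite pmulr_rge0.
Qed.

End Immersion.
End ConformalRegularity.

(** * Perron's method on a conformal surface *)

Section Surface.
Variables (R : realType) (M : conformal_surface R).
Local Notation plane := 'rV[R]_2.
Implicit Types (c d : chart R M) (x : M).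

Lemma atlas_dom_open c : atlas c -> open (chart_dom c).
Proof. by move=> /atlas_chart[]. Qed.

Lemma chart_invK c x : atlas c -> chart_dom c x -> chart_inv c (chart_map c x) = x.
Proof. by move=> /atlas_chart[_ _ h _ _]; exact: h. Qed.

Lemma chart_map_continuous c x : atlas c -> chart_dom c x -> {for x, continuous (chart_map c)}.
Proof. by move=> /atlas_chart[_ _ _ h _]; exact: h. Qed.

Lemma chart_inv_continuous c x : atlas c -> chart_dom c x ->
  {for chart_map c x, continuous (chart_inv c)}.
Proof. by move=> /atlas_chart[_ _ _ _ h] cx; apply: h; exists x. Qed.

Lemma chart_near c x (P : set M) : atlas c -> chart_dom c x -> nbhs x P ->
  \forall z \near chart_map c x,
    exists y, [/\ chart_dom c y, P y, z = chart_map c y & chart_inv c z = y].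
Proof.
move=> Ac cx Px; have [_ oi _ _ _] := atlas_chart Ac.
have N1 : nbhs (chart_map c x) (chart_map c @` chart_dom c).
  by apply: open_nbhs_nbhs; split => //; exists x.
have N2 : \forall z \near chart_map c x, P (chart_inv c z).
  by apply: (chart_inv_continuous Ac cx); rewrite chart_invK.
apply: filterS2 N1 N2 => z [y cy <-] /=; rewrite chart_invK// => Py.
by exists y.
Qed.

Lemma chart_image_open c (P : set M) : atlas c -> open P ->
  open (chart_map c @` (chart_dom c `&` P)).
Proof.
move=> Ac oP; rewrite openE => _ [x [cx Px] <-].
have Nx : nbhs x P by exact: open_nbhs_nbhs.
by apply: filterS (chart_near Ac cx Nx) => z [y [cy Py -> _]]; exists y.
Qed.

Lemma chart_near_dom c x (P : set M) : atlas c -> chart_dom c x ->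
  (\forall z \near chart_map c x, P (chart_inv c z)) -> nbhs x P.
Proof.
move=> Ac cx N.
have N1 : \forall y \near x, P (chart_inv c (chart_map c y)) by exact: chart_map_continuous N.
have N2 : nbhs x (chart_dom c) by apply: open_nbhs_nbhs; split => //; exact: atlas_dom_open.
by apply: filterS2 N1 N2 => y h cy; rewrite chart_invK in h.
Qed.

Lemma continuous_chart (T : topologicalType) c x (v : M -> T) : atlas c -> chart_dom c x ->
  {for x, continuous v} <-> {for chart_map c x, continuous (v \o chart_inv c)}.
Proof.
move=> Ac cx; split=> h.
  apply: (@continuous_comp _ _ _ (chart_inv c) v); first exact: chart_inv_continuous.
  by rewrite chart_invK.
apply: (@near_eq_for_continuous _ _ (v \o chart_inv c \o chart_map c)).
  have N2 : nbhs x (chart_dom c) by apply: open_nbhs_nbhs; split => //; exact: atlas_dom_open.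
  by apply: filterS N2 => y cy /=; rewrite chart_invK.
by apply: (@continuous_comp _ _ _ (chart_map c) (v \o chart_inv c)) => //; exact: chart_map_continuous.
Qed.

(** Here the Hausdorff axiom enters: a closed disc of a chart is closed in the whole surface, so
    functions altered only inside it glue continuously with their old values. *)
Lemma chart_compact_closed c (A : set plane) : atlas c -> compact A ->
  A `<=` chart_map c @` chart_dom c -> closed (chart_inv c @` A).
Proof.
move=> Ac cA sA; apply: compact_closed; first exact: surface_hausdorff.
apply: continuous_compact => //; apply: continuous_in_subspaceT => z; rewrite inE => /sA[x cx <-].
exact: chart_inv_continuous.
Qed.

Definition mharm (h : M -> R) x : Prop :=
  forall c, atlas c -> chart_dom c x -> harmonic_at (h \o chart_inv c) (chart_map c x).

Definition msub (v : M -> R) x : Prop :=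
  forall c, atlas c -> chart_dom c x -> vsub (v \o chart_inv c) (chart_map c x).

Lemma msub_eq (u v : M -> R) x : {near x, u =1 v} -> msub u x -> msub v x.
Proof.
move=> E Hu c Ac cx; apply: vsub_eq (Hu c Ac cx).
by apply: filterS (chart_near Ac cx E) => z [y [_ e _ h]]; rewrite /= h.
Qed.

Lemma transition_immersion c d : atlas c -> atlas d ->
  planar_conformal_immersion (chart_map c @` (chart_dom c `&` chart_dom d))
    (chart_map d \o chart_inv c).
Proof. exact: atlas_conformal. Qed.

(** Transition maps are conformal, so subharmonicity seen in one chart is seen in all of them. *)
Lemma msub_chart (v : M -> R) x c : atlas c -> chart_dom c x ->
  vsub (v \o chart_inv c) (chart_map c x) -> msub v x.
Proof.
move=> Ac cx H d Ad dx.
have oU := chart_image_open Ac (atlas_dom_open Ad).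
have Uz : (chart_map c @` (chart_dom c `&` chart_dom d)) (chart_map c x) by exists x.
have Nc : nbhs x (chart_dom c) by apply: open_nbhs_nbhs; split => //; exact: atlas_dom_open.
have Nd : nbhs x (chart_dom d) by apply: open_nbhs_nbhs; split => //; exact: atlas_dom_open.
have K : {near chart_map c x, cancel (chart_map d \o chart_inv c) (chart_map c \o chart_inv d)}.
  by apply: filterS (chart_near Ac cx Nd) => z [y [cy dy -> e]]; rewrite /= e chart_invK.
have V : vsub (v \o chart_inv c)
    ((chart_map c \o chart_inv d) ((chart_map d \o chart_inv c) (chart_map c x))).
  by rewrite /= (chart_invK Ac cx) (chart_invK Ad dx).
have := vsub_immersion oU (transition_immersion Ac Ad) Uz K V.
rewrite [X in vsub _ X]/= chart_invK//; apply: vsub_eq.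
by apply: filterS (chart_near Ad dx Nc) => z [y [dy cy -> e]]; rewrite /= e chart_invK.
Qed.

Section Perron.
Variables (Om : set M) (Us : set (M -> R)) (L : M -> R).
Hypothesis oOm : open Om.
Hypothesis Us0 : Us !=set0.
Hypothesis HU : forall U, Us U -> forall x, Om x -> {for x, continuous U} /\ msub (fun y => - U y) x.
Hypothesis HL : forall x, Om x -> {for x, continuous L} /\ msub L x.
Hypothesis LU : forall U, Us U -> forall x, Om x -> L x <= U x.

(** No boundary values are prescribed. Competitors are confined below all supersolutions of [Us],
    and the subsolution [L] makes the family nonempty, so bounds on the solution are built in
    through [L] and [Us]. *)
Definition perron_family (v : M -> R) : Prop :=
  (forall x, Om x -> {for x, continuous v} /\ msub v x) /\
  (forall U, Us U -> forall x, Om x -> v x <= U x).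

Lemma perron_max u v : perron_family u -> perron_family v ->
  perron_family (fun x => maxr (u x) (v x)).
Proof.
move=> [u1 u2] [v1 v2]; split=> [x Ox|U UU x Ox]; last by rewrite ge_max u2 ?v2.
have [cu su] := u1 x Ox; have [cv sv] := v1 x Ox; split; first exact: continuous_max.
by move=> c Ac cx; apply: vsub_max; [exact: su|exact: sv].
Qed.

Definition perron_lift c (a : plane) (r : R) (v : M -> R) x : R :=
  if pselect (chart_dom c x) then dirichlet a r (v \o chart_inv c) (chart_map c x) else v x.

Section Lift.
Variables (c : chart R M) (a : plane) (r : R).
Hypothesis Ac : atlas c.
Hypothesis r0 : 0 < r.
Hypothesis sub : cdisc a r `<=` chart_map c @` (chart_dom c `&` Om).

Lemma perron_lift_chart v x : chart_dom c x ->
  perron_lift c a r v x = dirichlet a r (v \o chart_inv c) (chart_map c x).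
Proof. by rewrite /perron_lift; case: pselect. Qed.

Lemma perron_lift_out v x : ~ (chart_inv c @` cdisc a r) x -> perron_lift c a r v x = v x.
Proof.
rewrite /perron_lift; case: pselect => // cx nx.
rewrite dirichlet_out /= ?chart_invK// leNgt; apply/negP => h; apply: nx.
by exists (chart_map c x); [exact: odisc_cdisc|rewrite chart_invK].
Qed.

Lemma perron_disc_closed : closed (chart_inv c @` cdisc a r).
Proof.
apply: chart_compact_closed => //; first exact: cdisc_compact.
by move=> z /sub[x [cx _] <-]; exists x.
Qed.

Lemma perron_disc z : cdisc a r z ->
  [/\ chart_dom c (chart_inv c z), Om (chart_inv c z) & chart_map c (chart_inv c z) = z].
Proof. by move=> /sub[x [cx Ox] <-]; rewrite chart_invK. Qed.

Section Function.
Variable v : M -> R.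
Hypothesis Fv : perron_family v.

Let u := v \o chart_inv c.

Lemma perron_disc_continuous z : cdisc a r z -> {for z, continuous u}.
Proof.
move=> /perron_disc[h1 h2 h3]; have [cv _] := Fv.1 _ h2.
by move/(continuous_chart _ Ac h1) : cv; rewrite h3.
Qed.

Lemma perron_circle_continuous z : sqdist a z = r ^+ 2 -> {for z, continuous u}.
Proof. by move=> /circle_cdisc/perron_disc_continuous. Qed.

Lemma perron_disc_le z : cdisc a r z -> u z <= dirichlet a r u z.
Proof.
apply: harmonic_compare => y hy.
- by split; [exact: perron_disc_continuous|exact: dirichlet_continuous perron_circle_continuous _ hy].
- split; last exact: dirichlet_harmonic perron_circle_continuous _ hy.
  have [h1 h2 h3] := perron_disc (odisc_cdisc hy).
  have [_ sv] := Fv.1 _ h2; have := sv c Ac h1; by rewrite h3.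
- by rewrite dirichlet_out// hy.
Qed.

Lemma perron_lift_ge x : v x <= perron_lift c a r v x.
Proof.
have [[z hz <-]|n] := pselect ((chart_inv c @` cdisc a r) x); last by rewrite perron_lift_out.
have [h1 h2 h3] := perron_disc hz.
by rewrite perron_lift_chart// h3; exact: perron_disc_le.
Qed.

(** Off the closed disc nothing changes, and inside the lift is harmonic. On the circle the lift
    agrees with [v] and lies above it nearby, so it inherits subharmonicity. Each bound [U] survives
    by comparing -U with minus the lift. *)
Lemma perron_lift_family : perron_family (perron_lift c a r v).
Proof.
have outN x : ~ (chart_inv c @` cdisc a r) x -> {near x, v =1 perron_lift c a r v}.
  move=> nx; have : nbhs x (~` (chart_inv c @` cdisc a r)).
    by apply: open_nbhs_nbhs; split => //; apply: closed_openC; exact: perron_disc_closed.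
  by apply: filterS => y /perron_lift_out ->.
have inN x : chart_dom c x ->
    {near chart_map c x, dirichlet a r u =1 perron_lift c a r v \o chart_inv c}.
  move=> cx; have N : nbhs x [set: M] by exact: filterT.
  by apply: filterS (chart_near Ac cx N) => z [y [cy _ -> e]]; rewrite /= e perron_lift_chart.
split=> [x Ox|U UU x Ox].
  have [cv sv] := Fv.1 x Ox.
  have [[z hz zx]|n] := pselect ((chart_inv c @` cdisc a r) x); last first.
    have N := outN x n; split; first exact: near_eq_for_continuous cv.
    exact: msub_eq sv.
  have [h1 h2 h3] := perron_disc hz; rewrite zx in h1 h2 h3.
  split.
    apply/(continuous_chart _ Ac h1); apply: near_eq_for_continuous (inN x h1) _.
    by rewrite h3; exact: dirichlet_continuous perron_circle_continuous _ hz.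
  apply: (msub_chart Ac h1); have [hi|ho] := ltP (sqdist a z) (r ^+ 2).
    apply: vsub_eq (inN x h1) _; rewrite h3.
    by apply: harmonic_vsub; exact: dirichlet_harmonic perron_circle_continuous _ hi.
  apply: (vsub_touch _ _ (sv c Ac h1)).
    by apply: (@filterE _ (nbhs (chart_map c x))) => y; exact: perron_lift_ge.
  rewrite /= chart_invK// perron_lift_chart// h3 dirichlet_out// /u /=.
  by rewrite -h3 chart_invK.
have [[z hz <-]|n] := pselect ((chart_inv c @` cdisc a r) x); last first.
  by rewrite perron_lift_out//; exact: Fv.2.
have [h1 h2 h3] := perron_disc hz; rewrite perron_lift_chart// h3 -/u.
rewrite -lerN2; move: z hz {h1 h2 h3}.
apply: (@harmonic_compare _ a r (fun z => - U (chart_inv c z)) (fun z => - dirichlet a r u z)) => y hy.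
- have [h1 h2 h3] := perron_disc hy; have [cU _] := HU UU h2.
  move/(continuous_chart _ Ac h1) : cU; rewrite h3 => cU; split; first exact: (cvgN cU).
  exact: (cvgN (dirichlet_continuous r0 perron_circle_continuous hy)).
- have [h1 h2 h3] := perron_disc (odisc_cdisc hy); have [_ sU] := HU UU h2.
  split; first by have := sU c Ac h1; rewrite h3.
  by apply: harmonic_atN; exact: dirichlet_harmonic perron_circle_continuous _ hy.
- rewrite lerN2 dirichlet_out ?hy//.
  by have [h1 h2 h3] := perron_disc (circle_cdisc hy); exact: Fv.2.
Qed.

End Function.
End Lift.

Definition perron x : R := sup [set v x | v in perron_family].

Lemma perron_L : perron_family L.
Proof. by split. Qed.

Lemma perron_has_sup x : Om x -> has_sup [set v x | v in perron_family].
Proof.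
move=> Ox; split; first by exists (L x), L => //; exact: perron_L.
by have [U UU] := Us0; exists (U x) => _ [v [_ vU] <-]; exact: vU.
Qed.

Lemma perron_ge v x : Om x -> perron_family v -> v x <= perron x.
Proof. by move=> Ox Fv; apply: sup_upper_bound; [exact: perron_has_sup|exists v]. Qed.

Lemma perron_le U x : Om x -> Us U -> perron x <= U x.
Proof.
move=> Ox UU; apply: ge_sup; first by exists (L x), L => //; exact: perron_L.
by move=> _ [v [_ vU] <-]; exact: vU.
Qed.

(** Let [v0] come within e / 4 of the supremum at the centre. For any competitor [v], the lift of
    max(v, v0) minus the lift of [v0] is harmonic, nonnegative on the circle and at most e / 4 at
    the centre, so Harnack bounds it by [e] on the half disc. The supremum is therefore a uniform
    limit of harmonic functions there. *)
Lemma perron_harmonic x : Om x -> mharm perron x.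
Proof.
move=> Ox c Ac cx; set z0 := chart_map c x.
have N : nbhs z0 (chart_map c @` (chart_dom c `&` Om)).
  apply: open_nbhs_nbhs; split; last by exists x.
  exact: chart_image_open.
have [r r0 sub] := nbhs_odisc N.
have r20 : 0 < r / 2 by rewrite divr_gt0.
apply: (@harmonic_uniform_limit _ z0 (r / 2)) => //; last exact: odisc_center.
move=> e e0; have e4 : 0 < e / 4 by rewrite divr_gt0.
have [_ [v0 F0 <-] v0S] := sup_adherent e4 (perron_has_sup Ox).
have cz0 := odisc_cdisc (odisc_center z0 r0).
exists (dirichlet z0 r (v0 \o chart_inv c)) => z hz.
have hz' : odisc z0 r z by apply: odisc_le hz; [exact: ltW|rewrite ler_pdivrMr// ler_pMr// ler1n].
have C0 := perron_circle_continuous Ac sub F0.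
split; first exact: dirichlet_harmonic.
have [h1 h2 h3] := perron_disc Ac sub (odisc_cdisc hz').
have LE v : perron_family v -> dirichlet z0 r (v \o chart_inv c) z <= perron (chart_inv c z).
  move=> Fv; have := perron_ge h2 (perron_lift_family Ac r0 sub Fv).
  by rewrite perron_lift_chart// h3.
have LE0 v : perron_family v -> dirichlet z0 r (v \o chart_inv c) z0 <= perron x.
  move=> Fv; have := perron_ge Ox (perron_lift_family Ac r0 sub Fv).
  by rewrite perron_lift_chart.
have GE : perron (chart_inv c z) <= dirichlet z0 r (v0 \o chart_inv c) z + e.
  apply: ge_sup; first by exists (L (chart_inv c z)), L => //; exact: perron_L.
  move=> _ [v Fv <-]; pose v1 y := maxr (v y) (v0 y).
  have F1 : perron_family v1 by exact: perron_max.
  have C1 := perron_circle_continuous Ac sub F1.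
  have v1d := perron_disc_le Ac r0 sub F1 (odisc_cdisc hz').
  have vv1 : v (chart_inv c z) <= v1 (chart_inv c z) by rewrite le_max lexx.
  have H := @harnack _ z0 r (fun z => dirichlet z0 r (v1 \o chart_inv c) z - dirichlet z0 r (v0 \o chart_inv c) z) r0.
  have {}H := H (fun y hy => cvgB (dirichlet_continuous r0 C1 hy) (dirichlet_continuous r0 C0 hy))
    (fun y hy => harmonic_atB (dirichlet_harmonic r0 C1 hy) (dirichlet_harmonic r0 C0 hy)).
  have P y : sqdist z0 y = r ^+ 2 -> 0 <= dirichlet z0 r (v1 \o chart_inv c) y - dirichlet z0 r (v0 \o chart_inv c) y.
    by move=> hy; rewrite !dirichlet_out ?hy// subr_ge0 /= le_max lexx orbT.
  have := H (fun y => nbhs_filter y) P z hz; have := LE0 v1 F1.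
  have := perron_disc_le Ac r0 sub F0 cz0; rewrite /= /z0 chart_invK// -/z0.
  rewrite /= in v1d; rewrite -/(perron x) in v0S.
  lra.
have := LE v0 F0; rewrite ler_norml /= => h4; apply/andP; split; lra.
Qed.

End Perron.
End Surface.

(** * Density of the complement of a removable set *)

Section Dipole.
Variable R : realType.
Local Notation plane := 'rV[R]_2.

Lemma has_partials2V m (f : 'rV[R]_m -> R) x df ddf : f x != 0 -> has_partials2 f x df ddf ->
  has_partials2 (fun z => (f z)^-1) x (fun i z => df i z * - ((f z)^-1 ^+ 2))
    (fun i j z => ddf i j z * - ((f z)^-1 ^+ 2) + df i z * (df j z * (2 * (f z)^-1 ^+ 3))).
Proof.
move=> fx H; apply: (has_partials2_comp1 (h := fun s => s^-1) (dh := fun s => - (s^-1 ^+ 2))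
  (ddh := fun s => 2 * s^-1 ^+ 3)) H.
have N : \forall s \near f x, s != 0 :> R.
  by apply: open_nbhs_nbhs; split => //; exact: open_neq.
apply: filterS N => s s0.
have h : is_derive s (1 : R) (fun s : R => s^-1) (- (s^-1 ^+ 2)).
  have h := is_deriveV (f := id) s0 (is_derive_id s (1 : R)).
  by apply: is_derive_eq h _; rewrite /= [LHS]mulr1 exprVn.
split => //; split.
  have := is_deriveN (is_deriveM h h).
  rewrite (_ : - (_ * _) = fun s : R => - (s^-1 ^+ 2)); last by apply/funext => y; rewrite expr2.
  by move=> D; apply: is_derive_eq D _; rewrite /GRing.scale /=; ring.
have c : {for s, continuous (fun s : R => s^-1)} by apply: cvgV => //; exact: cvg_id.
exact: (cvgM (cvg_cst (2 : R)) (cvgM c (cvgM c c))).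
Qed.

(** The Kelvin transform of a linear function about [p], harmonic away from [p]. *)
Definition dipole (p v z : plane) : R := dot (z - p) v / sqdist p z.

Lemma harmonic_dipole (p v z : plane) : z != p -> harmonic_at (dipole p v) z.
Proof.
move=> zp; have d0 : sqdist p z != 0 by rewrite gt_eqF// sqdist_gt0.
have Hl (i : 'I_2) := has_partials2Z (v 0 i) (has_partials2B (has_partials2_coord i z) (has_partials2_cst (p 0 i) z)).
have H := has_partials2M (has_partials2D (Hl 0) (Hl 1)) (has_partials2V d0 (has_partials2_sqdist p z)).
eexists; eexists; split.
  by apply: has_partials2_eq H; apply: near_eq_all => y; rewrite /dipole dot2E !mxE /=; ring.
by rewrite /= sqdistE in d0 *; field.
Qed.

(* The boundary of the disc with centre p through q is the zero set. *)
Definition barrier (p q z : plane) : R := 1 - dipole p (q - p) z.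

Lemma harmonic_barrier (p q z : plane) : z != p -> harmonic_at (barrier p q) z.
Proof. by move=> zp; apply: harmonic_atB; [exact: harmonic_at_cst|exact: harmonic_dipole]. Qed.

Lemma barrierE (p q z : plane) : z != p -> barrier p q z =
  (sqdist q z + (sqdist p z - sqdist p q)) / (2 * sqdist p z).
Proof.
move=> zp; have d0 : sqdist p z != 0 by rewrite gt_eqF// sqdist_gt0.
rewrite /barrier /dipole (_ : dot _ _ = (sqdist p z + sqdist p q - sqdist q z) / 2); last first.
  by rewrite dot2E !sqdistE !mxE; field.
by field.
Qed.

Lemma barrier_ge (p q z : plane) (Q : R) : z != p -> sqdist p q <= sqdist p z -> sqdist p z <= Q ->
  sqdist q z / (2 * Q) <= barrier p q z.
Proof.
move=> zp h1 h2; have d0 := sqdist_gt0 zp; rewrite barrierE//.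
have Q0 : 0 < Q := lt_le_trans d0 h2.
apply: (@le_trans _ _ (sqdist q z / (2 * sqdist p z))).
  rewrite ler_wpM2l ?sqdist_ge0// lef_pV2 ?posrE ?mulr_gt0//.
  by rewrite ler_pM2l.
by rewrite ler_wpM2r ?invr_ge0 ?mulr_ge0 ?sqdist_ge0//; lra.
Qed.

(** The barrier is the scalar product of z - p and z - q divided by |z - p|^2. By Cauchy-Schwarz it
    is of linear size at [q], too small to compensate a square root of the distance. *)
Lemma barrier_sqr_le (p q z : plane) : z != p -> barrier p q z ^+ 2 <= sqdist q z / sqdist p z.
Proof.
move=> zp; have d0 := sqdist_gt0 zp.
have -> : barrier p q z = dot (z - p) (z - q) / sqdist p z.
  rewrite /barrier /dipole -[1](@mulfV _ (sqdist p z)) ?gt_eqF// -mulrBl; congr (_ / _).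
  by rewrite !dot2E sqdistE !mxE; ring.
rewrite exprMn exprVn ler_pdivrMr ?exprn_gt0// expr2 (expr2 (sqdist p z)) mulrA divfK ?gt_eqF//.
by rewrite -expr2 mulrC; exact: cauchy_schwarz2.
Qed.

(** This is |z - q|^(1/2), written with exponential and logarithm so that its subharmonicity comes
    from convexity. At z = q the formula is not meaningful, hence the hypothesis [z != q] in the
    facts that compare it with the distance. *)
Definition fourth_root (q z : plane) : R := expR (ln (sqdist q z) / 4).

Lemma fourth_root_gt0 (q z : plane) : 0 < fourth_root q z.
Proof. exact: expR_gt0. Qed.

Lemma fourth_rootX (q z : plane) : z != q -> fourth_root q z ^+ 4 = sqdist q z.
Proof.
move=> zq; rewrite -expRM_natr divfK// lnK// posrE; exact: sqdist_gt0.
Qed.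

Lemma fourth_root_le (q z : plane) (t : R) : z != q -> 0 <= t -> sqdist q z <= t ^+ 4 ->
  fourth_root q z <= t.
Proof.
move=> zq t0; rewrite -fourth_rootX// ler_pXn2r// ?nnegrE//.
exact/ltW/fourth_root_gt0.
Qed.

Lemma fourth_root_continuous (q z : plane) : z != q -> {for z, continuous (fourth_root q)}.
Proof.
move=> zq; apply: (@continuous_comp _ _ _ (fun z => ln (sqdist q z) / 4) expR); last exact: continuous_expR.
exact: (cvgM (harmonic_at_continuous (harmonic_ln zq)) (cvg_cst (4^-1 : R))).
Qed.

(* The fourth root of |z - q|^2 is a convex function of a harmonic function. *)
Lemma fourth_root_vsub (q z : plane) : z != q -> vsub (fourth_root q) z.
Proof.
move=> zq; pose l y : R := ln (sqdist q y) / 4.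
have hl : harmonic_at l z.
  apply: harmonic_at_eq (harmonic_atZ 4^-1 (harmonic_ln zq)).
  by apply: near_eq_all => y; rewrite /l mulrC.
pose T y := expR (l z) * (1 + (l y - l z)).
have hT : harmonic_at T z.
  apply: harmonic_atZ; apply: harmonic_atD; first exact: harmonic_at_cst.
  by apply: harmonic_atB => //; exact: harmonic_at_cst.
apply: (@vsub_touch _ _ T); last exact: harmonic_vsub.
  apply: (@filterE _ (nbhs z)) => y; rewrite /T /fourth_root -/(l y).
  rewrite -[X in _ <= expR X](subrK (l z)) expRD mulrC ler_wpM2r ?expR_ge0//.
  exact: expR_ge1Dx.
by rewrite /T subrr addr0 mulr1.
Qed.

End Dipole.

Section RemovableDense.
Variables (R : realType) (M : conformal_surface R).
Local Notation plane := 'rV[R]_2.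

Lemma planar_harmonic_at (U : set plane) (h : plane -> R) z :
  open U -> planar_harmonic U h -> U z -> harmonic_at h z.
Proof.
move=> oU [h1 h2] Uz; eexists; eexists; split; first exact: class_C2_partials oU h1 Uz.
exact: h2.
Qed.

Lemma harmonic_at_planar (U : set plane) (h : plane -> R) :
  (forall z, U z -> harmonic_at h z) -> planar_harmonic U h.
Proof.
move=> H; split.
  by apply: class_C2_of_partials => z /H[g [k [Hh _]]]; exists g, k.
move=> z /H[g [k [Hh L]]].
by rewrite (has_partials2_val Hh 0 0) (has_partials2_val Hh 1 1).
Qed.

Lemma harmonic_on_mharm (U : set M) (h : M -> R) x : open U -> harmonic_on U h -> U x -> mharm h x.
Proof.
move=> oU H Ux c Ac cx; apply: planar_harmonic_at (H c Ac) _; first exact: chart_image_open.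
by exists x.
Qed.

Lemma mharm_harmonic_on (U : set M) (h : M -> R) : (forall x, U x -> mharm h x) -> harmonic_on U h.
Proof. by move=> H c Ac; apply: harmonic_at_planar => _ [x [cx Ux] <-]; exact: H. Qed.

(** * A harmonic function off a disc trapped between a square root and barriers *)

Section Trap.
Variables (c : chart R M) (p q : plane) (rho : R).
Hypothesis Ac : atlas c.
Hypothesis pq : q != p.
Hypothesis rho0 : 0 < rho.
Hypothesis rho1 : rho <= 1.

Let delta := Num.sqrt (sqdist p q).
Hypothesis subp : cdisc p delta `<=` chart_map c @` chart_dom c.
Hypothesis subq : cdisc q rho `<=` chart_map c @` chart_dom c.

Let Om : set M := ~` (chart_inv c @` cdisc p delta).

Let dd0 : 0 < sqdist p q. Proof. exact: sqdist_gt0. Qed.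

Let dE : delta ^+ 2 = sqdist p q. Proof. by rewrite sqr_sqrtr ?sqdist_ge0. Qed.

Let oOm : open Om.
Proof.
by apply: closed_openC; apply: chart_compact_closed => //; exact: cdisc_compact.
Qed.

(** [Q] bounds |z - p|^2 on the part of the disc about [q] outside the disc about [p]. With kappa =
    1 / (2 Q) the barrier is at least kappa |z - q|^2 there. *)
Let Q : R := 2 * sqdist p q + 2 * rho ^+ 2.
Let kappa : R := (2 * Q)^-1.

Let rr0 : 0 < rho ^+ 2. Proof. by rewrite exprn_gt0. Qed.

Let Q0 : 0 < Q. Proof. by rewrite addr_gt0// mulr_gt0. Qed.

Let kappa0 : 0 < kappa. Proof. by rewrite invr_gt0 mulr_gt0. Qed.

Definition trap_region (z : plane) : Prop := sqdist p q < sqdist p z /\ sqdist q z < rho ^+ 2.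

Lemma trap_region_neq z : trap_region z -> z != p /\ z != q.
Proof.
move=> [h1 h2]; split; apply/eqP => e; move: h1; rewrite e ?ltxx//.
by rewrite sqdistxx ltNge sqdist_ge0.
Qed.

Lemma trap_barrier z : trap_region z -> kappa * sqdist q z <= barrier p q z.
Proof.
move=> rz; have [zp _] := trap_region_neq rz; have [h1 h2] := rz.
rewrite mulrC; apply: barrier_ge => //; first exact: ltW.
by apply: (le_trans (sqdist_triangle p q z)); rewrite /Q; lra.
Qed.

Lemma trap_chart x : Om x -> chart_dom c x -> sqdist q (chart_map c x) < rho ^+ 2 ->
  trap_region (chart_map c x).
Proof.
move=> Ox cx h; split => //; rewrite ltNge; apply/negP => h1; apply: Ox.
by exists (chart_map c x); [rewrite /cdisc /= dE|rewrite chart_invK].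
Qed.

Definition trap_glue (F : plane -> R) (k : R) (x : M) : R :=
  if pselect (chart_dom c x /\ sqdist q (chart_map c x) < rho ^+ 2) then F (chart_map c x) else k.

(** The local function equals the constant [k] on the outer half of the disc about [q], so near
    every point of [Om] the glued function is, as a germ, either the local one or constant, and
    properties can be checked separately. *)
Lemma trap_glueP (F : plane -> R) (k : R) x :
  (forall z, trap_region z -> rho ^+ 2 / 4 <= sqdist q z -> F z = k) -> Om x ->
  (exists2 z, z = chart_map c x & [/\ chart_dom c x, trap_region z,
     trap_glue F k x = F z & {near z, F =1 trap_glue F k \o chart_inv c}]) \/
  (trap_glue F k x = k /\ {near x, (fun _ => k) =1 trap_glue F k}).
Proof.
move=> FK Ox.
have [[cx h]|n] := pselect (chart_dom c x /\ sqdist q (chart_map c x) < rho ^+ 2).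
  left; exists (chart_map c x) => //; split => //.
  - exact: trap_chart.
  - by rewrite /trap_glue; case: pselect => // -[].
  have N : nbhs x [set: M] by exact: filterT.
  have N2 : \forall z \near chart_map c x, sqdist q z < rho ^+ 2.
    by apply: odisc_nbhs.
  apply: filterS2 (chart_near Ac cx N) N2 => z [y [cy _ -> e]] h2.
  rewrite /= e /trap_glue; case: pselect => // H.
  by exfalso; apply: H.
right.
have K y : Om y -> ~ (chart_inv c @` cdisc q (rho / 2)) y -> trap_glue F k y = k.
  move=> Oy ny; rewrite /trap_glue; case: pselect => // -[cy h].
  apply: FK; first exact: trap_chart.
  rewrite leNgt; apply/negP => h2; apply: ny; exists (chart_map c y); last by rewrite chart_invK.
  by rewrite /cdisc /= exprMn (_ : 2^-1 ^+ 2 = 4^-1); [exact: ltW|field].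
have nx : ~ (chart_inv c @` cdisc q (rho / 2)) x.
  move=> [z hz zx]; apply: n.
  have hz' : odisc q rho z.
    apply: cdisc_odisc hz; first by rewrite divr_ge0// ltW.
    by rewrite gtr_pMr// invf_lt1// ltr1n.
  by have [y cy e] := subq (odisc_cdisc hz'); rewrite -e chart_invK// in zx; rewrite -zx e; split.
split; first exact: K.
have cl : closed (chart_inv c @` cdisc q (rho / 2)).
  apply: chart_compact_closed => //; first exact: cdisc_compact.
  move=> z hz; apply: subq; apply: le_trans hz _.
  by rewrite ler_pXn2r ?nnegrE ?divr_ge0 ?(ltW rho0)// ler_pdivrMr// ler_pMr// ler1n.
have N1 : nbhs x (~` (chart_inv c @` cdisc q (rho / 2))).
  by apply: open_nbhs_nbhs; split => //; exact: closed_openC.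
have N2 : nbhs x Om by apply: open_nbhs_nbhs; split.
by apply: filterS2 N1 N2 => y h1 h2; rewrite K.
Qed.

(** Chosen so that A times the barrier is at least 1 once |z - q| reaches rho / 2. The square root
    is at most 1 on the region, so [trap_low] is 0 there and glues with 0. *)
Let A : R := 4 / (kappa * rho ^+ 2).

Let A0 : 0 < A. Proof. by rewrite divr_gt0// mulr_gt0. Qed.

Definition trap_low (z : plane) : R := maxr 0 (fourth_root q z - A * barrier p q z).

(** The term 4 / rho^2 makes the multiplied barrier at least 1 for |z - q| beyond rho / 2, so the
    upper function becomes 1 there. The term t^-4 makes it at least 1 once |z - q|^(1/2) exceeds
    [t]; below that the summand [t] dominates the square root. Either way the lower function stays
    below the upper one. *)
Definition trap_coef (t : R) : R := (4 / rho ^+ 2 + t ^- 4) / kappa.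

(* This is the minimum of 1 and t + C barrier. *)
Definition trap_up (t : R) (z : plane) : R :=
  - maxr (- 1) (- (t + trap_coef t * barrier p q z)).

Lemma trap_root_le1 z : trap_region z -> fourth_root q z <= 1.
Proof.
move=> rz; have [_ zq] := trap_region_neq rz; apply: fourth_root_le => //.
rewrite expr1n; have [_ h] := rz; apply: (le_trans (ltW h)).
by rewrite expr_le1// ltW.
Qed.

Lemma trap_barrier_ge0 z : trap_region z -> 0 <= barrier p q z.
Proof. by move=> /trap_barrier; apply: le_trans; rewrite mulr_ge0 ?sqdist_ge0// ltW. Qed.

Lemma trap_low_far z : trap_region z -> rho ^+ 2 / 4 <= sqdist q z -> trap_low z = 0.
Proof.
move=> rz h; rewrite /trap_low (max_idPl _)// subr_le0.
apply: (le_trans (trap_root_le1 rz)).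
have h1 : A * (kappa * (rho ^+ 2 / 4)) = 1 by rewrite /A; field; rewrite !gt_eqF.
rewrite -h1 ler_pM2l//; apply: le_trans (trap_barrier rz).
by rewrite ler_pM2l.
Qed.

Lemma trap_coef_gt0 t : 0 < t -> 0 < trap_coef t.
Proof. by move=> t0; rewrite divr_gt0// addr_gt0// ?divr_gt0// invr_gt0 exprn_gt0. Qed.

Lemma trap_coef_barrier t z : 0 < t -> trap_region z ->
  (4 / rho ^+ 2 + t ^- 4) * sqdist q z <= trap_coef t * barrier p q z.
Proof.
move=> t0 rz; rewrite /trap_coef -mulrA ler_pM2l.
  by rewrite mulrC ler_pdivlMr// mulrC; exact: trap_barrier.
by rewrite addr_gt0// ?divr_gt0// invr_gt0 exprn_gt0.
Qed.

Lemma trap_up_far t z : 0 < t -> trap_region z -> rho ^+ 2 / 4 <= sqdist q z -> trap_up t z = 1.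
Proof.
move=> t0 rz h; rewrite /trap_up (max_idPl _) ?opprK// lerN2.
have := trap_coef_barrier t0 rz.
have h1 : (4 / rho ^+ 2) * (rho ^+ 2 / 4) = 1 by field; rewrite gt_eqF.
have h2 : (4 / rho ^+ 2) * (rho ^+ 2 / 4) <= (4 / rho ^+ 2) * sqdist q z.
  by rewrite ler_pM2l// divr_gt0.
have h3 : 0 <= t ^- 4 * sqdist q z by rewrite mulr_ge0 ?sqdist_ge0// invr_ge0 exprn_ge0// ltW.
by rewrite mulrDl; lra.
Qed.

Lemma trap_low_le1 z : trap_region z -> trap_low z <= 1.
Proof.
move=> rz; rewrite /trap_low ge_max ler01 /=.
have := trap_root_le1 rz; have : 0 <= A * barrier p q z.
  by rewrite mulr_ge0 ?trap_barrier_ge0// ltW.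
by lra.
Qed.

Lemma trap_low_up t z : 0 < t -> trap_region z -> trap_low z <= trap_up t z.
Proof.
move=> t0 rz; rewrite /trap_up lerNr ge_max lerN2 trap_low_le1//= lerN2.
have cb := trap_coef_barrier t0 rz; have b0 := trap_barrier_ge0 rz.
have c0 : 0 <= trap_coef t * barrier p q z by rewrite mulr_ge0// ltW// trap_coef_gt0.
have a0 : 0 <= A * barrier p q z by rewrite mulr_ge0// ltW.
rewrite /trap_low ge_max addr_ge0 ?(ltW t0)//=.
have [_ zq] := trap_region_neq rz.
have [h|h] := leP (sqdist q z) (t ^+ 4).
  by have := fourth_root_le zq (ltW t0) h; lra.
have h1 : 1 <= t ^- 4 * sqdist q z by rewrite mulrC ler_pdivlMr ?exprn_gt0// mul1r ltW.
have h2 : 0 <= 4 / rho ^+ 2 * sqdist q z by rewrite mulr_ge0 ?sqdist_ge0// ltW// divr_gt0.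
by have := trap_root_le1 rz; rewrite mulrDl in cb; lra.
Qed.

Lemma trap_low_good z : trap_region z -> {for z, continuous trap_low} /\ vsub trap_low z.
Proof.
move=> rz; have [zp zq] := trap_region_neq rz.
have hb := harmonic_atZ A (harmonic_barrier q zp).
have cf := cvgB (fourth_root_continuous zq) (harmonic_at_continuous hb).
split.
  apply: (@continuous_max _ _ (fun _ => 0) (fun z => fourth_root q z - A * barrier p q z)).
    exact: cst_continuous.
  exact: cf.
apply: vsub_max; first exact: harmonic_vsub (harmonic_at_cst 0 z).
by apply: vsub_subr hb; exact: fourth_root_vsub.
Qed.

Lemma trap_up_good t z : trap_region z ->
  {for z, continuous (trap_up t)} /\ vsub (fun y => - trap_up t y) z.
Proof.
move=> rz; have [zp zq] := trap_region_neq rz.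
have hb := harmonic_atN (harmonic_atD (harmonic_at_cst t z) (harmonic_atZ (trap_coef t) (harmonic_barrier q zp))).
have cf := harmonic_at_continuous hb.
have cm : {for z, continuous (fun z => maxr (- 1) (- (t + trap_coef t * barrier p q z)))}.
  apply: (@continuous_max _ _ (fun _ => - 1) (fun z => - (t + trap_coef t * barrier p q z))).
    exact: cst_continuous.
  exact: cf.
split; first exact: (cvgN cm).
apply: (@vsub_eq _ _ (fun y => maxr (- 1) (- (t + trap_coef t * barrier p q y)))).
  by apply: near_eq_all => y; rewrite /trap_up opprK.
by apply: vsub_max; [exact: harmonic_vsub (harmonic_at_cst _ _)|exact: harmonic_vsub].
Qed.

(** This is the Perron solution between the glued lower function and the glued upper functions for
    all t > 0. The barrier vanishes at [q], so the upper bounds force the limit 0 there, while the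
    lower bound is of size |z - q|^(1/2). *)
Lemma trapped_harmonic : exists S : M -> R, [/\
  forall x, Om x -> mharm S x,
  forall x, Om x -> 0 <= S x <= 1 &
  forall x, Om x -> chart_dom c x -> sqdist q (chart_map c x) < rho ^+ 2 ->
    fourth_root q (chart_map c x) - A * barrier p q (chart_map c x) <= S x /\
    forall t, 0 < t -> S x <= t + trap_coef t * barrier p q (chart_map c x)].
Proof.
pose L := trap_glue trap_low 0.
pose Us := [set trap_glue (trap_up t) 1 | t in [set t | 0 < t]].
have Us0 : Us !=set0 by exists (trap_glue (trap_up 1) 1), 1 => //=.
have cstc (k : R) x : {for x, continuous (fun _ : M => k)} by exact: cvg_cst.
have csts (k : R) x : msub (fun _ : M => k) x.
  by move=> d Ad dx; exact: harmonic_vsub (harmonic_at_cst k _).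
have HL x : Om x -> {for x, continuous L} /\ msub L x.
  move=> Ox; have [[z ze [cx rz _ N]]|[_ N]] := trap_glueP trap_low_far Ox.
    have [h1 h2] := trap_low_good rz; rewrite ze in h1 h2 N; split.
      by apply/(continuous_chart _ Ac cx); exact: near_eq_for_continuous h1.
    by apply: (msub_chart Ac cx); exact: vsub_eq h2.
  by split; [exact: near_eq_for_continuous (cstc 0 x)|exact: msub_eq (csts 0 x)].
have HU U : Us U -> forall x, Om x -> {for x, continuous U} /\ msub (fun y => - U y) x.
  move=> [t t0 <-] x Ox.
  have [[z ze [cx rz _ N]]|[_ N]] := trap_glueP (fun z => @trap_up_far t z t0) Ox.
    have [h1 h2] := trap_up_good t rz; rewrite ze in h1 h2 N; split.
      by apply/(continuous_chart _ Ac cx); exact: near_eq_for_continuous h1.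
    apply: (msub_chart Ac cx); apply: vsub_eq h2.
    by apply: filterS N => y /= ->.
  split; first exact: near_eq_for_continuous (cstc 1 x).
  by apply: msub_eq (csts (- 1) x); apply: filterS N => y /= <-.
have LU U : Us U -> forall x, Om x -> L x <= U x.
  move=> [t t0 <-] x Ox; rewrite /L /trap_glue; case: pselect => [H|n]; last exact: ler01.
  by have [cx h] := H; apply: trap_low_up => //; exact: trap_chart.
exists (perron Om Us); split.
- by move=> x Ox; exact: (perron_harmonic oOm Us0 HU HL LU Ox).
- move=> x Ox; have G := perron_ge Us0 HL LU Ox (perron_L HL LU).
  have U1 : Us (trap_glue (trap_up 1) 1) by exists 1 => //=.
  have Le := perron_le HL LU Ox U1.
  apply/andP; split; [apply: (le_trans _ G)|apply: (le_trans Le)]; rewrite /L /trap_glue.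
    by case: pselect => h; [rewrite /trap_low le_max lexx|exact: lexx].
  by case: pselect => h; [rewrite /trap_up lerNl le_max lexx|exact: lexx].
- move=> x Ox cx h; have rz := trap_chart Ox cx h; split.
    apply: le_trans (perron_ge Us0 HL LU Ox (perron_L HL LU)).
    rewrite /L /trap_glue; case: pselect => [y1|n]; last by exfalso; apply: n.
    by rewrite /trap_low le_max lexx orbT.
  move=> t t0; have U1 : Us (trap_glue (trap_up t) 1) by exists t.
  apply: (le_trans (perron_le HL LU Ox U1)).
  rewrite /trap_glue; case: pselect => [y1|n]; last by exfalso; apply: n.
  by rewrite /trap_up lerNl le_max lexx orbT.
Qed.

End Trap.
End RemovableDense.

Section Density.
Variables (R : realType) (M : conformal_surface R).
Local Notation plane := 'rV[R]_2.

Lemma has_partials_lipschitz m (f : 'rV[R]_m -> R) x g : has_partials f x g ->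
  exists2 C, 0 <= C & \forall y \near x, `|f y - f x| <= C * `|y - x|.
Proof.
move=> /has_partials_taylor/(_ 1 ltr01)/near0_norm[d d0 Hd].
exists (1 + \sum_i `|g i x|); first by rewrite addr_ge0// sumr_ge0.
apply/nbhs_ballP; exists d => // y; rewrite -ball_normE /ball_ /= distrC => /Hd.
rewrite addr0 subrK mul1r => h.
rewrite mulrDl mul1r -[f y - f x](subrK (\sum_i (y - x) 0 i * g i x)).
apply: (le_trans (ler_normD _ _)); apply: lerD => //.
rewrite mulr_suml; apply: (le_trans (ler_norm_sum _ _ _)); apply: ler_sum => i _.
by rewrite normrM mulrC ler_wpM2l// mx_norm_le.
Qed.

Lemma closure_chart (c : chart R M) (q : plane) (W : set M) (P : set plane) : atlas c ->
  (chart_map c @` chart_dom c) q -> closure W (chart_inv c q) -> nbhs q P ->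
  exists z, [/\ P z, (chart_map c @` chart_dom c) z & W (chart_inv c z)].
Proof.
move=> Ac [x cx <-] Wx Px; rewrite chart_invK// in Wx.
have N : nbhs x (chart_dom c) by apply: open_nbhs_nbhs; split => //; exact: atlas_dom_open.
have N2 : \forall y \near x, P (chart_map c y) by exact: chart_map_continuous Px.
have [y [Wy [cy Py]]] := Wx _ (filterI N N2).
by exists (chart_map c y); split; [|exists y|rewrite chart_invK].
Qed.

(* A bounded harmonic function off a disc inside K that behaves like
   |z - q|^(1/2) at a boundary point q of the disc adherent to the complement
   of K has no extension that is differentiable at q. *)
Lemma removable_touching (K : set M) (c : chart R M) (p q : plane) (rho : R) :
  removable K -> atlas c -> q != p -> 0 < rho -> rho <= 1 ->
  cdisc p (Num.sqrt (sqdist p q)) `<=` chart_map c @` chart_dom c ->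
  cdisc q rho `<=` chart_map c @` chart_dom c ->
  (forall z, cdisc p (Num.sqrt (sqdist p q)) z -> K (chart_inv c z)) ->
  closure (~` K) (chart_inv c q) -> False.
Proof.
move=> [clK rK] Ac qp rho0 rho1 sp sq pK qW.
have [S [S1 S2 S3]] := trapped_harmonic Ac qp rho0 rho1 sp sq.
have WO x : (~` K) x -> (~` (chart_inv c @` cdisc p (Num.sqrt (sqdist p q)))) x.
  by move=> Kx [z /pK hz e]; apply: Kx; rewrite -e.
have hS : harmonic_on (~` K) S by apply: mharm_harmonic_on => x /WO /S1.
have [H [hH HS]] : exists H : M -> R, harmonic_on [set: M] H /\ forall x, (~` K) x -> H x = S x.
  apply: rK => //; exists 1 => x /WO /S2 /andP[h1 h2]; by rewrite ger0_norm.
set A := 4 / _ in S3.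
have dd0 : 0 < sqdist p q by exact: sqdist_gt0.
have A0 : 0 < A.
  by rewrite /A divr_gt0// mulr_gt0 ?exprn_gt0// invr_gt0 !(mulr_gt0, addr_gt0, exprn_gt0).
have qq : cdisc q rho q by exact/odisc_cdisc/odisc_center.
have [x0 cx0 xq] := sq q qq.
pose k := H \o chart_inv c.
have hk : harmonic_at k q.
  by rewrite -xq; apply: harmonic_on_mharm hH _ _ Ac cx0 => //; exact: openT.
have ck : {for q, continuous k} by exact: harmonic_at_continuous hk.
have hb := harmonic_barrier q qp.
have bq : barrier p q q = 0 by rewrite barrierE// sqdistxx; ring.
have NO : nbhs q (odisc q rho) by apply: odisc_nbhs; exact: odisc_center.
(* The extension is known only on the complement of [K]. That complement has points arbitrarily
   close to [q], and all information on [k] is drawn from such points. *)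
have key (P : set plane) : nbhs q P -> exists z, [/\ P z, z != q, z != p,
    sqdist p q <= sqdist p z &
    [/\ 0 <= k z, fourth_root q z - A * barrier p q z <= k z &
       forall t, 0 < t -> k z <= t + trap_coef p q rho t * barrier p q z]].
  move=> Pq; have [z [[Pz oz] iz Kz]] := closure_chart Ac (sq q qq) qW (filterI Pq NO).
  have [y cy yz] := iz; have e : chart_inv c z = y by rewrite -yz chart_invK.
  rewrite e in Kz; have Oy := WO y Kz.
  have h := S3 y Oy cy; rewrite yz in h; have [h1 h2] := h oz.
  have kz : k z = S y by rewrite /k /= e HS.
  have zp : sqdist p q < sqdist p z.
    rewrite ltNge; apply/negP => h3; apply: Oy; exists z => //.
    by rewrite /cdisc /= sqr_sqrtr ?sqdist_ge0.
  exists z; rewrite kz; split => //; last by split => //; have /andP[] := S2 y Oy.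
  - by apply/eqP => e1; rewrite e1 ltxx in zp.
  - by apply/eqP => e1; rewrite e1 sqdistxx ltNge sqdist_ge0 in zp.
  - exact: ltW.
have k0 : k q = 0.
  apply/eqP; rewrite -normr_le0; apply/ler_addgt0Pr => e e0; rewrite add0r.
  pose t := e / 3; have t0 : 0 < t by rewrite divr_gt0.
  have N1 : \forall z \near q, `|k z - k q| <= t by move: ck => /cvgr_distC_le; apply.
  have cb : trap_coef p q rho t * barrier p q z @[z --> q] --> trap_coef p q rho t * barrier p q q.
    exact: harmonic_at_continuous (harmonic_atZ _ hb).
  have N2 : \forall z \near q, trap_coef p q rho t * barrier p q z <= t.
    by move: cb; rewrite bq mulr0 => /cvgr_le; apply.
  have [z [[h1 h2] _ _ _ [h3 _ h4]]] := key _ (filterI N1 N2).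
  have := h4 t t0; move: h1; rewrite !ler_norml => /andP[h5 h6] h7.
  have e3 : e = 3 * t by rewrite /t; field.
  by apply/andP; split; lra.
have [g [kk [[Hg _] _]]] := hk.
have [C C0 NC] := has_partials_lipschitz Hg.
(* With E = |z - q|^(1/2), the lower bound and the Lipschitz bound give E <= D E^2. This is
   impossible for E below 1 / (D + 1), which [N3] ensures. *)
pose D := C + A / Num.sqrt (sqdist p q).
have s0 : 0 < Num.sqrt (sqdist p q) by rewrite sqrtr_gt0.
have D0 : 0 <= D by rewrite addr_ge0// divr_ge0// ltW.
have N3 : \forall z \near q, sqdist q z < ((D + 1)^-1) ^+ 4.
  have := @sqdist_continuous _ q q; rewrite /continuous_at sqdistxx => /cvgr_lt; apply.
  by rewrite exprn_gt0// invr_gt0; lra.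
have [z [[h1 h2] zq zp pz [_ h3 _]]] := key _ (filterI NC N3).
pose E := fourth_root q z; have E0 : 0 < E := fourth_root_gt0 q z.
have E4 : sqdist q z = (E ^+ 2) ^+ 2 by rewrite -exprM fourth_rootX.
have nz : `|z - q| <= E ^+ 2.
  by rewrite -(ler_pXn2r (n := 2)) ?nnegrE ?sqr_ge0// -E4; exact: norm_sqdist.
have bz : barrier p q z <= E ^+ 2 / Num.sqrt (sqdist p q).
  have [bn|bp] := leP (barrier p q z) 0; first by rewrite (le_trans bn)// divr_ge0 ?sqr_ge0// ltW.
  rewrite -(ler_pXn2r (n := 2)) ?nnegrE ?divr_ge0 ?sqr_ge0 ?(ltW bp) ?(ltW s0)//.
  apply: (le_trans (barrier_sqr_le q zp)); rewrite exprMn exprVn -E4 sqr_sqrtr ?sqdist_ge0//.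
  rewrite ler_wpM2l ?sqdist_ge0// lef_pV2 ?posrE//; exact: sqdist_gt0.
have E1 : E < (D + 1)^-1.
  rewrite -(ltr_pXn2r (n := 4)) ?nnegrE ?(ltW E0)// ?invr_ge0; last by lra.
  by rewrite fourth_rootX.
have kz : k z <= C * E ^+ 2.
  rewrite k0 subr0 in h1; apply: (le_trans (ler_norm _)); apply: (le_trans h1).
  by rewrite ler_wpM2l.
have ED : E <= D * E ^+ 2.
  have : A * barrier p q z <= A * (E ^+ 2 / Num.sqrt (sqdist p q)) by rewrite ler_pM2l.
  rewrite -/E in h3; rewrite /D mulrDl (_ : A / _ * _ = A * (E ^+ 2 / Num.sqrt (sqdist p q))); last by field; rewrite gt_eqF.
  lra.
have : 1 <= D * E by rewrite -(ler_pM2r E0) mul1r -mulrA -expr2.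
have : E * (D + 1) < 1 by rewrite -ltr_pdivlMr ?div1r//; lra.
by lra.
Qed.

(** If the closure of the complement were not everything, connectedness would give it a boundary
    point. From a point [p] outside it, close to that boundary point, the nearest point q' of the
    closure is taken; the disc about [p] through q' touches the closure at q' and lies in [K]. *)
Lemma removable_dense (K : set M) : connected [set: M] -> removable K -> ~` K !=set0 ->
  forall x, closure (~` K) x.
Proof.
move=> cM rK W0; set W := ~` K in W0 *.
have oW : open W by apply: closed_openC; case: rK.
apply: contrapT => nW; have {}nW : closure W <> setT by move=> e; apply: nW => x; rewrite e.
have [q qW nq] : exists2 q, closure W q & ~ nbhs q (closure W).
  apply: contrapT => H; apply: nW; apply: cM.
  - by have [w Ww] := W0; exists w; exact: subset_closure.
  - exists (closure W); last by rewrite setTI.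
    rewrite openE => x cx; apply: contrapT => nx; apply: H; by exists x.
  - by exists (closure W); [exact: closed_closure|rewrite setTI].
have [c Ac cq] := atlas_cover q; set zq := chart_map c q.
have oI : open (chart_map c @` chart_dom c) by have [] := atlas_chart Ac.
have Nq : nbhs zq (chart_map c @` chart_dom c) by apply: open_nbhs_nbhs; split => //; exists q.
have [r r0 sr] := nbhs_odisc Nq.
(* The distance from [p] to its nearest point is then also below r / 4, so the disc about [p] stays
   in the chart disc of radius [r]. *)
have r40 : 0 < r / 4 by rewrite divr_gt0.
have [p hp npW] : exists2 p, odisc zq (r / 4) p & ~ closure W (chart_inv c p).
  apply: contrapT => H; apply: nq; apply: (chart_near_dom Ac cq).
  apply: filterS (odisc_nbhs (odisc_center zq r40)) => z hz.
  by apply: contrapT => nz; apply: H; exists z.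
pose A := cdisc zq r `&` ~` (chart_map c @` (chart_dom c `&` ~` closure W)).
have cA : compact A.
  apply: compact_closedI; first exact: cdisc_compact.
  apply: open_closedC; apply: chart_image_open => //.
  by apply: closed_openC; exact: closed_closure.
have AP z : cdisc zq r z -> (A z <-> closure W (chart_inv c z)).
  move=> hz; have [y cy yz] := sr z hz.
  have e : chart_inv c z = y by rewrite -yz chart_invK.
  rewrite e; split=> [[_ h]|h].
    by apply: contrapT => ny; apply: h; exists y.
  split=> // -[y' [cy' ny'] e']; apply: ny'; rewrite -yz in e'.
  by rewrite -(chart_invK Ac cy') e' chart_invK.
have Azq : A zq.
  by apply/AP; [exact/odisc_cdisc/odisc_center|rewrite /zq chart_invK].
have cs : {within A, continuous (sqdist p)}.
  exact: continuous_subspaceT (@sqdist_continuous _ p).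
have [|q' ] := compact_EVT_min _ cA cs; first by exists zq.
rewrite inE => Aq' Hmin.
have m z : A z -> sqdist p q' <= sqdist p z by move=> Az; apply: Hmin; rewrite inE.
have hp' : sqdist p zq < (r / 4) ^+ 2 by rewrite sqdistC.
have near_p z : sqdist p z <= sqdist p q' -> cdisc zq r z.
  move=> hz; apply: (le_trans (sqdist_triangle zq p z)); rewrite (sqdistC zq p).
  have := m zq Azq; have e : (r / 4) ^+ 2 = r ^+ 2 / 16 by field.
  have : 0 < r ^+ 2 by rewrite exprn_gt0.
  rewrite e in hp'; lra.
have sE : Num.sqrt (sqdist p q') ^+ 2 = sqdist p q' by rewrite sqr_sqrtr ?sqdist_ge0.
have q'W : closure W (chart_inv c q') by apply/AP => //; case: Aq'.
have q'p : q' != p by apply/eqP => e; apply: npW; rewrite -e.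
have inK z : sqdist p z < sqdist p q' -> ~ closure W (chart_inv c z).
  move=> hz /AP-/(_ (near_p z (ltW hz)))/m; by rewrite leNgt hz.
(* A point of the closed disc in the open complement of [K] could be moved slightly towards [p]
   without leaving that complement, and would then be closer to [p] than the nearest point. *)
have pK z : cdisc p (Num.sqrt (sqdist p q')) z -> K (chart_inv c z).
  rewrite /cdisc /= sE => hz; apply: contrapT => nK.
  have [y cy yz] := sr z (near_p z hz).
  have e : chart_inv c z = y by rewrite -yz chart_invK.
  have N : nbhs z (chart_map c @` (chart_dom c `&` W)).
    apply: open_nbhs_nbhs; split; first exact: chart_image_open.
    by exists y => //; split => //; rewrite -e.
  have [d d0 Hd] := near0_norm N.
  have [e1|zp] := eqVneq z p; first by apply: npW; apply: subset_closure; rewrite -e1.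
  have np : 0 < `|p - z| by rewrite normr_gt0 subr_eq0 eq_sym.
  pose t := minr 1 (d / `|p - z| / 2).
  have t0 : 0 < t by rewrite lt_min ltr01 !divr_gt0.
  have t1 : t <= 1 by rewrite ge_min lexx.
  have td : `|t *: (p - z)| < d.
    rewrite normrZ gtr0_norm// -ltr_pdivlMr// (@le_lt_trans _ _ (d / `|p - z| / 2))//.
      by rewrite /t ge_min lexx orbT.
    by rewrite gtr_pMr ?divr_gt0// invf_lt1// ltr1n.
  have [y' [cy' Wy'] e'] := Hd _ td.
  apply: (inK (t *: (p - z) + z)); last first.
    by apply: subset_closure; rewrite -e' chart_invK.
  have -> : sqdist p (t *: (p - z) + z) = (1 - t) ^+ 2 * sqdist p z.
    by rewrite !sqdistE !mxE; ring.
  apply: lt_le_trans hz; rewrite gtr_pMl; last exact: sqdist_gt0.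
  have : 0 <= 1 - t < 1 by apply/andP; split; lra.
  by move=> /andP[h1 h2]; rewrite expr_lt1.
have Nq' : nbhs q' (chart_map c @` chart_dom c).
  by apply: open_nbhs_nbhs; split => //; apply: sr; apply: near_p.
have [r1 r10 sr1] := nbhs_odisc Nq'.
have rho0 : 0 < minr 1 r1 by rewrite lt_min ltr01.
apply: (@removable_touching K c p q' (minr 1 r1)) => //.
- by rewrite ge_min lexx.
- by move=> z; rewrite /cdisc /= sE => /near_p/sr.
- move=> z hz; apply: sr1; apply: le_trans hz _.
  by rewrite ler_pXn2r ?nnegrE ?(ltW rho0) ?(ltW r10)// ge_min lexx orbT.
Qed.

End Density.

(** * 2-convexity of the boundary *)

Section TwoConvexity.
Variable R : realType.
Local Notation plane := 'rV[R]_2.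

Lemma dotC n (u v : 'rV[R]_n) : dot u v = dot v u.
Proof. by apply: eq_bigr => i _; rewrite mulrC. Qed.

Lemma dotDl n (u v w : 'rV[R]_n) : dot (u + v) w = dot u w + dot v w.
Proof. by rewrite /dot -big_split; apply: eq_bigr => i _; rewrite !mxE mulrDl. Qed.

Lemma dotZl n (a : R) (u w : 'rV[R]_n) : dot (a *: u) w = a * dot u w.
Proof. by rewrite /dot mulr_sumr; apply: eq_bigr => i _; rewrite !mxE mulrA. Qed.

Lemma dotDr n (u v w : 'rV[R]_n) : dot w (u + v) = dot w u + dot w v.
Proof. by rewrite !(dotC w) dotDl. Qed.

Lemma dotZr n (a : R) (u w : 'rV[R]_n) : dot w (a *: u) = a * dot w u.
Proof. by rewrite !(dotC w) dotZl. Qed.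

Lemma dot_ge0 n (u : 'rV[R]_n) : 0 <= dot u u.
Proof. by apply: sumr_ge0 => i _; rewrite -expr2 sqr_ge0. Qed.

Lemma dot_eq0 n (u : 'rV[R]_n) : dot u u = 0 -> u = 0.
Proof.
move=> h; apply/rowP => i; rewrite mxE; apply/eqP; rewrite -sqrf_eq0 expr2.
have H : forall j, true -> 0 <= u 0 j * u 0 j by move=> j _; rewrite -expr2 sqr_ge0.
by apply/eqP; exact: (psumr_eq0P H h (i:=i) isT).
Qed.

Lemma dot_gt0 n (u : 'rV[R]_n) : u != 0 -> 0 < dot u u.
Proof.
move=> u0; rewrite lt_neqAle dot_ge0 andbT eq_sym.
by apply/eqP => /dot_eq0/eqP; exact/negP.
Qed.

Definition bform n (A : 'I_n -> 'I_n -> R) (u v : 'rV[R]_n) : R :=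
  \sum_k u 0 k * \sum_l v 0 l * A k l.

Lemma bformDl n A (u v w : 'rV[R]_n) : bform A (u + v) w = bform A u w + bform A v w.
Proof. by rewrite /bform -big_split; apply: eq_bigr => i _; rewrite !mxE mulrDl. Qed.

Lemma bformZl n A (a : R) (u w : 'rV[R]_n) : bform A (a *: u) w = a * bform A u w.
Proof. by rewrite /bform mulr_sumr; apply: eq_bigr => i _; rewrite !mxE mulrA. Qed.

Lemma bformDr n A (u v w : 'rV[R]_n) : bform A w (u + v) = bform A w u + bform A w v.
Proof.
rewrite /bform -big_split; apply: eq_bigr => i _ /=; rewrite -mulrDr -big_split; congr (_ * _).
by apply: eq_bigr => j _; rewrite !mxE mulrDl.
Qed.

Lemma bformZr n A (a : R) (u w : 'rV[R]_n) : bform A w (a *: u) = a * bform A w u.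
Proof.
rewrite /bform mulr_sumr; apply: eq_bigr => i _; rewrite mulrCA; congr (_ * _).
by rewrite mulr_sumr; apply: eq_bigr => j _; rewrite !mxE mulrA.
Qed.

Definition conformal_pair n (u v : 'rV[R]_n) : Prop := dot u u = dot v v /\ dot u v = 0.

Lemma composition_laplacian n (G : 'rV[R]_n -> R) (f : plane -> 'rV[R]_n) z dG ddG df ddf :
  has_partials2 G (f z) dG ddG ->
  (forall k, has_partials2 (fun y => f y 0 k) z (df k) (ddf k)) ->
  exists g h, [/\ has_partials2 (fun y => G (f y)) z g h,
    (forall i, g i z = \sum_k df k i z * dG k (f z)) &
    (forall i j, h i j z = \sum_k ddf k i j z * dG k (f z) +
       bform (fun k l => ddG k l (f z)) (\row_k df k i z) (\row_k df k j z))].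
Proof.
move=> HG Hf; eexists; eexists; split; [exact: has_partials2_comp HG Hf|by []|].
move=> i j; rewrite /= big_split /=; congr (_ + _).
apply: eq_bigr => k _; rewrite mxE; congr (_ * _).
by apply: eq_bigr => l _; rewrite mxE.
Qed.

(** Dividing both vectors by their common length gives an orthonormal basis of a plane, and the
    trace scales by a positive factor. *)
Lemma psh_pair n (D : set 'rV[R]_n) rho x (u v : 'rV[R]_n) :
  strongly_2_plurisubharmonic D rho -> D x -> u != 0 -> conformal_pair u v ->
  0 < bform (fun k l => partial l (partial k rho) x) u u +
      bform (fun k l => partial l (partial k rho) x) v v.
Proof.
move=> [_ H] Dx u0 [uv uv0]; set A := fun _ _ => _.
pose s := Num.sqrt (dot u u); have d0 := dot_gt0 u0.
have s0 : 0 < s by rewrite sqrtr_gt0.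
have ss : s ^+ 2 = dot u u by rewrite sqr_sqrtr// ltW.
pose e1 := s^-1 *: u; pose e2 := s^-1 *: v.
have sn : s != 0 by rewrite gt_eqF.
have e11 : dot e1 e1 = 1 by rewrite dotZl dotZr -ss; field.
have e22 : dot e2 e2 = 1 by rewrite dotZl dotZr -uv -ss; field.
have e12 : dot e1 e2 = 0 by rewrite dotZl dotZr uv0 !mulr0.
have fr : free [:: e1; e2].
  have nz w : dot w w = 1 -> w != 0.
    by move=> h; apply/eqP => w0; move: h; rewrite w0 /dot big1 => [/esym/eqP|i _]; rewrite ?oner_eq0// mxE mul0r.
  rewrite free_cons seq1_free span_seq1 nz// andbT.
  apply/negP => /vlineP[k ek]; move: e11; rewrite {2}ek dotZr e12 mulr0 => /esym/eqP.
  by rewrite oner_eq0.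
pose e : 2.-tuple 'rV[R]_n := [tuple e1; e2].
have ob : orthonormal_basis <<e>>%VS e.
  split; first by rewrite basisEfree fr subvv (eqnP fr) /=.
  move=> i j; have [->|->] := I2P i; have [->|->] := I2P j => //=.
    by rewrite /= dotC.
have dim2 : \dim <<e>>%VS = 2%N by rewrite (eqnP fr).
have := H x Dx <<e>>%VS dim2 e ob.
have q w : dot (w *m hessian rho x) w = bform A w w.
  rewrite /dot /bform; apply: eq_bigr => i _; rewrite mxE mulrC; congr (_ * _).
  by apply: eq_bigr => j _; rewrite mxE.
rewrite sum2 !q /= !(bformZl, bformZr) !mulrA -mulrDr pmulr_rgt0//.
by rewrite mulr_gt0// invr_gt0.
Qed.

End TwoConvexity.

(** * Enneper surfaces with prescribed second-order part *)

Section Enneper.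
Variable R : realType.
Local Notation plane := 'rV[R]_2.

(** A general combination of real and imaginary parts of z, z^2 and z^3, the building blocks of the
    coordinates of the surface. *)
Lemma has_partials2_cubic (c0 c1 c2 c3 d0 d1 : R) (z : plane) :
  has_partials2 (fun y : plane => c0 * y 0 0 + c1 * y 0 1 +
      (c2 * (y 0 0 * y 0 0 - y 0 1 * y 0 1) + c3 * (y 0 0 * y 0 1)) +
      (d0 * (y 0 0 * y 0 0 * y 0 0 - 3 * (y 0 0 * y 0 1 * y 0 1)) +
       d1 * (3 * (y 0 0 * y 0 0 * y 0 1) - y 0 1 * y 0 1 * y 0 1))) z
    (fun i y => if i == 0 then c0 + 2 * c2 * y 0 0 + c3 * y 0 1 +
                  3 * d0 * (y 0 0 * y 0 0 - y 0 1 * y 0 1) + 6 * d1 * (y 0 0 * y 0 1)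
                else c1 - 2 * c2 * y 0 1 + c3 * y 0 0 -
                  6 * d0 * (y 0 0 * y 0 1) + 3 * d1 * (y 0 0 * y 0 0 - y 0 1 * y 0 1))
    (fun i j y => if i == j then (-1) ^+ i * (2 * c2 + 6 * d0 * y 0 0 + 6 * d1 * y 0 1)
                  else c3 - 6 * d0 * y 0 1 + 6 * d1 * y 0 0).
Proof.
have X := has_partials2_coord 0 z; have Y := has_partials2_coord 1 z.
have XX := has_partials2M X X; have YY := has_partials2M Y Y; have XY := has_partials2M X Y.
apply: has_partials2_ext (has_partials2D (has_partials2D
  (has_partials2D (has_partials2Z c0 X) (has_partials2Z c1 Y))
  (has_partials2D (has_partials2Z c2 (has_partials2B XX YY)) (has_partials2Z c3 XY)))
  (has_partials2D
   (has_partials2Z d0 (has_partials2B (has_partials2M XX X) (has_partials2Z 3 (has_partials2M XY Y))))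
   (has_partials2Z d1 (has_partials2B (has_partials2Z 3 (has_partials2M XX Y)) (has_partials2M YY Y))))).
- by [].
- by move=> i y; have [->|->] := I2P i; rewrite /=; ring.
- move=> i j y; have [->|->] := I2P i; have [->|->] := I2P j; rewrite /= ?expr0 ?expr1; ring.
Qed.

Lemma dot_combination n (u v w : 'rV[R]_n) (s a b c : R) : dot u u = s -> dot v v = s -> dot w w = s ->
  dot u v = 0 -> dot u w = 0 -> dot v w = 0 -> forall a' b' c' : R,
  dot (a *: u + b *: v + c *: w) (a' *: u + b' *: v + c' *: w) = s * (a * a' + b * b' + c * c').
Proof.
move=> uu vv ww uv uw vw a' b' c'.
rewrite !(dotDl, dotDr, dotZl, dotZr) uu vv ww (dotC v u) (dotC w u) (dotC w v) uv uw vw; ring.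
Qed.

Lemma sum2_not_isotropic (x y x1 x2 y1 y2 : R) : x + y = 2 ->
  x * x + x1 * x1 + x2 * x2 = 0 -> y1 * y1 + y * y + y2 * y2 = 0 -> False.
Proof.
move=> xy hx hy; have := sqr_ge0 x1; have := sqr_ge0 x2; have := sqr_ge0 y1.
have := sqr_ge0 y2; have := sqr_ge0 (x - y); have e : y = 2 - x by lra.
by rewrite e in hy *; lra.
Qed.

(* With k = k1 + i k2, this is Enneper's surface with Weierstrass data
   (s, k z), so that its second fundamental form at 0 is prescribed by k. *)
Lemma enneper_surface n (p u v w : 'rV[R]_n) (s k1 k2 : R) : 0 < s ->
  dot u u = s -> dot v v = s -> dot w w = s -> dot u v = 0 -> dot u w = 0 -> dot v w = 0 ->
  exists (F : plane -> 'rV[R]_n) df ddf, F 0 = p /\ [/\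
    forall z k, has_partials2 (fun y => F y 0 k) z (df k) (ddf k),
    forall z k, ddf k 0 0 z + ddf k 1 1 z = 0,
    forall z, conformal_pair (\row_k df k 0 z) (\row_k df k 1 z) /\ \row_k df k 0 z != 0,
    forall k, df k 0 0 = u 0 k /\ df k 1 0 = v 0 k &
    forall k, [/\ ddf k 0 0 0 = 2 * k1 * w 0 k, ddf k 1 1 0 = - (2 * k1 * w 0 k),
      ddf k 0 1 0 = - (2 * k2 * w 0 k) & ddf k 1 0 0 = - (2 * k2 * w 0 k)]].
Proof.
move=> s0 uu vv ww uv uw vw.
(* q1 + i q2 is the square of k1 + i k2; conformality forces this coefficient on the cubic terms. *)
pose q1 := k1 ^+ 2 - k2 ^+ 2; pose q2 := 2 * k1 * k2.
have Ha := has_partials2_cubic 1 0 0 0 (- q1 / 3) (q2 / 3).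
have Hb := has_partials2_cubic 0 1 0 0 (q2 / 3) (q1 / 3).
have Hc := has_partials2_cubic 0 0 k1 (- 2 * k2) 0 0.
move: Ha Hb Hc.
set a := (X in forall z, has_partials2 X z _ _); set da := fun _ _ => _; set dda := fun _ _ _ => _ => Ha.
set b := (X in forall z, has_partials2 X z _ _); set db := (X in forall z, has_partials2 _ z X _);
 set ddb := (X in forall z, has_partials2 _ z _ X) => Hb.
set c := (X in forall z, has_partials2 X z _ _); set dc := (X in forall z, has_partials2 _ z X _);
 set ddc := (X in forall z, has_partials2 _ z _ X) => Hc.
pose F (z : plane) := \row_k (p 0 k + (u 0 k * a z + v 0 k * b z + w 0 k * c z)).
pose df (k : 'I_n) i z := u 0 k * da i z + v 0 k * db i z + w 0 k * dc i z.
pose ddf (k : 'I_n) i j z := u 0 k * dda i j z + v 0 k * ddb i j z + w 0 k * ddc i j z.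
have rowE i z : \row_k df k i z = da i z *: u + db i z *: v + dc i z *: w.
  by apply/rowP => k; rewrite !mxE /df; ring.
exists F, df, ddf; split; first by apply/rowP => k; rewrite !mxE /a /b /c !mxE; ring.
split.
- move=> z k; apply: has_partials2_ext (has_partials2D (has_partials2_cst (p 0 k) z)
    (has_partials2D (has_partials2D (has_partials2Z (u 0 k) (Ha z)) (has_partials2Z (v 0 k) (Hb z)))
      (has_partials2Z (w 0 k) (Hc z)))) => [y|i y|i j y].
  + by rewrite mxE.
  + by rewrite /df /= add0r.
  + by rewrite /ddf /= add0r.
- by move=> z k; rewrite /ddf /dda /ddb /ddc /= expr0 expr1; ring.
- move=> z; have D i j : dot (\row_k df k i z) (\row_k df k j z) =
      s * (da i z * da j z + db i z * db j z + dc i z * dc j z).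
    by rewrite !rowE (dot_combination _ _ _ uu vv ww uv uw vw).
  have cp : conformal_pair (\row_k df k 0 z) (\row_k df k 1 z).
    by rewrite /conformal_pair !D /da /db /dc /q1 /q2 /=; split; field.
  split => //; apply/eqP => e.
  have n0 : dot (\row_k df k 0 z) (\row_k df k 0 z) = 0.
    by rewrite e /dot big1 // => i _; rewrite mxE mul0r.
  have n1 := n0; have [cp1 _] := cp; rewrite cp1 in n1.
  have sn : s != 0 by rewrite gt_eqF.
  move: n0 n1; rewrite !D => /eqP; rewrite mulf_eq0 (negbTE sn) => /eqP n0.
  move=> /eqP; rewrite mulf_eq0 (negbTE sn) => /eqP n1.
  (* The quadratic terms cancel in this sum. It therefore never vanishes, which excludes a common
     zero of both partial derivatives, hence a branch point. *)
  have e2 : da 0 z + db 1 z = 2 by rewrite /da /db /=; ring.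
  exact: sum2_not_isotropic e2 n0 n1.
- by move=> k; rewrite /df /da /db /dc /= !mxE; split; ring.
- by move=> k; rewrite /ddf /dda /ddb /ddc /= !mxE !expr0 !expr1; split; ring.
Qed.

End Enneper.

(** * Nonnegative tangential trace at boundary points *)

Section TangentialTrace.
Variable R : realType.
Local Notation plane := 'rV[R]_2.

Lemma quadratic_negative (c x y a b d : R) : 0 < c -> `|a + c| <= c / 4 -> `|d + c| <= c / 4 ->
  `|b| <= c / 2 -> 0 < x ^+ 2 + y ^+ 2 -> x ^+ 2 * a + x * y * b + y ^+ 2 * d < 0.
Proof.
move=> c0 /ler_normlP[_ ha] /ler_normlP[_ hd] hb xy.
have x0 := sqr_ge0 x; have y0 := sqr_ge0 y.
have h1 : x * y * b <= (x ^+ 2 + y ^+ 2) / 2 * (c / 2).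
  apply: (le_trans (ler_norm _)); rewrite normrM; apply: ler_pM => //.
  rewrite ler_norml; have := sqr_ge0 (x + y); have := sqr_ge0 (x - y).
  by rewrite !expr2 => *; apply/andP; split; lra.
have h2 : x ^+ 2 * a <= x ^+ 2 * (- (3 / 4) * c) by apply: ler_wpM2l => //; lra.
have h3 : y ^+ 2 * d <= y ^+ 2 * (- (3 / 4) * c) by apply: ler_wpM2l => //; lra.
have h4 : 0 < (x ^+ 2 + y ^+ 2) * c by exact: mulr_gt0.
move: h1 h2 h3 h4; set X := x ^+ 2; set Y := y ^+ 2; set P := x * y * b; set A := X * a; set B := Y * d.
have -> : X * (- (3 / 4) * c) = - (3 / 4) * (X * c) by ring.
have -> : Y * (- (3 / 4) * c) = - (3 / 4) * (Y * c) by ring.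
have -> : (X + Y) / 2 * (c / 2) = (X * c + Y * c) / 4 by field.
by rewrite mulrDl; lra.
Qed.

Lemma has_partials2_continuous m (f : 'rV[R]_m -> R) x g h i j : has_partials2 f x g h ->
  {for x, continuous (h i j)}.
Proof. by move=> [_ H]; have [_] := nbhs_singleton (H i) j. Qed.

(** The symmetrized Hessian at 0 is -c times the identity. Keeping every entry within c / 4 of its
    value at 0 leaves the quadratic remainder negative. *)
Lemma strict_max_near0 (G : plane -> R) dG ddG c : has_partials2 G 0 dG ddG ->
  G 0 = 0 -> (forall i, dG i 0 = 0) -> 0 < c ->
  ddG 0 0 0 = - c -> ddG 1 1 0 = - c -> ddG 0 1 0 + ddG 1 0 0 = 0 ->
  \forall z \near (0 : plane), z != 0 -> G z < 0.
Proof.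
move=> H G0 dG0 c0 h00 h11 h01.
have c4 : 0 < c / 4 by lra.
have N : \forall z \near (0 : plane), forall i j, `|ddG i j 0 - ddG i j z| <= c / 4.
  apply: (@filter_forall _ _ (fun i z => forall j, `|ddG i j 0 - ddG i j z| <= c / 4) (nbhs (0 : plane))) => i.
  apply: (@filter_forall _ _ (fun j z => `|ddG i j 0 - ddG i j z| <= c / 4) (nbhs (0 : plane))) => j.
  have K : {for 0, continuous (ddG i j)} by exact: has_partials2_continuous H.
  by have /(@cvgrPdist_le _ _ _ (nbhs (0 : plane))) := K; apply.
have [d d0 Hd] := near0_norm (filterI (has_partials2_near H) N).
apply/nbhs_ballP; exists d => // z; rewrite -ball_normE /ball_ /= sub0r normrN => zd z0.
have sm (t : R) : 0 <= t <= 1 -> `|t *: z| < d.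
  by move=> /andP[t0 t1]; rewrite normrZ ger0_norm// (le_lt_trans _ zd)// ler_piMl.
have T (t : R) : 0 <= t <= 1 -> has_partials2 G (t *: z + 0) dG ddG.
  by move=> /sm/Hd[].
have [t [s [/andP[t0 t1] /andP[s0 s1]]]] := ray_taylor2 T.
rewrite !addr0 G0 !sum2 !dG0 !mulr0 addr0 !subr0 => ->.
have /Hd[_] : `|s *: z| < d by apply: sm; rewrite !ltW.
rewrite addr0 => E; rewrite pmulr_rlt0//.
have -> : z 0 0 * (z 0 0 * ddG 0 0 (s *: z) + z 0 1 * ddG 0 1 (s *: z)) +
  z 0 1 * (z 0 0 * ddG 1 0 (s *: z) + z 0 1 * ddG 1 1 (s *: z)) =
  z 0 0 ^+ 2 * ddG 0 0 (s *: z) + z 0 0 * z 0 1 * (ddG 0 1 (s *: z) + ddG 1 0 (s *: z)) +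
  z 0 1 ^+ 2 * ddG 1 1 (s *: z) by ring.
apply: (quadratic_negative c0).
- by have := E 0 0; rewrite h00 -normrN opprB opprK.
- by have := E 1 1; rewrite h11 -normrN opprB opprK.
- have -> : ddG 0 1 (s *: z) + ddG 1 0 (s *: z) =
    - ((ddG 0 1 0 - ddG 0 1 (s *: z)) + (ddG 1 0 0 - ddG 1 0 (s *: z))) by lra.
  rewrite normrN (le_trans (ler_normD _ _))//; have := E 0 1; have := E 1 0; lra.
- by have := sqdist_gt0 z0; rewrite sqdistE !mxE !subr0.
Qed.

(* The discs F - t N have their boundaries in a fixed compact subset of D, so
   by the maximum principle they stay in a fixed sublevel set of rho. *)
Lemma psh_disc_closed n (D : set 'rV[R]_n) rho (F : plane -> 'rV[R]_n) df ddf (N : 'rV[R]_n) e t0 :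
  open D -> strongly_2_plurisubharmonic D rho -> exhaustion D rho ->
  (forall z k, has_partials2 (fun y => F y 0 k) z (df k) (ddf k)) ->
  (forall z k, ddf k 0 0 z + ddf k 1 1 z = 0) ->
  (forall z, conformal_pair (\row_k df k 0 z) (\row_k df k 1 z) /\ \row_k df k 0 z != 0) ->
  0 < t0 ->
  (forall z t, cdisc 0 e z -> 0 <= t <= t0 -> 0 < t \/ sqdist 0 z = e ^+ 2 -> D (F z - t *: N)) ->
  D (F 0).
Proof.
move=> oD psh ex HF LF CF t00 HD; have [rC2 _] := psh.
have Fc z : {for z, continuous F}.
  exact: (has_partials_row_continuous (fun k => proj1 (HF z k))).
have rc x : D x -> {for x, continuous rho}.
  by move=> Dx; apply: has_partials_continuous (class_C2_partials oD rC2 Dx).1.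
pose S := [set z : plane | sqdist 0 z = e ^+ 2].
have cS : compact S.
  apply: (subclosed_compact _ (@cdisc_compact R 0 e)); last by move=> z; exact: circle_cdisc.
  apply: (@closed_comp _ _ (sqdist 0) [set t | t = e ^+ 2]); last exact: closed_eq.
  by move=> z _; exact: sqdist_continuous.
pose Phi (q : plane * R) := rho (F q.1 - q.2 *: N).
have Phic z t : D (F z - t *: N) -> {for (z, t), continuous Phi}.
  move=> Dz; apply: (@continuous_comp _ _ _ (fun q : plane * R => F q.1 - q.2 *: N) rho); last exact: rc.
  apply: (@cvgB _ _ _ (nbhs (z, t)) _ (fun q : plane * R => F q.1) (fun q => q.2 *: N)).
    apply: (@continuous_comp _ _ _ (@fst plane R) F); [exact: cvg_fst|exact: Fc].
  by apply: cvgZr_tmp; exact: cvg_snd.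
have [m Hm] : exists m, forall z t, S z -> 0 <= t <= t0 -> Phi (z, t) <= m.
  have cK : compact (S `*` `[0%R, t0]) by apply: compact_setX => //; exact: segment_compact.
  have [[z1 Sz1]|S0] := pselect (S !=set0); last by exists 0 => z t Sz; case: S0; exists z.
  have K0 : (S `*` `[0%R, t0]) !=set0 by exists (z1, 0); split => //=; rewrite in_itv /= lexx ltW.
  have KPhi : {within S `*` `[0%R, t0], continuous Phi}.
    apply: continuous_in_subspaceT => -[z t]; rewrite inE => -[/= Sz]; rewrite in_itv /= => tt.
    by apply: Phic; apply: HD => //; [exact: circle_cdisc|right].
  have [q _ Hq] := compact_EVT_max K0 cK KPhi.
  exists (Phi q) => z t Sz tt; apply: Hq; rewrite inE; split => //=; by rewrite in_itv.
have Hr t : 0 < t <= t0 -> rho (F 0 - t *: N) <= m.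
  move=> /andP[tp tt]; have DF z : cdisc 0 e z -> D (F z - t *: N).
    by move=> h; apply: HD => //; [rewrite ltW|left].
  have L z : cdisc 0 e z -> exists g h, has_partials2 (fun y => rho (F y - t *: N) - m) z g h /\
      0 <= h 0 0 z + h 1 1 z.
    move=> /DF Dz; have Hrho := class_C2_partials oD rC2 Dz.
    have HFt k : has_partials2 (fun y => (F y - t *: N) 0 k) z (df k) (ddf k).
      have := has_partials2D (HF z k) (has_partials2_cst (- (t * N 0 k)) z).
      by apply: has_partials2_ext => [y|i y|i j y]; rewrite ?mxE /= ?addr0// !mxE.
    have [g [h [Hgh _ hE]]] := composition_laplacian Hrho HFt.
    eexists; eexists; split; first exact: has_partials2B Hgh (has_partials2_cst m z).
    rewrite /= !subr0 !hE addrACA -big_split big1 /= => [|k _]; last by rewrite -mulrDl LF mul0r.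
    by have [cp nz] := CF z; rewrite add0r; exact: ltW (psh_pair psh Dz nz cp).
  rewrite -subr_le0; apply: (max_principle (A := cdisc 0 e) (u := fun z => rho (F z - t *: N) - m)).
  - exact: cdisc_compact.
  - apply: continuous_in_subspaceT => z; rewrite inE => /L[g [h [[Hg _] _]]].
    exact: has_partials_continuous Hg.
  - move=> z Az; have [Sz|Sz] := eqVneq (sqdist 0 z) (e ^+ 2).
      by left; rewrite subr_le0; apply: (Hm z t) => //; rewrite tt ltW.
    right; split; first by apply: filterS (@odisc_cdisc _ 0 e) (odisc_nbhs _); rewrite /odisc /= lt_neqAle Sz.
    by have [g [h [Hg Lz]]] := L z Az; exact: vsub_C2 Hg Lz.
  - by rewrite /cdisc /= sqdistxx sqr_ge0.
(* The sublevel set is compact in the ambient space, hence closed there. The limit of the centres as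
   t decreases to 0 lies in it, and so in [D]. *)
have clm : closed [set x | D x /\ rho x <= m] by apply: compact_closed; [exact: norm_hausdorff|exact: ex].
suff [//] : [set x | D x /\ rho x <= m] (F 0).
have ct : F 0 - t *: N @[t --> (0 : R)] --> F 0.
  rewrite -[X in _ --> X]subr0 -[X in _ - X](scale0r N).
  apply: (@cvgB _ _ _ (nbhs (0 : R)) _ (fun=> F 0) (fun t : R => t *: N)); first exact: cvg_cst.
  by apply: cvgZr_tmp; exact: cvg_id.
apply: (@closed_cvg _ _ (0 : R)^'+ _ (fun t : R => F 0 - t *: N) _ clm _ _ (cvg_at_right_filter ct)).
near=> t; have tt : 0 < t <= t0 by apply/andP; split; near: t; [exact: nbhs_right_gt|exact: nbhs_right_le].
split; last exact: Hr.
have /andP[tp tl] := tt.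
by apply: HD; rewrite ?tl ?(ltW tp)//; [rewrite /cdisc /= sqdistxx sqr_ge0|left].
Unshelve. all: by end_near.
Qed.

Lemma bform_sum0 n (A : 'I_n -> 'I_n -> R) : bform A 0 0 = 0.
Proof. by rewrite /bform big1// => i _; rewrite mxE mul0r. Qed.

Lemma dot_sum n (u : 'rV[R]_n) (a : 'I_n -> R) : \sum_i u 0 i * a i = dot u (\row_i a i).
Proof. by apply: eq_bigr => i _; rewrite mxE. Qed.

Lemma tangential_trace n (D U : set 'rV[R]_n) rho (g : 'rV[R]_n -> R) p (u v : 'rV[R]_n) :
  open D -> strongly_2_plurisubharmonic D rho -> exhaustion D rho ->
  open U -> class_Ck 2 U g -> D `&` U = [set x | U x /\ g x < 0] -> U p -> g p = 0 ->
  (exists i, partial i g p != 0) -> conformal_pair u v ->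
  \sum_i u 0 i * partial i g p = 0 -> \sum_i v 0 i * partial i g p = 0 ->
  0 <= bform (fun k l => partial l (partial k g) p) u u +
       bform (fun k l => partial l (partial k g) p) v v.
Proof.
move=> oD psh ex oU gC2 DU Up gp [i0 gi0] [uv uv0] uN vN.
set H := fun _ _ => _; rewrite leNgt; apply/negP => neg.
have nDp : ~ D p.
  move=> Dp; have : (D `&` U) p by split.
  by rewrite DU /= gp => -[_]; rewrite ltxx.
pose N : 'rV[R]_n := \row_i partial i g p.
have Hg y : U y -> has_partials2 g y (fun i => partial i g) (fun i j => partial j (partial i g)).
  exact: class_C2_partials.
move: uN vN; rewrite !dot_sum -/N => uN vN.
have N0 : N != 0 by apply/eqP => /rowP/(_ i0); rewrite !mxE => e; move: gi0; rewrite e eqxx.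
have NN := dot_gt0 N0.
have u0 : u != 0.
  apply/eqP => e; move: uv neg; rewrite e {1}/dot big1 => [/esym/dot_eq0 ->|i _]; last by rewrite mxE mul0r.
  by rewrite bform_sum0 addr0 ltxx.
have s0 := dot_gt0 u0; set s := dot u u in uv s0.
pose a := Num.sqrt (s / dot N N); pose w := a *: N.
have a0 : 0 < a by rewrite sqrtr_gt0 divr_gt0.
have aa : a * a = s / dot N N by rewrite -expr2 sqr_sqrtr// ltW// divr_gt0.
have ww : dot w w = s by rewrite dotZl dotZr mulrA aa divfK// gt_eqF.
have uw : dot u w = 0 by rewrite dotZr uN mulr0.
have vw : dot v w = 0 by rewrite dotZr vN mulr0.
pose m := dot w N; have m0 : 0 < m by rewrite /m dotZl mulr_gt0.
have mn : m != 0 by rewrite gt_eqF.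
(* The Hessian of g o F at 0 has diagonal entries H(u,u) + 2 k1 m and H(v,v) - 2 k1 m, and mixed
   entries with sum H(u,v) + H(v,u) - 4 k2 m. These values of [k1] and [k2] make the diagonal
   entries equal, to half the negative trace, and the mixed sum zero. *)
pose k1 := (bform H v v - bform H u u) / (4 * m); pose k2 := (bform H u v + bform H v u) / (4 * m).
have [F [df [ddf [F0 [HF LF CF dF0 ddF0]]]]] :=
  enneper_surface p k1 k2 s0 (erefl s) (esym uv) ww uv0 uw vw.
have Fc z : {for z, continuous F}.
  exact: (has_partials_row_continuous (fun k => proj1 (HF z k))).
have r0 : \row_k df k 0 0 = u by apply/rowP => k; rewrite mxE; case: (dF0 k).
have r1 : \row_k df k 1 0 = v by apply/rowP => k; rewrite mxE; case: (dF0 k).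
have Hg0 : has_partials2 g (F 0) (fun i => partial i g) (fun i j => partial j (partial i g)).
  by rewrite F0; exact: Hg.
have [dG [ddG [HG dGE ddGE]]] := composition_laplacian Hg0 (HF 0).
pose c := - (bform H u u + bform H v v) / 2.
have c0 : 0 < c by rewrite /c; lra.
have sw (b : R) : \sum_k b * w 0 k * partial k g p = b * m.
  rewrite /m /dot mulr_sumr; apply: eq_bigr => k _; by rewrite [N _ _]mxE mulrA.
have neg0 : \forall z \near (0 : plane), z != 0 -> g (F z) < 0.
  apply: (strict_max_near0 (c := c) HG).
  - by rewrite F0.
  - move=> i; rewrite dGE F0; transitivity (dot (\row_k df k i 0) N).
      by apply: eq_bigr => k _; rewrite !mxE.
    by have [->|->] := I2P i; rewrite ?r0 ?r1.
  - exact: c0.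
  - rewrite ddGE F0 r0 -/H (eq_bigr (fun k => 2 * k1 * w 0 k * partial k g p)) => [|k _].
      by rewrite sw /c /k1; field.
    by have [-> _ _ _] := ddF0 k.
  - rewrite ddGE F0 r1 -/H (eq_bigr (fun k => - (2 * k1) * w 0 k * partial k g p)) => [|k _].
      by rewrite sw /c /k1; field.
    by have [_ -> _ _] := ddF0 k; rewrite !mulNr.
  - rewrite !ddGE F0 r0 r1 -/H addrACA -big_split /=.
    rewrite (eq_bigr (fun k => - (4 * k2) * w 0 k * partial k g p)) => [|k _].
      by rewrite sw /k2; field.
    by have [_ _ -> ->] := ddF0 k; ring.
have slope0 : 0 < \sum_k N 0 k * partial k g p.
  by rewrite (_ : \sum_k _ = dot N N)// ; apply: eq_bigr => k _; rewrite !mxE.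
have sc : (\sum_k N 0 k * partial k g y) @[y --> p] --> \sum_k N 0 k * partial k g p.
  apply: (@cvg_fin_sum _ _ (nbhs p)) => k.
  have [+ _] := Hg p Up => /nbhs_singleton/(_ k)[_ h].
  exact: (cvgM (cvg_cst _) h).
have sN : \forall y \near p, 0 < \sum_k N 0 k * partial k g y by exact: (cvgr_gt _ sc).
have Un : nbhs p U by apply: open_nbhs_nbhs; split.
have [d d0 Hd] := near0_norm (filterI Un sN).
have Fn : \forall z \near (0 : plane), `|F z - p| < d / 2.
  have d2 : 0 < d / 2 by rewrite divr_gt0.
  by have /(@cvgrPdist_lt _ _ _ (nbhs (0 : plane))) := Fc 0; rewrite F0 => /(_ _ d2); apply: filterS => z; rewrite distrC.
have [e e0 He] := nbhs_odisc (filterI neg0 Fn).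
have en : e != 0 by rewrite gt_eqF.
(* A push by at most [t0] along [N] moves points by less than d / 2, so the pushed discs stay in the
   ball where [g] increases along [N]. *)
pose t0 := d / 2 / (`|N| + 1).
have N1 : 0 < `|N| + 1 by rewrite ltr_wpDl.
have t00 : 0 < t0 by rewrite !divr_gt0.
have FU z t : cdisc 0 e z -> 0 <= t <= t0 -> `|F z - t *: N - p| < d.
  move=> /He[_ /= Fz] /andP[t1 t2]; rewrite addrAC (le_lt_trans (ler_normB _ _))//.
  rewrite normrZ ger0_norm// (splitr d); apply: ltr_leD => //.
  apply: (@le_trans _ _ (t0 * (`|N| + 1))); first by apply: ler_pM => //; rewrite lerDl.
  by rewrite /t0 divfK// gt_eqF.
(* On the disc g o F is negative except at the centre, where it vanishes, and [g] decreases strictly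
   along -N. All pushed discs and the boundary of the unpushed one thus lie in [D], so F 0 = p would
   too. *)
apply: nDp; rewrite -F0; apply: (psh_disc_closed (N := N) (e := e) oD psh ex HF LF CF t00) => z t cz tt tz.
have Uz t' : 0 <= t' <= t0 -> U (F z - t' *: N) /\ 0 < \sum_k N 0 k * partial k g (F z - t' *: N).
  by move=> /(FU _ _ cz)/Hd; rewrite subrK.
have gF : z != 0 -> g (F z) < 0 by move=> z0; case: (He z cz) => h _; exact: h.
suff : (D `&` U) (F z - t *: N) by case.
rewrite DU; split; first by case: (Uz t tt).
have [t1 t2] := andP tt; have [tp|tp] := ltP 0 t; last first.
  have {}tp : t = 0 by apply/eqP; rewrite eq_le tp.
  rewrite tp scale0r subr0; apply: gF; apply/eqP => z0; case: tz; first by rewrite tp ltxx.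
  by rewrite z0 sqdistxx => /esym/eqP; rewrite sqrf_eq0 (negbTE en).
have Hray (s1 : R) : 0 <= s1 <= t -> is_derive (s1 *: (- N) + F z) (- N) g
    (- \sum_k N 0 k * partial k g (F z - s1 *: N)).
  move=> /andP[h1 h2]; rewrite scalerN addrC.
  have [|Us _] := Uz s1; first by rewrite h1 (le_trans h2).
  have [h _] := Hg _ Us.
  have := has_partials_derive (- N) h; rewrite -sumrN.
  by under [in X in is_derive _ _ _ X -> _]eq_bigr do rewrite mxE mulNr.
have [s1 /andP[h1 h2]] := ray_mvt tp Hray.
rewrite scalerN [X in g X - _]addrC => E.
have [_ S] : U (F z - s1 *: N) /\ 0 < \sum_k N 0 k * partial k g (F z - s1 *: N).
  by apply: Uz; rewrite !ltW//; exact: lt_le_trans t2.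
have gz : g (F z) <= 0.
  by have [->|/gF/ltW//] := eqVneq z 0; rewrite F0 gp.
have : t * - \sum_k N 0 k * partial k g (F z - s1 *: N) < 0 by rewrite pmulr_rlt0// oppr_lt0.
rewrite -E subr_lt0 => h; exact: lt_le_trans h gz.
Qed.

End TangentialTrace.

(** * The Hopf lemma *)

Section Hopf.
Variable R : realType.
Local Notation plane := 'rV[R]_2.

Lemma bform_bound n (A : 'I_n -> 'I_n -> R) (C : R) (u v : 'rV[R]_n) :
  (forall k l, `|A k l| <= C) ->
  `|bform A u v| <= C * n%:R * ((dot u u + dot v v) / 2).
Proof.
move=> AC; rewrite /bform.
have H k l : `|u 0 k * (v 0 l * A k l)| <= C * ((u 0 k * u 0 k + v 0 l * v 0 l) / 2).
  rewrite mulrA normrM mulrC; apply: ler_pM => //; rewrite normrM.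
  have := sqr_ge0 (`|u 0 k| - `|v 0 l|); rewrite sqrrB !sqr_normr !expr2 mulr2n; lra.
apply: (@le_trans _ _ (\sum_k \sum_l C * ((u 0 k * u 0 k + v 0 l * v 0 l) / 2))).
  apply: (le_trans (ler_norm_sum _ _ _)); apply: ler_sum => k _.
  rewrite mulr_sumr; apply: (le_trans (ler_norm_sum _ _ _)); apply: ler_sum => l _; exact: H.
under eq_bigr do rewrite -mulr_sumr -mulr_suml big_split sumr_const card_ord /=.
rewrite -mulr_sumr -mulr_suml big_split /= sumr_const card_ord.
by rewrite sumrMnl -mulrnDl -/(dot u u) -/(dot v v) -!mulrA mulr_natl mulrnAl.
Qed.

(* Gram-Schmidt turns X, Y into a conformal pair, at a cost controlled by the
   failure of conformality. *)
Lemma almost_conformal n (A : 'I_n -> 'I_n -> R) (C : R) (N X Y : 'rV[R]_n) :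
  0 <= C -> (forall k l, `|A k l| <= C) ->
  (forall u v, conformal_pair u v -> dot u N = 0 -> dot v N = 0 ->
     0 <= bform A u u + bform A v v) ->
  dot X N = 0 -> dot Y N = 0 ->
  - (4 * (C * n%:R) * (`|dot X X - dot Y Y| + `|dot X Y|)) <= bform A X X + bform A Y Y.
Proof.
move=> C0 AC H; wlog XY : X Y / dot Y Y <= dot X X.
  move=> W XN YN; have [h|/ltW h] := leP (dot Y Y) (dot X X); first exact: W.
  rewrite distrC (dotC X) (addrC (bform A X X)); exact: W.
move=> XN YN; set B := C * n%:R; have Bb u v := bform_bound u v AC; rewrite -/B in Bb.
rewrite (ger0_norm (x := dot X X - dot Y Y)) ?subr_ge0//.
set xx := dot X X in XY *; set yy := dot Y Y in XY *; set xy := dot X Y.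
have xx0 : 0 <= xx by exact: dot_ge0.
have yy0 : 0 <= yy by exact: dot_ge0.
have B0 : 0 <= B by rewrite mulr_ge0.
have xxB : `|bform A X X| <= B * xx by have := Bb X X; rewrite -/xx; lra.
have yyB : `|bform A Y Y| <= B * yy by have := Bb Y Y; rewrite -/yy; lra.
set e := _ + `|xy|.
(* When |X|^2 is at most twice the defect, the crude bound on the form suffices. Otherwise the
   orthogonalized vector is nonzero and can be rescaled. *)
have [big|small] := leP xx (2 * e).
  have h1 : B * yy <= B * xx by exact: ler_wpM2l.
  have h2 : B * xx <= B * (2 * e) by exact: ler_wpM2l.
  move: xxB yyB => /ler_normlP[a _] /ler_normlP[b _].
  by have -> : 4 * B * e = B * (2 * e) + B * (2 * e) by [ring]; lra.
have e0 : 0 <= e by rewrite addr_ge0// subr_ge0.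
have x0 : 0 < xx by lra.
have xn : xx != 0 by rewrite gt_eqF.
pose mu := xy / xx; pose Y1 := Y + (- mu) *: X; pose q := xy ^+ 2 / xx.
have XY1 : dot X Y1 = 0 by rewrite /Y1 dotDr dotZr -/xy -/xx /mu; field.
have y1E : dot Y1 Y1 = yy - q.
  by rewrite /Y1 !(dotDl, dotDr) !(dotZl, dotZr) (dotC Y X) -/xy -/xx -/yy /mu /q; field.
have xye : `|xy| <= e by rewrite /e lerDr subr_ge0.
have q0 : 0 <= q by rewrite divr_ge0// sqr_ge0.
have qxy : q <= `|xy|.
  rewrite /q -sqr_normr ler_pdivrMr// expr2 ler_wpM2l//; lra.
have xq : xx - (yy - q) <= e by rewrite /e; lra.
have y10 : 0 < yy - q by lra.
(* Rescales the orthogonalized vector to the length of [X]; the price is proportional to the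
   defect. *)
pose la := Num.sqrt (xx / (yy - q)).
have la2 : la * la = xx / (yy - q) by rewrite -expr2 sqr_sqrtr// ltW// divr_gt0.
have Y1N : dot Y1 N = 0 by rewrite /Y1 dotDl -scaleNr dotZl XN YN mulr0 addr0.
have cp : conformal_pair X (la *: Y1).
  by split; rewrite !dotZr ?XY1 ?mulr0// dotZl y1E mulrA la2 divfK// gt_eqF.
have := H _ _ cp XN; rewrite dotZl Y1N mulr0 bformZl bformZr mulrA la2 => /(_ erefl) main.
have YE : Y = Y1 + mu *: X by rewrite /Y1 scaleNr subrK.
have bY : bform A Y Y = bform A Y1 Y1 + mu * (bform A Y1 X + bform A X Y1) + mu ^+ 2 * bform A X X.
  by rewrite {1 2}YE !(bformDl, bformDr, bformZl, bformZr); ring.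
have y1B : `|bform A Y1 Y1| <= B * (yy - q) by have := Bb Y1 Y1; rewrite y1E; lra.
have t1 : (xx / (yy - q) - 1) * bform A Y1 Y1 <= B * e.
  have l1 : 0 <= xx / (yy - q) - 1 by rewrite subr_ge0 ler_pdivlMr// mul1r; lra.
  apply: (@le_trans _ _ ((xx / (yy - q) - 1) * (B * (yy - q)))).
    by apply: ler_wpM2l => //; apply: le_trans y1B; exact: ler_norm.
  have -> : (xx / (yy - q) - 1) * (B * (yy - q)) = B * (xx - (yy - q)).
    by field; rewrite gt_eqF.
  exact: ler_wpM2l.
have t2 : - (B * (2 * `|xy|)) <= mu * (bform A Y1 X + bform A X Y1).
  rewrite lerNl; apply: (le_trans (ler_norm _)); rewrite normrN normrM.
  have -> : B * (2 * `|xy|) = `|mu| * (B * (2 * xx)).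
    by rewrite /mu normrM normfV (gtr0_norm x0); field.
  apply: ler_wpM2l => //; apply: (le_trans (ler_normD _ _)).
  have h1 := Bb Y1 X; have h2 := Bb X Y1; rewrite y1E -/xx in h1 h2.
  have h3 : B * ((yy - q + xx) / 2) <= B * xx by apply: ler_wpM2l => //; lra.
  have h4 : B * ((xx + (yy - q)) / 2) <= B * xx by apply: ler_wpM2l => //; lra.
  by have -> : B * (2 * xx) = B * xx + B * xx by [ring]; lra.
have t3 : - (B * `|xy|) <= mu ^+ 2 * bform A X X.
  rewrite lerNl; apply: (le_trans (ler_norm _)); rewrite normrN normrM (ger0_norm (sqr_ge0 _)).
  apply: (@le_trans _ _ (mu ^+ 2 * (B * xx))); first by apply: ler_wpM2l => //; exact: sqr_ge0.
  have -> : mu ^+ 2 * (B * xx) = B * q by rewrite /mu /q; field.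
  exact: ler_wpM2l.
have t4 : B * `|xy| <= B * e by exact: ler_wpM2l.
have -> : 4 * B * e = B * e + (B * e + B * e + B * e) by ring.
have {}t2 : - (B * `|xy| + B * `|xy|) <= mu * (bform A Y1 X + bform A X Y1).
  by rewrite (_ : _ + _ = B * (2 * `|xy|))//; ring.
rewrite mulrBl mul1r in t1.
by rewrite bY; lra.
Qed.


End Hopf.

(** * Pushing a conformal harmonic map in a transverse direction *)

Section HopfBarrier.
Variable R : realType.
Local Notation plane := 'rV[R]_2.

Lemma compact_superlevel (T : topologicalType) (K : set T) (F : T -> R) :
  closed K -> compact K -> (forall x, K x -> {for x, continuous F}) ->
  compact [set x | K x /\ 0 <= F x].
Proof.
move=> clK cK cF; apply: (subclosed_compact _ cK) => [x cx|x []//].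
have Kx : K x by apply: clK => V /cx[y [[Ky _] Vy]]; exists y.
split => //; rewrite leNgt; apply/negP => Fx.
have N : \forall y \near x, F y < 0 by exact: (cvgr_lt _ (cF x Kx)).
by have [y [[_ h1] h2]] := cx _ N; move: h1; rewrite leNgt h2.
Qed.

Lemma gaussian_partials2 (a z : plane) (al ka : R) :
  has_partials2 (fun y => expR (- al * sqdist a y) - ka) z
    (fun i y => - (2 * al * (y 0 i - a 0 i)) * expR (- al * sqdist a y))
    (fun i j y => (4 * al ^+ 2 * (y 0 i - a 0 i) * (y 0 j - a 0 j) - 2 * al * (j == i)%:R) *
       expR (- al * sqdist a y)).
Proof.
have E : \forall s \near - al * sqdist a z, is_derive (s : R) (1 : R) (@expR R) (expR s) /\
    is_derive (s : R) (1 : R) (@expR R) (expR s) /\ {for s, continuous (@expR R)}.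
  by near=> s; split; [|split]; [exact: is_derive_expR|exact: is_derive_expR|exact: continuous_expR].
have H := has_partials2_comp1 E (has_partials2Z (- al) (has_partials2_sqdist a z)).
apply: has_partials2_ext (has_partials2B H (has_partials2_cst ka z)) => [y|i y|i j y] //=; ring.
Unshelve. all: by end_near.
Qed.

Variables (n : nat) (D W : set 'rV[R]_n) (rho g : 'rV[R]_n -> R).
Hypotheses (oD : open D) (psh : strongly_2_plurisubharmonic D rho) (ex : exhaustion D rho).
Hypotheses (oW : open W) (gC2 : class_Ck 2 W g) (DW : D `&` W = [set x | W x /\ g x < 0]).
Variables (p e : 'rV[R]_n) (d c0 C1 : R).
Hypotheses (d0 : 0 < d) (c00 : 0 < c0) (C10 : 0 <= C1) (ee : dot e e = 1) (e1 : `|e| <= 1).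
Hypothesis box : forall y, `|y - p| < d -> [/\ W y, c0 <= \sum_k e 0 k * partial k g y &
  forall k l, `|partial l (partial k g) y| <= C1].

Lemma shift_near y t : `|y - p| < d / 2 -> `|t| <= d / 4 -> `|y + t *: e - p| < d.
Proof.
move=> yp td; rewrite addrAC (le_lt_trans (ler_normD _ _))// normrZ.
have : `|t| * `|e| <= d / 4 * 1 by exact: ler_pM.
by have := d0; move: yp; set a := `|y - p|; set b := `|t| * `|e|; lra.
Qed.

Lemma shift_mvt y t1 t2 : `|y - p| < d / 2 -> - (d / 4) <= t1 -> t1 < t2 -> t2 <= d / 4 ->
  exists2 y', `|y' - p| < d &
    g (y + t2 *: e) - g (y + t1 *: e) = (t2 - t1) * \sum_k e 0 k * partial k g y'.
Proof.
move=> yp h1 h12 h2; have t0 : 0 < t2 - t1 by rewrite subr_gt0.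
have near_t (s : R) : 0 <= s <= t2 - t1 -> `|y + (s + t1) *: e - p| < d.
  by move=> /andP[s0 s1]; apply: shift_near => //; rewrite ler_norml; apply/andP; split; lra.
have H (s : R) : 0 <= s <= t2 - t1 -> is_derive (s *: e + (y + t1 *: e)) e g
    (\sum_k e 0 k * partial k g (y + (s + t1) *: e)).
  move=> /near_t/box[Wy _ _]; rewrite [s *: e + _]addrCA -scalerDl.
  by have [h _] := class_C2_partials oW gC2 Wy; exact: has_partials_derive h.
have [s /andP[s0 s1]] := ray_mvt t0 H.
rewrite addrCA -scalerDl subrK => E; exists (y + (s + t1) *: e) => //.
by apply: near_t; rewrite !ltW.
Qed.

Lemma shift_rise y t1 t2 : `|y - p| < d / 2 -> - (d / 4) <= t1 -> t1 < t2 -> t2 <= d / 4 ->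
  g (y + t1 *: e) + c0 * (t2 - t1) <= g (y + t2 *: e).
Proof.
move=> yp h1 h12 h2; have [y' /box[_ cy _] E] := shift_mvt yp h1 h12 h2.
by rewrite addrC -lerBrDr E mulrC ler_pM2l// subr_gt0.
Qed.

Variables (A : set plane) (f : plane -> 'rV[R]_n) (df : 'I_n -> 'I_2 -> plane -> R)
  (ddf : 'I_n -> 'I_2 -> 'I_2 -> plane -> R) (L : R).
Hypotheses (cA : compact A) (L0 : 0 <= L).
Hypothesis fA : forall z, A z -> [/\ `|f z - p| < d / 2, g (f z) <= 0,
  forall k, has_partials2 (fun y => f y 0 k) z (df k) (ddf k) /\ ddf k 0 0 z + ddf k 1 1 z = 0,
  conformal_pair (\row_k df k 0 z) (\row_k df k 1 z) &
  forall i, `|dot (\row_k df k i z) e| <= L].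
Variables (w : plane -> R) (dw : 'I_2 -> plane -> R) (ddw : 'I_2 -> 'I_2 -> plane -> R).
Hypothesis Hw : forall z, A z -> has_partials2 w z dw ddw.
Hypothesis w0 : forall z, A z -> 0 <= w z <= d / 8.

(* The largest s for which contact_height (z, s) vanishes for some z measures
   how far f + w e protrudes from D; there f + (w - s) e touches bD from
   inside. *)
Definition contact_height (q : plane * R) : R := g (f q.1 + (w q.1 - q.2) *: e).

Lemma contact_height_continuous z s : A z -> 0 <= s <= d / 4 ->
  {for (z, s), continuous contact_height}.
Proof.
move=> Az /andP[s0 s1]; have [fz _ Hf _ _] := fA Az.
have fc : {for z, continuous f} by exact: (has_partials_row_continuous (fun k => proj1 (proj1 (Hf k)))).
have wc : {for z, continuous w} by have [h _] := Hw Az; exact: has_partials_continuous h.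
apply: (@continuous_comp _ _ _ (fun q : plane * R => f q.1 + (w q.1 - q.2) *: e) g); last first.
  have /box[Wy _ _] : `|f z + (w z - s) *: e - p| < d.
    by apply: shift_near => //; have := w0 Az; rewrite ler_norml => /andP[h1 h2]; apply/andP; split; have := d0; lra.
  have [h _] := class_C2_partials oW gC2 Wy; exact: has_partials_continuous h.
apply: (@cvgD _ _ _ (nbhs (z, s)) _ (fun q : plane * R => f q.1) (fun q => (w q.1 - q.2) *: e)).
  by apply: (@continuous_comp _ _ _ (@fst plane R) f); [exact: cvg_fst|exact: fc].
apply: cvgZr_tmp; apply: (@cvgB _ _ _ (nbhs (z, s)) _ (fun q : plane * R => w q.1) (fun q => q.2)).
  by apply: (@continuous_comp _ _ _ (@fst plane R) w); [exact: cvg_fst|exact: wc].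
exact: cvg_snd.
Qed.

(** The largest [s] exists by compactness. It is at most [w z] because g (f z) <= 0 and [g] rises
    along [e]; hence s < d / 4, and a positive contact height at level [s] would persist for a
    larger [s]. Positivity of [s] comes from the protruding point [z1]. *)
Lemma max_contact z1 : A z1 -> 0 < g (f z1 + w z1 *: e) ->
  exists z s, [/\ A z, 0 < s <= w z, contact_height (z, s) = 0 &
    forall y, A y -> contact_height (y, s) <= 0].
Proof.
move=> Az1 pos1; pose K := A `*` `[0%R, d / 4]; have d40 : 0 <= d / 4 by have := d0; lra.
have cK : compact K by apply: compact_setX => //; exact: segment_compact.
have KE z s : K (z, s) <-> A z /\ 0 <= s <= d / 4 by rewrite /K /= in_itv.
have cH q : K q -> {for q, continuous contact_height}.
  by case: q => z s /KE[Az sd]; exact: contact_height_continuous.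
have clK : closed K by apply: compact_closed => //; exact: norm_hausdorff.
have cS := compact_superlevel clK cK cH.
set S := [set _ | _] in cS.
have S1 : S (z1, 0) by split; [apply/KE; rewrite lexx d40|rewrite /contact_height /= subr0 ltW].
have S0 : S !=set0 by exists (z1, 0).
have csnd : {within S, continuous (@snd plane R)} by apply: continuous_subspaceT => q; exact: cvg_snd.
have [[z s]] := compact_EVT_max S0 cS csnd; rewrite inE => -[/KE[Az /andP[s0 sd]] Hz] max.
have sw t : 0 <= t <= d / 4 -> 0 <= contact_height (z, t) -> t <= w z.
  move=> /andP[t0 t1] Ht; rewrite leNgt; apply/negP => tw; have [fz gz _ _ _] := fA Az.
  have /andP[wz0 wz1] := w0 Az.
  have := @shift_rise (f z) (w z - t) 0 fz; rewrite scale0r addr0.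
  move=> /(_ _ _ d40) h; have {h} : g (f z + (w z - t) *: e) + c0 * (0 - (w z - t)) <= g (f z).
    by apply: h; lra.
  have : 0 < c0 * (0 - (w z - t)) by rewrite mulr_gt0// sub0r oppr_gt0 subr_lt0.
  by move: Ht gz; rewrite /contact_height /=; lra.
have nonpos y : A y -> contact_height (y, s) <= 0.
  move=> Ay; rewrite leNgt; apply/negP => Hy.
  have sd' : s < d / 4.
    by have /andP[_ h] := w0 Az; have := sw s; rewrite s0 sd => /(_ isT Hz); have := d0; lra.
  have cs : contact_height (y, t) @[t --> s] --> contact_height (y, s).
    apply: (@continuous_comp _ _ _ (fun t : R => (y, t)) contact_height s); last first.
      by apply: contact_height_continuous; rewrite ?s0.
    by apply: (@cvg_pair _ _ _ (nbhs s) (nbhs y) (nbhs s) _ _ _ (fun=> y) id); [exact: cvg_cst|exact: cvg_id].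
  have N : \forall t \near s^'+, [/\ 0 < contact_height (y, t), s < t & t <= d / 4].
    near=> t; split; near: t; [|exact: nbhs_right_gt|exact: nbhs_right_le].
    exact: (cvgr_gt _ (cvg_at_right_filter cs)).
  have [t [h1 h2 h3]] := @filter_ex _ s^'+ _ _ N.
  have St : S (y, t) by split; [apply/KE; rewrite h3 (le_trans s0 (ltW h2))|exact: ltW].
  by have := max (y, t); rewrite inE => /(_ St) /=; rewrite leNgt h2.
exists z, s; split => //.
- rewrite sw ?s0// andbT lt_neqAle s0 andbT; apply/negP => /eqP s00.
  by have := nonpos _ Az1; rewrite -s00 /contact_height /= subr0 leNgt pos1.
- by apply/eqP; rewrite eq_le nonpos.
Unshelve. all: by end_near.
Qed.

(** The terms linear in [a] and [b] are controlled by the components along [e], and the quadratic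
    ones are absorbed since |a| + |b| <= 1. Applied with the partial derivatives of [w], the defect
    is linear in its gradient. *)
Lemma conformal_defect (X Y : 'rV[R]_n) (a b : R) : conformal_pair X Y ->
  `|dot X e| <= L -> `|dot Y e| <= L -> `|a| + `|b| <= 1 ->
  `|dot (X + a *: e) (X + a *: e) - dot (Y + b *: e) (Y + b *: e)| +
    `|dot (X + a *: e) (Y + b *: e)| <= (3 * L + 1) * (`|a| + `|b|).
Proof.
move=> [XY XY0] Xe Ye ab; rewrite !(dotDl, dotDr, dotZl, dotZr) ee XY XY0 (dotC e X) (dotC e Y) !mulr1.
set x := dot X e in Xe *; set y := dot Y e in Ye *.
have M (s t T : R) : `|t| <= T -> `|s * t| <= `|s| * T by move=> tT; rewrite normrM ler_wpM2l.
have h1 : `|dot Y Y + a * x + (a * x + a * a) - (dot Y Y + b * y + (b * y + b * b))| <=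
    2 * (`|a| * L) + 2 * (`|b| * L) + `|a| * `|a| + `|b| * `|b|.
  have /ler_normlP[p1 p2] := M a x L Xe; have /ler_normlP[p3 p4] := M b y L Ye.
  have aa := ger0_norm (sqr_ge0 a); have bb := ger0_norm (sqr_ge0 b).
  rewrite -!normrM -!expr2 aa bb; have := sqr_ge0 a; have := sqr_ge0 b.
  by move=> *; rewrite ler_norml; apply/andP; split; lra.
have h2 : `|0 + b * x + (a * y + a * b)| <= `|b| * L + `|a| * L + `|a| * `|b|.
  rewrite add0r addrA; apply: (le_trans (ler_normD _ _)); apply: lerD; last by rewrite normrM.
  by apply: (le_trans (ler_normD _ _)); apply: lerD; exact: M.
apply: (le_trans (lerD _ _)); first exact: h1.
  by move: h2; congr (_ <= _); congr `|_|; ring.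
have ha : `|a| * `|a| + `|b| * `|b| + `|a| * `|b| <= (`|a| + `|b|) * (`|a| + `|b|).
  by have : 0 <= `|a| * `|b| by [exact: mulr_ge0]; lra.
have hb : (`|a| + `|b|) * (`|a| + `|b|) <= (`|a| + `|b|) * 1 by apply: ler_wpM2l.
by lra.
Qed.

(** At the extreme contact g o F has a local maximum, so its gradient vanishes and the partial
    derivatives of F are tangential. Its Laplacian is at least c0 times that of [w] minus the cost
    of the conformal defect, hence positive by the last alternative: a contradiction. The other two
    alternatives exclude contact on the boundary of [A]. *)
Lemma barrier_nonpos :
  (forall z, A z -> [\/ w z = 0, g (f z + w z *: e) <= 0 |
     [/\ nbhs z A, `|dw 0 z| + `|dw 1 z| <= 1 &
      4 * (C1 * n%:R) * ((3 * L + 1) * (`|dw 0 z| + `|dw 1 z|)) < c0 * (ddw 0 0 z + ddw 1 1 z)]]) ->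
  forall z, A z -> g (f z + w z *: e) <= 0.
Proof.
move=> alt z1 Az1; rewrite leNgt; apply/negP => pos1.
have [z [s [Az /andP[s0 sw] Hz max]]] := max_contact Az1 pos1.
have [fz gz Hf cf Le] := fA Az; have /andP[wz0 wz1] := w0 Az; have dd := d0.
case: (alt z Az) => [wz|gw|[Nz S1 Lap]]; first by move: sw s0; rewrite wz; lra.
  have : g (f z + (w z - s) *: e) + c0 * (w z - (w z - s)) <= g (f z + w z *: e).
    by apply: shift_rise => //; lra.
  have gs : g (f z + (w z - s) *: e) = 0 := Hz.
  rewrite subKr gs add0r; have : 0 < c0 * s by exact: mulr_gt0.
  by lra.
set q := f z + (w z - s) *: e.
have [|Wq gq Hq] := @box q.
  by apply: shift_near => //; rewrite ler_norml; apply/andP; split; lra.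
pose F y := f y + (w y - s) *: e.
have HF k : has_partials2 (fun y => F y 0 k) z (fun i y => df k i y + dw i y * e 0 k)
    (fun i j y => ddf k i j y + ddw i j y * e 0 k).
  have := has_partials2D (Hf k).1 (has_partials2Z (e 0 k) (has_partials2B (Hw Az) (has_partials2_cst s z))).
  apply: has_partials2_ext => [y|i y|i j y] /=; rewrite ?subr0 1?[e 0 k * _]mulrC //.
  by rewrite /F !mxE.
have Hg := class_C2_partials oW gC2 Wq.
have [dG [ddG [HG dGE ddGE]]] := composition_laplacian (f := F) Hg HF.
have lmax : \forall y \near z, g (F y) <= g (F z).
  apply: filterS Nz => y Ay; rewrite (Hz : g (F z) = 0); exact: max.
have H0 i := local_max_partials HG lmax i.
pose N := \row_k partial k g q.
have rowE i : \row_k (df k i z + dw i z * e 0 k) = \row_k df k i z + dw i z *: e.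
  by apply/rowP => k; rewrite !mxE.
have tan i : dot (\row_k df k i z + dw i z *: e) N = 0.
  rewrite -rowE; have [<- _] := H0 i; rewrite dGE; apply: eq_bigr => k _; rewrite !mxE; reflexivity.
have bound : - (4 * (C1 * n%:R) * ((3 * L + 1) * (`|dw 0 z| + `|dw 1 z|))) <=
   bform (fun k l => partial l (partial k g) q) (\row_k df k 0 z + dw 0 z *: e) (\row_k df k 0 z + dw 0 z *: e) +
   bform (fun k l => partial l (partial k g) q) (\row_k df k 1 z + dw 1 z *: e) (\row_k df k 1 z + dw 1 z *: e).
  apply: (le_trans _ (almost_conformal (N := N) C10 Hq _ (tan 0) (tan 1))).
    rewrite lerN2; apply: ler_wpM2l; first by rewrite !mulr_ge0.
    exact: conformal_defect.
  move=> u v uv uN vN; apply: (tangential_trace oD psh ex oW gC2 DW Wq) => //.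
  - apply: contrapT => nz; move: gq; rewrite big1 ?leNgt ?c00// => k _.
    apply/eqP; rewrite mulf_eq0; apply/orP; right; apply/negPn/negP => h; by apply: nz; exists k.
  - by apply: etrans uN; apply: eq_bigr => k _; rewrite mxE.
  - by apply: etrans vN; apply: eq_bigr => k _; rewrite mxE.
have S0 : 0 <= 4 * (C1 * n%:R) * ((3 * L + 1) * (`|dw 0 z| + `|dw 1 z|)).
  by rewrite !mulr_ge0// addr_ge0// mulr_ge0.
have Lp : 0 < ddw 0 0 z + ddw 1 1 z by rewrite -(pmulr_rgt0 _ c00); exact: le_lt_trans Lap.
have [_ l0] := H0 0; have [_ l1] := H0 1.
have : ddG 0 0 z + ddG 1 1 z = (ddw 0 0 z + ddw 1 1 z) * (\sum_k e 0 k * partial k g q) +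
   (bform (fun k l => partial l (partial k g) q) (\row_k df k 0 z + dw 0 z *: e) (\row_k df k 0 z + dw 0 z *: e) +
   bform (fun k l => partial l (partial k g) q) (\row_k df k 1 z + dw 1 z *: e) (\row_k df k 1 z + dw 1 z *: e)).
  rewrite !ddGE !rowE addrACA -big_split /= mulr_sumr; congr (_ + _).
  apply: eq_bigr => k _; rewrite -mulrDl mulrA; congr (_ * _).
  have [_ lf] := Hf k; rewrite addrACA lf add0r mulrDl; reflexivity.
have : (ddw 0 0 z + ddw 1 1 z) * c0 <= (ddw 0 0 z + ddw 1 1 z) * (\sum_k e 0 k * partial k g q).
  by rewrite ler_pM2l.
rewrite [_ * c0]mulrC; move: Lap bound l0 l1.
set t1 := bform _ _ _; set t2 := bform _ _ _; set t3 := _ * (\sum_k _); set t4 := 4 * _ * _.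
by set t5 := ddG _ _ _; set t6 := ddG _ _ _; set t7 := c0 * _; lra.
Qed.

End HopfBarrier.

(** * Hopf's lemma at a contact point on a circle *)

Section HopfDisc.
Variable R : realType.
Local Notation plane := 'rV[R]_2.

Lemma has_partials_ray_le0 m (f : 'rV[R]_m -> R) x v df : has_partials f x df ->
  (forall t, 0 < t <= 1 / 2 -> f (t *: v + x) <= f x) -> \sum_i v 0 i * df i x <= 0.
Proof.
move=> H M; rewrite leNgt; apply/negP; set S := \sum_i _ => S0.
have v1 : 0 < `|v| + 1 by rewrite ltr_wpDl.
pose e := S / (2 * (`|v| + 1)); have e0 : 0 < e by rewrite divr_gt0// mulr_gt0.
have [d d0 Hd] := near0_norm (has_partials_taylor H e0).
pose t := Num.min (1 / 2) (d / (2 * (`|v| + 1))).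
have t0 : 0 < t by rewrite lt_min !divr_gt0// mulr_gt0.
have th : t <= 1 / 2 by rewrite ge_min lexx.
have td : t * (`|v| + 1) <= d / 2.
  have : t <= d / (2 * (`|v| + 1)) by rewrite ge_min lexx orbT.
  rewrite -(ler_pM2r v1) => h; apply: (le_trans h); rewrite le_eqVlt; apply/orP; left; apply/eqP.
  by field; rewrite gt_eqF.
have nv : `|t *: v| = t * `|v| by rewrite normrZ gtr0_norm.
have tv : t * `|v| < t * (`|v| + 1) by rewrite ltr_pM2l// ltrDl.
have /Hd : `|t *: v| < d by rewrite nv; lra.
rewrite addr0 nv => /ler_normlP[h _].
have E : \sum_i (t *: v) 0 i * df i x = t * S.
  by rewrite mulr_sumr; apply: eq_bigr => i _; rewrite mxE mulrA.
rewrite E in h; have := M t; rewrite t0 th => /(_ isT) Mt.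
have e2 : e * (t * (`|v| + 1)) = t * S / 2 by rewrite /e; field; rewrite gt_eqF.
have e3 : e * (t * `|v|) < t * S / 2 by rewrite -e2 ltr_pM2l.
have : 0 < t * S by exact: mulr_gt0.
by lra.
Qed.

Lemma sqr_compl_bound (t : R) : 0 < t -> t <= 1 / 2 -> (2^-1) ^+ 2 <= (1 - t) ^+ 2 <= 1.
Proof.
move=> t0 t1; have -> : 1 = 1 ^+ 2 :> R by rewrite expr1n.
by rewrite !ler_sqr ?nnegrE ?expr1n; lra.
Qed.

Variables (n : nat) (D W : set 'rV[R]_n) (rho g : 'rV[R]_n -> R).
Hypotheses (oD : open D) (psh : strongly_2_plurisubharmonic D rho) (ex : exhaustion D rho).
Hypotheses (oW : open W) (gC2 : class_Ck 2 W g) (DW : D `&` W = [set x | W x /\ g x < 0]).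
Variables (p e : 'rV[R]_n) (d c0 c2 C1 : R).
Hypotheses (d0 : 0 < d) (c00 : 0 < c0) (C10 : 0 <= C1) (ee : dot e e = 1) (e1 : `|e| <= 1).
Hypothesis box : forall y, `|y - p| < d -> [/\ W y,
  c0 <= \sum_k e 0 k * partial k g y, \sum_k e 0 k * partial k g y <= c2 &
  forall k l, `|partial l (partial k g) y| <= C1].
Variables (V : set plane) (f : plane -> 'rV[R]_n) (df : 'I_n -> 'I_2 -> plane -> R)
  (ddf : 'I_n -> 'I_2 -> 'I_2 -> plane -> R) (L : R).
Hypothesis L0 : 0 <= L.
Hypothesis fV : forall z, V z -> [/\ `|f z - p| < d / 2, g (f z) <= 0,
  forall k, has_partials2 (fun y => f y 0 k) z (df k) (ddf k) /\ ddf k 0 0 z + ddf k 1 1 z = 0,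
  conformal_pair (\row_k df k 0 z) (\row_k df k 1 z) &
  forall i, `|dot (\row_k df k i z) e| <= L].

(** On the annulus between radii r / 2 and r, a Gaussian barrier [w] vanishing on the outer circle
    keeps g (f + w e) <= 0, with equality at [zs]. The gradient of g o f at [zs] is zero, yet [w]
    grows inwards at a positive rate, so g (f + w e) would become positive along the segment from
    [zs] towards [z1]. *)
Lemma hopf_disc (z1 zs : plane) (r : R) : 0 < r -> cdisc z1 r `<=` V -> nbhs zs V ->
  sqdist z1 zs = r ^+ 2 -> g (f zs) = 0 -> (forall z, sqdist z1 z < r ^+ 2 -> g (f z) < 0) -> False.
Proof.
move=> r0 rV Vs zs_r gzs inner; have dd := d0.
have r2 : 0 < r ^+ 2 by rewrite exprn_gt0.
have box' y : `|y - p| < d -> [/\ W y, c0 <= \sum_k e 0 k * partial k g y &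
  forall k l, `|partial l (partial k g) y| <= C1] by move=> /box[].
have gc z : V z -> {for z, continuous (fun y => g (f y))}.
  move=> /fV[fz _ Hf _ _]; have [|Wy _ _ _] := @box (f z); first by move: fz; lra.
  have [h _] := class_C2_partials oW gC2 Wy.
  exact: has_partials_continuous (has_partials_comp h (fun k => proj1 (proj1 (Hf k)))).
pose A := [set z : plane | (r / 2) ^+ 2 <= sqdist z1 z <= r ^+ 2].
have AV z : A z -> V z by move=> /andP[_ h]; exact: rV.
have cA : compact A.
  apply: (subclosed_compact _ (@cdisc_compact R z1 r)); last by move=> z /andP[].
  apply: (@closed_comp _ _ (sqdist z1) (`[(r / 2) ^+ 2, r ^+ 2]%classic)).
    by move=> z _; exact: sqdist_continuous.
  exact: interval_closed.
have [eta eta0 Heta] : exists2 eta, 0 < eta & forall z, sqdist z1 z = (r / 2) ^+ 2 -> g (f z) <= - eta.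
  pose S := [set z | sqdist z1 z = (r / 2) ^+ 2].
  have Sr z : S z -> sqdist z1 z < r ^+ 2 by rewrite /S /= => ->; lra.
  have [S0|S0] := pselect (S !=set0); last by exists 1 => // z Sz; case: S0; exists z.
  have cS : compact S.
    apply: (subclosed_compact _ (@cdisc_compact R z1 r)); last by move=> z /Sr/ltW.
    apply: (@closed_comp _ _ (sqdist z1) [set t | t = (r / 2) ^+ 2]); last exact: closed_eq.
    by move=> z _; exact: sqdist_continuous.
  have cg : {within S, continuous (fun y => g (f y))}.
    by apply: continuous_in_subspaceT => z; rewrite inE => /Sr/ltW h; apply: gc; exact: rV.
  have [z2 Sz2 max] := compact_EVT_max S0 cS cg; rewrite inE in Sz2.
  exists (- g (f z2)); first by rewrite oppr_gt0; apply: inner; exact: Sr.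
  by move=> z Sz; rewrite opprK; apply: max; rewrite inE.
have c20 : 0 < c2.
  have [h _ _ _ _] := fV (nbhs_singleton Vs); have [|_ h1 h2 _] := @box (f zs); first by move: h; lra.
  by apply: lt_le_trans c00 _; exact: le_trans h1 h2.
(* One factor 4 is the constant of [almost_conformal], the other comes from the gradient bound 4 al
   r for the Gaussian, up to the factor eps E. *)
pose K := 16 * (C1 * n%:R) * (3 * L + 1).
have L1 : 0 < 3 * L + 1 by have := L0; lra.
have K0 : 0 <= K by rewrite !mulr_ge0// ltW.
have cr0 : 0 < c0 * r ^+ 2 by exact: mulr_gt0.
(* At distance at least r / 2 from the centre, c0 times the Laplacian is at least al (al c0 r^2 - 4
   c0) eps E. This choice makes it exceed the defect al K r eps E. *)
have [al al0 alE] : exists2 al, 0 < al & al * (c0 * r ^+ 2) = K * r + 4 * c0 + 1.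
  exists ((K * r + 4 * c0 + 1) / (c0 * r ^+ 2)); last by rewrite divfK// gt_eqF.
  by rewrite divr_gt0// ltr_wpDl// addr_ge0// ?mulr_ge0// ltW.
have alr : 0 < 4 * al * r by rewrite !mulr_gt0.
(* The three bounds on [eps] keep the push within d / 8, the gradient of [w] at most 1, and the rise
   of [g] on the inner circle below the room [eta] available there. *)
have [eps [eps0 epsd eps1 eps2]] : exists eps,
    [/\ 0 < eps, eps <= d / 8, eps * (4 * al * r) <= 1 & eps * c2 <= eta].
  exists (Num.min (d / 8) (Num.min (1 / (4 * al * r)) (eta / c2))); split.
  - by rewrite !lt_min !divr_gt0.
  - by rewrite ge_min lexx.
  - by rewrite -ler_pdivlMr// !ge_min lexx !orbT.
  - by rewrite -ler_pdivlMr// !ge_min lexx !orbT.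
pose E z := expR (- al * sqdist z1 z).
have E0 z : 0 < E z by exact: expR_gt0.
have E1 z : E z <= 1 by rewrite -expR0 ler_expR mulNr oppr_le0 mulr_ge0 ?sqdist_ge0// ltW.
pose ka := expR (- al * r ^+ 2).
have ka0 : 0 < ka by exact: expR_gt0.
have G z := has_partials2Z eps (gaussian_partials2 z1 z al ka).
set w := fun y => eps * _ in G.
set dw := fun i y => eps * _ in G.
set ddw := fun i j y => eps * _ in G.
have w_d z : A z -> 0 <= w z <= eps.
  move=> /andP[_ h]; apply/andP; split.
    by rewrite mulr_ge0 ?subr_ge0 ?ler_expR ?ler_wnM2l// ?oppr_le0// ltW.
  by rewrite /w ger_pMr//; have := E1 z; rewrite /E; lra.
have w_d8 z : A z -> 0 <= w z <= d / 8 by move=> /w_d/andP[-> h]; exact: le_trans epsd.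
have dwE z : cdisc z1 r z -> `|dw 0 z| + `|dw 1 z| <= 4 * al * r * (eps * E z).
  move=> h; have co i : `|z 0 i - z1 0 i| <= r.
    rewrite -(ler_pXn2r (n := 2)) ?nnegrE ?(ltW r0)// sqr_normr; apply: le_trans h.
    rewrite sqdistE; have := sqr_ge0 (z 0 0 - z1 0 0); have := sqr_ge0 (z 0 1 - z1 0 1).
    by have [->|->] := I2P i; lra.
  have b i : `|dw i z| <= 2 * al * r * (eps * E z).
    rewrite /dw -/(E z) !normrM normrN !normrM (gtr0_norm eps0) (gtr0_norm al0) (gtr0_norm (E0 z)) normr_nat.
    rewrite mulrCA; apply: ler_wpM2r; first by rewrite mulr_ge0 // ltW.
    by apply: ler_wpM2l => //; rewrite mulr_ge0// ltW.
  by have := b 0; have := b 1; lra.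
have lapE z : ddw 0 0 z + ddw 1 1 z = (4 * al ^+ 2 * sqdist z1 z - 4 * al) * (eps * E z).
  by rewrite /ddw -/(E z) sqdistE /=; ring.
have key : forall z, A z -> g (f z + w z *: e) <= 0.
  apply: (barrier_nonpos oD psh ex oW gC2 DW d0 c00 C10 ee e1 box' cA L0 (fun z Az => fV (AV z Az)) (fun z Az => G z) w_d8) => z Az.
  have /andP[Az1 Az2] := Az; have Vz := AV z Az; have [fz gz _ _ _] := fV Vz.
  have [zr|zr] := eqVneq (sqdist z1 z) (r ^+ 2).
    by constructor 1; rewrite /w zr subrr mulr0.
  have [zr2|zr2] := eqVneq (sqdist z1 z) ((r / 2) ^+ 2).
    constructor 2; have := Heta _ zr2; have /andP[wz0 wz1] := w_d z Az.
    have [->|wn] := eqVneq (w z) 0; first by rewrite scale0r addr0.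
    have wp : 0 < w z by rewrite lt_neqAle eq_sym wn.
    have [||||y /box[_ _ cy _] Ey] := shift_mvt oW gC2 d0 e1 box' (y := f z) (t1 := 0) (t2 := w z) => //; try lra.
    move: Ey; rewrite scale0r addr0 subr0 => Ey Hz.
    have : w z * (\sum_k e 0 k * partial k g y) <= eps * c2.
      apply: (@le_trans _ _ (w z * c2)); first by rewrite ler_pM2l.
      by apply: ler_wpM2r => //; exact: ltW.
    by rewrite -Ey; lra.
  constructor 3.
  have Nz : nbhs z A.
    have N1 : \forall y \near z, (r / 2) ^+ 2 < sqdist z1 y.
      by apply: (cvgr_gt _ (@sqdist_continuous R z1 z)); rewrite lt_neqAle eq_sym zr2.
    have N2 : \forall y \near z, sqdist z1 y < r ^+ 2.
      by apply: (cvgr_lt _ (@sqdist_continuous R z1 z)); rewrite lt_neqAle zr.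
    by apply: filterS2 N1 N2 => y h1 h2; rewrite /A /= (ltW h1) (ltW h2).
  split => //.
    apply: (le_trans (dwE z Az2)); apply: le_trans eps1; rewrite mulrC ler_wpM2r// ?(ltW alr)//.
    by rewrite ger_pMr.
  have X0 : 0 < eps * E z by exact: mulr_gt0.
  apply: (@le_lt_trans _ _ (al * (K * r) * (eps * E z))).
    have -> : al * (K * r) * (eps * E z) = 4 * (C1 * n%:R) * ((3 * L + 1) * (4 * al * r * (eps * E z))).
      by rewrite /K; ring.
    by do 2 (apply: ler_wpM2l; first by rewrite ?mulr_ge0// ltW); exact: dwE.
  rewrite lapE [X in _ < X]mulrA ltr_pM2r//.
  apply: (@lt_le_trans _ _ (c0 * (4 * al ^+ 2 * (r / 2) ^+ 2 - 4 * al))).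
    have -> : c0 * (4 * al ^+ 2 * (r / 2) ^+ 2 - 4 * al) = al * (al * (c0 * r ^+ 2) - 4 * c0) by field.
    by rewrite ltr_pM2l// alE; lra.
  by rewrite ler_pM2l// lerB// ler_pM2l// mulr_gt0// exprn_gt0.
have Azs : A zs by rewrite /A /= zs_r lexx; apply/andP; split => //; lra.
have [fzs _ Hf _ _] := fV (nbhs_singleton Vs).
have [|Wzs cz _ _] := @box (f zs); first by move: fzs; lra.
have Hg := class_C2_partials oW gC2 Wzs.
have [dG [ddG [HG dGE _]]] := composition_laplacian Hg (fun k => proj1 (Hf k)).
(* g o f is nonpositive on a full neighbourhood of [zs] and vanishes at [zs], so [zs] is an interior
   maximum. *)
have tang i : dG i zs = 0.
  apply: (local_max_partials HG _ i).1; apply: filterS Vs => z /fV[_ h _ _ _]; by rewrite gzs.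
pose F y := f y + w y *: e.
have HF k : has_partials (fun y => F y 0 k) zs (fun i y => df k i y + dw i y * e 0 k).
  have := has_partialsD (Hf k).1.1 (has_partialsZ (e 0 k) (G zs).1).
  by apply: has_partials_eq => [|i]; apply: near_eq_all => y; rewrite ?mxE //= mulrC// !mxE.
have wzs : w zs = 0 by rewrite /w zs_r subrr mulr0.
have Fzs : F zs = f zs by rewrite /F wzs scale0r addr0.
have Hg' : has_partials g (F zs) (fun k => partial k g) by rewrite Fzs; exact: Hg.1.
have : \sum_i (z1 - zs) 0 i * \sum_k (df k i zs + dw i zs * e 0 k) * partial k g (F zs) <= 0.
  apply: (has_partials_ray_le0 (has_partials_comp Hg' HF)) => t /andP[t0 t1].
  rewrite Fzs gzs; apply: key.
  have q : sqdist z1 (t *: (z1 - zs) + zs) = (1 - t) ^+ 2 * r ^+ 2.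
    by rewrite -zs_r !sqdistE !mxE; ring.
  have /andP[t2 t3] := sqr_compl_bound t0 t1.
  rewrite /A /= q exprMn (mulrC (r ^+ 2)) !ler_pM2r// t2 /=.
  by rewrite -[leRHS]mul1r ler_pM2r.
rewrite Fzs (eq_bigr (fun i => (z1 - zs) 0 i * dw i zs * \sum_k e 0 k * partial k g (f zs))) => [|i _].
  rewrite -mulr_suml leNgt pmulr_rgt0; last first.
    rewrite sum2 /dw !mxE -/(E zs).
    have -> : (z1 0 0 - zs 0 0) * (eps * (- (2 * al * (zs 0 0 - z1 0 0)) * E zs)) +
      (z1 0 1 - zs 0 1) * (eps * (- (2 * al * (zs 0 1 - z1 0 1)) * E zs)) = 2 * al * sqdist z1 zs * (eps * E zs).
      by rewrite sqdistE; ring.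
    by rewrite zs_r !mulr_gt0.
  by rewrite (lt_le_trans c00).
rewrite -mulrA; congr (_ * _).
have := tang i; rewrite dGE => ti.
transitivity (\sum_k df k i zs * partial k g (f zs) + dw i zs * \sum_k e 0 k * partial k g (f zs)).
  by rewrite mulr_sumr -big_split; apply: eq_bigr => k _ /=; rewrite mulrDl mulrA.
by rewrite ti add0r.
Qed.

End HopfDisc.

(** * Openness of the contact set with the boundary *)

Section Contact.
Variable R : realType.
Local Notation plane := 'rV[R]_2.

Lemma class_Ck_le m (V : normedModType R) k l (U : set 'rV[R]_m) (f : 'rV[R]_m -> V) :
  (k <= l)%N -> class_Ck l U f -> class_Ck k U f.
Proof.
move=> kl H s x Ux; have [h1 h2] := H s x Ux; split=> h; first by apply: h1; exact: leq_trans kl.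
by apply: h2; exact: leq_trans kl.
Qed.

(** Within the closure of [D], lying on the boundary becomes the closed inequality 0 <= g, so that
    contact sets are superlevel sets to which compactness applies. *)
Lemma boundary_defining n (D : set 'rV[R]_n) r p : 2 < r -> has_Cr_boundary r D -> bd D p ->
  exists (U : set 'rV[R]_n) (g : 'rV[R]_n -> R), [/\ open U /\ U p, class_Ck 2 U g,
    forall x, U x -> exists i : 'I_n, partial i g x != 0,
    D `&` U = [set x | U x /\ g x < 0] &
    forall x, U x -> closure D x -> g x <= 0 /\ (0 <= g x <-> bd D x)].
Proof.
move=> r2 HB /HB[U [g [oU [gC _] nz DU bU]]]; exists U, g; split => //.
  apply: class_Ck_le gC; rewrite truncn_ge_nat; first exact: ltW.
  by apply: le_trans (ltW r2).
move=> x Ux cx; have bx : bd D x <-> g x = 0.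
  split=> [bx|gx]; first by have : (bd D `&` U) x by []; rewrite bU => -[].
  by have : [set x | U x /\ g x = 0] x by []; rewrite -bU => -[].
have [b|nb] := pselect (bd D x).
  by have /bx gx := b; rewrite gx lexx.
have Dx : D x.
  apply: contrapT => nD; apply: nb; split => // /interior_subset; exact: nD.
have : (D `&` U) x by []; rewrite DU => -[_ gx]; split; first exact: ltW.
by split => [h|/bx]; [move: gx; rewrite ltNge h|move=> e; rewrite e lexx].
Qed.

Lemma ler_sum_term n (F : 'I_n -> R) k : (forall i, 0 <= F i) -> F k <= \sum_i F i.
Proof. by move=> F0; rewrite (bigD1 k)//= lerDl sumr_ge0. Qed.

(** The transverse direction is a signed coordinate vector along which [g] has nonzero derivative.
    Its Euclidean length is 1 and its ambient norm at most 1, and transversality reduces to the sign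
    of one partial derivative. *)
Lemma defining_box n (W : set 'rV[R]_n) (g : 'rV[R]_n -> R) p : open W -> W p -> class_Ck 2 W g ->
  (exists i, partial i g p != 0) ->
  exists e d c0 c2 C1, [/\ 0 < d, 0 < c0, 0 <= C1, dot e e = 1 & `|e| <= 1] /\
    forall y, `|y - p| < d -> [/\ W y,
      c0 <= \sum_k e 0 k * partial k g y, \sum_k e 0 k * partial k g y <= c2 &
      forall k l, `|partial l (partial k g) y| <= C1].
Proof.
move=> oW Wp gC2 [i0 gi0]; have Hg := class_C2_partials oW gC2 Wp.
pose sg := Num.sg (partial i0 g p); pose e : 'rV[R]_n := sg *: delta_mx 0 i0.
have ss : sg * sg = 1 by rewrite -expr2 /sg sqr_sg gi0.
have eE y : \sum_k e 0 k * partial k g y = sg * partial i0 g y.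
  rewrite (bigD1 i0)//= big1 => [|k ki]; last by rewrite !mxE (negbTE ki) andbF mulr0 mul0r.
  by rewrite !mxE !eqxx mulr1 addr0.
pose a := sg * partial i0 g p.
have a0 : 0 < a by rewrite /a /sg -normrEsg normr_gt0.
pose C1 := 1 + \sum_k \sum_l `|partial l (partial k g) p|.
have cs : sg * partial i0 g y @[y --> p] --> a.
  by have [_ h] := nbhs_singleton Hg.1 i0; exact: (cvgM (cvg_cst _) h).
have N1 : \forall y \near p, a / 2 < sg * partial i0 g y by apply: (cvgr_gt _ cs); lra.
have N2 : \forall y \near p, sg * partial i0 g y < 2 * a by apply: (cvgr_lt _ cs); lra.
have N3 : \forall y \near p, forall k l, `|partial l (partial k g) y| <= C1.
  apply: (@filter_forall _ _ (fun k y => forall l, `|partial l (partial k g) y| <= C1) (nbhs p)) => k.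
  apply: (@filter_forall _ _ (fun l y => `|partial l (partial k g) y| <= C1) (nbhs p)) => l.
  have ch : {for p, continuous (partial l (partial k g))} by exact: has_partials2_continuous Hg.
  have : `|partial l (partial k g) y| @[y --> p] --> `|partial l (partial k g) p| by exact: cvg_norm ch.
  move=> cn; have lt : `|partial l (partial k g) p| < C1.
    have h1 := @ler_sum_term n (fun l => `|partial l (partial k g) p|) l (fun=> normr_ge0 _).
    have h2 := @ler_sum_term n (fun k => \sum_l `|partial l (partial k g) p|) k (fun=> sumr_ge0 _ (fun _ _ => normr_ge0 _)).
    by apply: (le_lt_trans (le_trans h1 h2)); rewrite ltrDr.
  by apply: filterS (cvgr_lt _ cn _ lt) => y; exact: ltW.
have Wn : nbhs p W by apply: open_nbhs_nbhs; split.
have [d d0 Hd] := near0_norm (filterI (filterI Wn N3) (filterI N1 N2)).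
exists e, d, (a / 2), (2 * a), C1; split; first split => //.
- by rewrite divr_gt0.
- by rewrite addr_ge0// sumr_ge0// => k _; rewrite sumr_ge0.
- rewrite /e dotZl dotZr mulrA ss mul1r /dot (bigD1 i0)//= big1 => [|k ki].
    by rewrite !mxE !eqxx mulr1 addr0.
  by rewrite !mxE (negbTE ki) andbF mulr0.
- rewrite /e normrZ /sg normr_sg gi0 mul1r; exact: delta_norm.
by move=> y /Hd[]; rewrite subrK => -[Wy Cy] [h1 h2]; split => //; rewrite eE ltW.
Qed.

(** If contact failed at points arbitrarily near [z0], such a point [z1] would have a nearest
    contact point [zs]. The open disc about [z1] through [zs] is then free of contact, which is the
    configuration excluded by [hopf_disc]. *)
Lemma contact_nbhs n (D : set 'rV[R]_n) rho r (U : set plane) (f : plane -> 'rV[R]_n) z0 :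
  open D -> strongly_2_plurisubharmonic D rho -> exhaustion D rho -> 2 < r -> has_Cr_boundary r D ->
  open U -> planar_conformal_harmonic U f -> (forall z, U z -> closure D (f z)) ->
  U z0 -> bd D (f z0) -> nbhs z0 [set z | bd D (f z)].
Proof.
move=> oD psh ex r2 HB oU [[fC2 fL] fconf] fD Uz0 bz0; set p := f z0 in bz0.
have [W [g [[oW Wp] gC2 nz DW sgn]]] := boundary_defining r2 HB bz0.
have [e [d [c0 [c2 [C1 [[d0 c00 C10 ee e1] box]]]]]] := defining_box oW Wp gC2 (nz p Wp).
pose df (k : 'I_n) (i : 'I_2) z := partial i f z 0 k.
pose ddf (k : 'I_n) (i j : 'I_2) z := partial j (partial i f) z 0 k.
have Hf z k : U z -> has_partials2 (fun y => f y 0 k) z (df k) (ddf k).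
  by move=> Uz; exact: (class_C2_row k oU fC2 Uz).
have rowE i z : \row_k df k i z = partial i f z by apply/rowP => k; rewrite mxE.
pose L := 1 + \sum_i `|dot (partial i f z0) e|.
have L0 : 0 <= L by rewrite addr_ge0// sumr_ge0.
have d2 : 0 < d / 2 by rewrite divr_gt0.
have d2d : d / 2 < d by rewrite ltr_pdivrMr// ltr_pMr// ltr1n.
have fc z : U z -> {for z, continuous f}.
  by move=> Uz; exact: (has_partials_row_continuous (fun k => proj1 (Hf z k Uz))).
have N1 : \forall z \near z0, `|f z - p| < d / 2.
  by have /(@cvgrPdist_lt _ _ _ (nbhs z0)) := fc z0 Uz0; move=> /(_ _ d2); apply: filterS => z; rewrite distrC.
have N2 : \forall z \near z0, forall i, `|dot (\row_k df k i z) e| <= L.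
  apply: (@filter_forall _ _ (fun i z => `|dot (\row_k df k i z) e| <= L) (nbhs z0)) => i.
  have cd : \sum_k (\row_k df k i z) 0 k * e 0 k @[z --> z0] --> \sum_k (\row_k df k i z0) 0 k * e 0 k.
    apply: (@cvg_fin_sum _ _ (nbhs z0)) => k.
    have [_ h] := nbhs_singleton (Hf z0 k Uz0).1 i.
    under eq_fun do rewrite mxE; rewrite mxE.
    exact: (cvgM h (cvg_cst _)).
  have lt : `|dot (\row_k df k i z0) e| < L.
    have h1 := @ler_sum_term 2 (fun i => `|dot (partial i f z0) e|) i (fun=> normr_ge0 _).
    by rewrite rowE; apply: (le_lt_trans h1); rewrite ltrDr.
  by apply: filterS (cvgr_lt _ (cvg_norm cd) _ lt) => z; exact: ltW.
have Un : nbhs z0 U by apply: open_nbhs_nbhs; split.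
have [r0 r00 Hr] := nbhs_odisc (filterI Un (filterI N1 N2)).
pose V := cdisc z0 r0.
have fV z : V z -> [/\ `|f z - p| < d / 2, g (f z) <= 0,
    forall k, has_partials2 (fun y => f y 0 k) z (df k) (ddf k) /\ ddf k 0 0 z + ddf k 1 1 z = 0,
    conformal_pair (\row_k df k 0 z) (\row_k df k 1 z) &
    forall i, `|dot (\row_k df k i z) e| <= L].
  move=> /Hr[Uz [h1 h2]]; split.
  - exact: h1.
  - have [|Wz _ _ _] := box (f z); first exact: lt_trans h1 d2d.
    by have [] := sgn _ Wz (fD z Uz).
  - move=> k; split; first exact: Hf.
    by have := fL z Uz => /rowP/(_ k); rewrite !mxE.
  - by have := fconf z Uz; rewrite (rowE 0 z) (rowE 1 z).
  - exact: h2.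
have bV z : V z -> 0 <= g (f z) <-> bd D (f z).
  move=> /Hr[Uz [h1 h2]]; have [|Wz _ _ _] := box (f z); first exact: lt_trans h1 d2d.
  by have [_] := sgn _ Wz (fD z Uz).
have gc z : V z -> {for z, continuous (fun y => g (f y))}.
  move=> Vz; have [h1 _ Hfz _ _] := fV z Vz.
  have [|Wz _ _ _] := box (f z); first exact: lt_trans h1 d2d.
  exact: has_partials_continuous (has_partials_comp (class_C2_partials oW gC2 Wz).1 (fun k => proj1 (proj1 (Hfz k)))).
apply: contrapT => nn.
(* With [z1] within r0 / 3 of [z0], its nearest contact point is also within r0 / 3, and the disc
   reaching it stays inside the disc of radius [r0]. *)
have [z1 z1d nb1] : exists2 z1, odisc z0 (r0 / 3) z1 & ~ bd D (f z1).
  apply: contrapT => H; apply: nn; apply: filterS (odisc_nbhs (a := z0) (r := r0 / 3) _).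
    by move=> z hz; apply: contrapT => nb; apply: H; exists z.
  by rewrite /odisc /= sqdistxx exprn_gt0// divr_gt0.
have cE := compact_superlevel (@cdisc_closed R z0 r0) (@cdisc_compact R z0 r0) gc.
set E := [set _ | _] in cE.
have V0 : V z0 by rewrite /V /cdisc /= sqdistxx sqr_ge0.
have E0 : E z0 by split; [exact: V0|apply/(bV z0 V0); exact: bz0].
have E0' : E !=set0 by exists z0.
have cs : {within E, continuous (sqdist z1)} by exact: continuous_subspaceT (@sqdist_continuous R z1).
have [zs] := compact_EVT_min E0' cE cs; rewrite inE => -[Vzs gzs] min.
have q3 : (r0 / 3) ^+ 2 = r0 ^+ 2 / 9 by field.
have rr0 : 0 < r0 ^+ 2 by rewrite exprn_gt0.
have s10 : sqdist z1 zs < r0 ^+ 2 / 9.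
  have := min z0; rewrite inE => /(_ E0) h; apply: (le_lt_trans h).
  by rewrite sqdistC -q3.
have close z : sqdist z1 z <= sqdist z1 zs -> sqdist z0 z < r0 ^+ 2.
  move=> h; apply: (le_lt_trans (sqdist_triangle z0 z1 z)).
  have : sqdist z0 z1 < r0 ^+ 2 / 9 by rewrite -q3.
  by lra.
have V1 : V z1 by apply: ltW; apply: close; rewrite sqdistxx sqdist_ge0.
have zs1 : zs != z1.
  by apply/eqP => e0; apply: nb1; apply/(bV z1 V1); rewrite -e0.
pose r1 := Num.sqrt (sqdist z1 zs).
have r1s : r1 ^+ 2 = sqdist z1 zs by rewrite sqr_sqrtr ?sqdist_ge0.
apply: (hopf_disc oD psh ex oW gC2 DW d0 c00 C10 ee e1 box L0 fV (z1 := z1) (zs := zs) (r := r1)).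
- by rewrite sqrtr_gt0 sqdist_gt0.
- by move=> z; rewrite /cdisc /= r1s => /close/ltW.
- by apply: filterS (@odisc_cdisc _ z0 r0) (odisc_nbhs (close _ (lexx _))).
- by rewrite r1s.
- by apply/eqP; rewrite eq_le gzs andbT; have [_ h _ _ _] := fV _ Vzs.
- move=> z; rewrite r1s => h; rewrite ltNge; apply/negP => gz.
  have Ez : E z by split; [apply: ltW; apply: close; exact: ltW|exact: gz].
  by have := min z; rewrite inE => /(_ Ez); rewrite leNgt h.
Qed.

End Contact.

(** * Conformal harmonic maps of surfaces *)

Section Planar.
Variable R : realType.
Local Notation plane := 'rV[R]_2.

Lemma planar_harmonic_coord n (U : set plane) (h : plane -> 'rV[R]_n) z k :
  open U -> planar_harmonic U h -> U z -> harmonic_at (fun y => h y 0 k) z.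
Proof.
move=> oU [h1 h2] Uz; eexists; eexists; split; first exact: class_C2_row oU h1 Uz.
by have /rowP/(_ k) := h2 z Uz; rewrite !mxE.
Qed.

Lemma planar_harmonic_row n (U : set plane) (h : plane -> 'rV[R]_n) : open U ->
  (forall z k, U z -> harmonic_at (fun y => h y 0 k) z) -> planar_harmonic U h.
Proof.
move=> oU H; have hC2 : class_Ck 2 U h.
  by apply: class_C2_of_row => z k /(H z k)[g [l [Hh _]]]; exists g, l.
split => // z Uz; apply/rowP => k; rewrite !mxE; have [g [l [Hh Lh]]] := H z k Uz.
have Hk := class_C2_row k oU hC2 Uz.
apply: etrans Lh; congr (_ + _).
  by apply: etrans (esym (has_partials2_val Hk 0 0)) (has_partials2_val Hh 0 0).
by apply: etrans (esym (has_partials2_val Hk 1 1)) (has_partials2_val Hh 1 1).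
Qed.

Lemma conformal_at_near n (f h : plane -> 'rV[R]_n) z : {near z, f =1 h} ->
  conformal_at f z -> conformal_at h z.
Proof.
move=> E; have e i : partial i f z = partial i h z.
  by apply: near_eq_derive.
by rewrite /conformal_at !e.
Qed.

(** The conformality equations are continuous in the first derivatives, so they pass from a dense
    set to the points where the extension was not yet known to satisfy them. *)
Lemma conformal_at_closure n (U : set plane) (h : plane -> 'rV[R]_n) z : open U -> class_Ck 2 U h ->
  U z -> closure [set y | conformal_at h y] z -> conformal_at h z.
Proof.
move=> oU hC2 Uz cz.
have cp i j : dot (partial i h y) (partial j h y) @[y --> z] --> dot (partial i h z) (partial j h z).
  apply: (@cvg_fin_sum _ _ (nbhs z)) => k; have [Hk _] := class_C2_row k oU hC2 Uz.
  by have [_ a] := nbhs_singleton Hk i; have [_ b] := nbhs_singleton Hk j; exact: (cvgM a b).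
have zero (q : plane -> R) : q y @[y --> z] --> q z -> (forall y, conformal_at h y -> q y = 0) -> q z = 0.
  move=> cq q0; apply/eqP; rewrite -normr_le0 leNgt; apply/negP => qz.
  have N : \forall y \near z, 0 < `|q y| by exact: (cvgr_gt _ (cvg_norm cq)).
  by have [y [/= /q0 qy]] := cz _ N; rewrite qy normr0 ltxx.
split; last by apply: (zero (fun y => dot (partial 0 h y) (partial 1 h y))) => // y [].
apply/eqP; rewrite -subr_eq0; apply/eqP.
apply: (zero (fun y => dot (partial 0 h y) (partial 0 h y) - dot (partial 1 h y) (partial 1 h y))).
  exact: (cvgB (cp 0 0) (cp 1 1)).
by move=> y [e _]; apply/eqP; rewrite subr_eq0; apply/eqP; exact: e.
Qed.

Lemma planar_harmonic_continuous n (U : set plane) (h : plane -> 'rV[R]_n) z :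
  open U -> planar_harmonic U h -> U z -> {for z, continuous h}.
Proof.
move=> oU [hC2 _] Uz.
exact: (has_partials_row_continuous (fun k => proj1 (class_C2_row k oU hC2 Uz))).
Qed.

Lemma closure_image (S T : topologicalType) (A : set S) (f : S -> T) (D : set T) x :
  {for x, continuous f} -> closure A x -> (forall y, A y -> D (f y)) -> closure D (f x).
Proof. by move=> cf cx AD V /cf/cx[y [Ay Vy]]; exists (f y); split; [exact: AD|]. Qed.

Lemma harmonic_cst n (U : set plane) (v : 'rV[R]_n) : open U ->
  planar_conformal_harmonic U (fun=> v).
Proof.
move=> oU; split; first by apply: planar_harmonic_row => // z k _; exact: harmonic_at_cst.
by move=> z _; rewrite /conformal_at /partial !derive_cst; split => //; rewrite /dot big1// => i _; rewrite mxE mul0r.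
Qed.

Lemma discE : @disc R = odisc 0 1.
Proof. by apply/seteqP; split => z; rewrite /disc /odisc /sqdist /= subr0 expr1n. Qed.

Lemma punctured_disc_dense (z : plane) : @disc R z -> closure (@punctured_disc R) z.
Proof.
move=> dz; have [-> V V0|/eqP z0] := eqVneq z 0; last by apply: subset_closure; split.
have N : nbhs (0 : plane) (@disc R).
  by rewrite discE; apply: odisc_nbhs; rewrite /odisc /= sqdistxx expr1n.
have [d d0 Hd] := near0_norm (filterI V0 N).
have dh : 0 < d / 2 by rewrite divr_gt0.
have [|Vy dy] := Hd ((d / 2) *: delta_mx 0 0).
  rewrite normrZ gtr0_norm// (le_lt_trans (y := d / 2 * 1))//; last by lra.
  by rewrite ler_pM2l// delta_norm.
rewrite addr0 in Vy dy; exists ((d / 2) *: delta_mx 0 0); split => //; split => //.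
by move=> /rowP/(_ 0)/eqP; rewrite !mxE !eqxx mulr1 gt_eqF.
Qed.

End Planar.

Section Bounded.
Variable R : realType.

Lemma bounded_row n (D : set 'rV[R]_n) : bounded_set D -> exists B, forall y k, D y -> `|y 0 k| <= B.
Proof.
move=> [B [_ H]]; exists (B + 1) => y k Dy; apply: (le_trans (mx_norm_le y k)).
by apply: H Dy; rewrite ltrDl.
Qed.

Lemma closure_not_bd n (D : set 'rV[R]_n) y : closure D y -> ~ bd D y -> D y.
Proof.
move=> cD nb; apply: contrapT => nD; apply: nb; split => // /interior_subset; exact: nD.
Qed.

Lemma bd_not_mem n (D : set 'rV[R]_n) y : open D -> bd D y -> ~ D y.
Proof. by move=> oD [_ ni] Dy; apply: ni; rewrite (interior_id D).1. Qed.

End Bounded.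

Section Surface.
Variables (R : realType) (M : conformal_surface R) (n : nat).
Local Notation plane := 'rV[R]_2.

Lemma harmonic_on_row (f : M -> 'rV[R]_n) :
  (forall k x, mharm (fun y => f y 0 k) x) -> harmonic_on [set: M] f.
Proof.
move=> H c Ac; apply: planar_harmonic_row; first exact: (chart_image_open Ac openT).
by move=> _ k [x [cx _] <-]; exact: H.
Qed.

Lemma harmonic_on_coord (U : set M) (f : M -> 'rV[R]_n) k : open U ->
  harmonic_on U f -> harmonic_on U (fun x => f x 0 k).
Proof.
move=> oU H c Ac; apply: harmonic_at_planar => z Uz.
exact: (planar_harmonic_coord k (chart_image_open Ac oU) (H c Ac) Uz).
Qed.

Lemma harmonic_on_continuous (f : M -> 'rV[R]_n) x : harmonic_on [set: M] f -> {for x, continuous f}.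
Proof.
move=> H; have [c Ac cx] := @atlas_cover R M x; apply/(continuous_chart _ Ac cx).
apply: (planar_harmonic_continuous (chart_image_open Ac openT) (H c Ac)).
by exists x.
Qed.

Lemma conformal_harmonic_contact_open (D : set 'rV[R]_n) rho r (f : M -> 'rV[R]_n) :
  open D -> strongly_2_plurisubharmonic D rho -> exhaustion D rho -> 2 < r -> has_Cr_boundary r D ->
  conformal_harmonic_on [set: M] f -> range f `<=` closure D -> open [set x | bd D (f x)].
Proof.
move=> oD psh ex r2 HB cf fD; rewrite openE => x bx.
have [c Ac cx] := @atlas_cover R M x; apply: (chart_near_dom Ac cx).
apply: (contact_nbhs oD psh ex r2 HB (chart_image_open Ac openT) (cf c Ac)).
- by move=> _ [y _ <-]; apply: fD; exists (chart_inv c (chart_map c y)).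
- by exists x.
- by rewrite /= chart_invK.
Qed.

End Surface.

Theorem corollary1p3 (R : realType) (n : nat) (hn : (3 <= n)%N)
    (r : R) (hr : 2 < r) (D : set 'rV[R]_n)
    (hD : domain D) (hbounded : bounded_set D)
    (hconvex : minimally_convex D) (hboundary : has_Cr_boundary r D) :
  (forall (M : conformal_surface R) (f : M -> 'rV[R]_n),
      connected_open_surface M ->
      conformal_harmonic_on [set: M] f ->
      range f `<=` closure D ->
      range f `<=` D \/ range f `<=` bd D)
  /\
  (forall (M : conformal_surface R) (K : set M),
      connected_open_surface M ->
      removable K ->
      forall f : M -> 'rV[R]_n,
      conformal_harmonic_on (~` K) f ->
      f @` (~` K) `<=` D ->
      exists F : M -> 'rV[R]_n,
        [/\ conformal_harmonic_on [set: M] F,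
            range F `<=` D &
            forall x, (~` K) x -> F x = f x])
  /\
  (forall f : plane R -> 'rV[R]_n,
      planar_conformal_harmonic (@punctured_disc R) f ->
      f @` (@punctured_disc R) `<=` D ->
      exists F : plane R -> 'rV[R]_n,
        [/\ planar_conformal_harmonic (@disc R) F,
            F @` (@disc R) `<=` D &
            forall z, (@punctured_disc R) z -> F z = f z]).

Proof.
have [oD _ [v0 Dv0]] := hD; have [rho [psh ex]] := hconvex.
have [B DB] := bounded_row hbounded.
split; [|split].
- move=> M f [cM _] cf fD.
  have oC := conformal_harmonic_contact_open oD psh ex hr hboundary cf fD.
  have clC : closed [set x | bd D (f x)].
    have clb : closed (bd D).
      by rewrite /bd setDE; apply: closedI; [exact: closed_closure|apply: open_closedC; exact: open_interior].
    apply: (@closed_comp _ _ f (bd D)) => // x _; apply: harmonic_on_continuous => c Ac.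
    by have [] := cf c Ac.
  have [C0|C0] := pselect ([set x | bd D (f x)] !=set0).
    right => _ [x _ <-].
    have : [set x | bd D (f x)] = [set: M].
      by apply: cM => //; [exists [set x | bd D (f x)]; rewrite ?setTI|exists [set x | bd D (f x)]; rewrite ?setTI].
    by move=> /seteqP[_]; exact.
  left => _ [x _ <-]; apply: closure_not_bd => [|b]; first by apply: fD; exists x.
  by apply: C0; exists x.
- move=> M K [cM _] rK f cf fD; have [clK ext] := rK.
  have oW : open (~` K) by exact: closed_openC.
  (* If [K] is all of the surface there is nothing to extend, and a constant map with value in the
     nonempty [D] serves. *)
  have [W0|W0] := pselect ((~` K) !=set0); last first.
    exists (fun=> v0); split; last by move=> x Wx; case: W0; exists x.
      by move=> c Ac; apply: harmonic_cst; exact: (chart_image_open Ac openT).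
    by move=> _ [x _ <-].
  have dense := removable_dense cM rK W0.
  have hf : harmonic_on (~` K) f by move=> c Ac; have [] := cf c Ac.
  have Hext k : exists H : M -> R, harmonic_on [set: M] H /\ forall x, (~` K) x -> H x = f x 0 k.
    apply: ext; first exact: harmonic_on_coord.
    by exists B => x Wx; apply: DB; apply: fD; exists x.
  have [H HH] := choice Hext.
  pose F x := \row_k H k x.
  have Ff x : (~` K) x -> F x = f x.
    by move=> Wx; apply/rowP => k; rewrite mxE; exact: (HH k).2.
  have hF : harmonic_on [set: M] F.
    apply: harmonic_on_row => k x; rewrite (_ : (fun y => F y 0 k) = H k); last first.
      by apply/funext => y; rewrite mxE.
    exact: (harmonic_on_mharm openT (HH k).1).
  have cF : conformal_harmonic_on [set: M] F.
    move=> c Ac; split; first exact: hF.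
    move=> _ [x [cx _] <-].
    have [FC2 _] := hF c Ac; have oU := chart_image_open Ac (@openT M).
    (* Removability gives a harmonic extension componentwise, with no relation between the
       components; conformality is recovered from the dense complement of [K]. *)
    apply: (conformal_at_closure oU FC2); first by exists x.
    move=> V Vx; have NV : nbhs x (chart_map c @^-1` V).
      exact: (chart_map_continuous Ac cx).
    have Nc : nbhs x (chart_dom c) by apply: open_nbhs_nbhs; split => //; exact: atlas_dom_open.
    have [y [Wy [Vy cy]]] := dense x _ (filterI NV Nc).
    exists (chart_map c y); split; last exact: Vy.
    have [_ cfy] := cf c Ac.
    apply: (@conformal_at_near _ _ (f \o chart_inv c)); last by apply: cfy; exists y.
    have NW : nbhs y (~` K) by apply: open_nbhs_nbhs.
    by apply: filterS (chart_near Ac cy NW) => z [y' [_ Wy' _ /= ->]]; rewrite Ff.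
  have FD : range F `<=` closure D.
    move=> _ [x _ <-]; apply: (closure_image (harmonic_on_continuous hF) (dense x)) => y Wy.
    by rewrite Ff//; apply: fD; exists y.
  (* A boundary value at [x] would be attained on a whole neighbourhood of [x]. That neighbourhood
     contains a point off [K], where the extension equals [f] and lies in the open set [D]. *)
  exists F; split => // _ [x _ <-]; apply: closure_not_bd => [|b]; first by apply: FD; exists x.
  have oC := conformal_harmonic_contact_open oD psh ex hr hboundary cF FD.
  have N : nbhs x [set x | bd D (F x)] by apply: open_nbhs_nbhs.
  have [y [Wy by_]] := dense x _ N; apply: (bd_not_mem oD by_).
  by rewrite Ff//; apply: fD; exists y.
move=> f cf fD.
have oP : open (@punctured_disc R).
  rewrite /punctured_disc discE setDE; apply: openI; first exact: odisc_open.
  apply: closed_openC; exact: (accessible_closed_set1 (hausdorff_accessible (@norm_hausdorff _ _))).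
have od : open (@disc R) by rewrite discE; exact: odisc_open.
have [hf cof] := cf.
have Hext k : exists v : plane R -> R, (forall z, odisc 0 1 z -> harmonic_at v z) /\
    (forall z, odisc 0 1 z -> z != 0 -> v z = f z 0 k).
  apply: (@removable_point _ _ B) => z dz z0.
  have Pz : @punctured_disc R z by split; [rewrite discE|exact/eqP].
  split; first exact: (planar_harmonic_coord k oP hf Pz).
  by apply: DB; apply: fD; exists z.
have [H HH] := choice Hext.
pose F z := \row_k H k z.
have Ff z : @punctured_disc R z -> F z = f z.
  move=> [dz z0]; apply/rowP => k; rewrite mxE; apply: (HH k).2; [by rewrite -discE|exact/eqP].
have hF : planar_harmonic (@disc R) F.
  apply: planar_harmonic_row => // z k dz; rewrite (_ : (fun y => F y 0 k) = H k); last first.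
    by apply/funext => y; rewrite mxE.
  by apply: (HH k).1; rewrite -discE.
have dense z : @disc R z -> closure (@punctured_disc R) z by exact: punctured_disc_dense.
have cF : planar_conformal_harmonic (@disc R) F.
  split; first exact: hF.
  move=> z dz; apply: (conformal_at_closure od hF.1 dz).
  apply: closure_subset (dense z dz) => y Py /=; apply: conformal_at_near (cof y Py).
  have : nbhs y (@punctured_disc R) by apply: open_nbhs_nbhs.
  by apply: filterS => w /Ff.
have FD z : @disc R z -> closure D (F z).
  move=> dz; apply: (closure_image (planar_harmonic_continuous od hF dz) (dense z dz)) => y Py.
  by rewrite Ff//; apply: fD; exists y.
exists F; split => // _ [z dz <-]; apply: closure_not_bd => [|b]; first exact: FD.
have N := contact_nbhs oD psh ex hr hboundary od cF FD dz b.
have [y [Py by_]] := dense z dz _ N; apply: (bd_not_mem oD by_).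
by rewrite Ff//; apply: fD; exists y.
Qed.
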